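(* For every integer $x$ with $|x|\geq2$, the numbers $\psi(x^{-1})$, $\Delta(x^{-1})$, and $B_4(x^{-1})$ are irrational, and $$\mu\!\left(\psi(x^{-1})\right)\leq\frac{18}{7},\qquad \mu\!\left(\Delta(x^{-1})\right)\leq\frac{18\pi^2}{7\pi^2-24},\qquad \mu\!\left(B_4(x^{-1})\right)\leq3.$$
   Context: For $|r|<1$: $$\psi(r):=\sum_{n=0}^{\infty}r^{n(n+1)/2},\qquad \Delta(r):=\sum_{m=0}^{\infty}d(2m+1)r^m=\sum_{k=0}^\infty\frac{r^k}{1-r^{2k+1}},\qquad B_4(r):=\sum_{n=0}^{\infty}b_4(n)r^n=\frac{(r^4;r^4)_\infty}{(r;r)_\infty},$$ where $d(n)$ is the number of positive divisors of the positive integer $n$, $b_4(n)$ is the number of partitions of $n$ using no part divisible by $4$ (with $b_4(0)=1$), and $(u;r)_\infty=\prod_{j\ge0}(1-ur^j)$. For a real irrational number $\xi$, its irrationality measure is $$\mu(\xi):=\sup\left\{\mu>0:0<\left|\xi-\frac PQ\right|<Q^{-\mu}\text{ for infinitely many }(P,Q)\in\mathbb Z\times\mathbb Z_{>0}\right\}.$$ *)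

(* Defs.v *)
From mathcomp Require Import all_boot all_order all_algebra.
From mathcomp Require Import all_classical all_reals all_analysis.
Import Order.TTheory GRing.Theory Num.Theory.
Import numFieldNormedType.Exports.

Set Implicit Arguments.
Unset Strict Implicit.
Unset Printing Implicit Defensive.

Local Open Scope classical_set_scope.
Local Open Scope ring_scope.

(* Every power series below converges for |r| < 1; outside that disc [limn]
   may return a junk value. *)

Definition psi (R : realType) (r : R) : R :=
  limn (series (fun n : nat => r ^+ (n * n.+1)./2)).

Definition num_divisors (n : nat) : nat := size (divisors n).

Definition Delta (R : realType) (r : R) : R :=
  limn (series (fun m : nat => (num_divisors m.*2.+1)%:R * r ^+ m)).

(* A partition of n is encoded by its multiplicities: [m i] is the number of
   parts equal to i, so [\sum_i i * m i = n], where i and [m i] are at most n.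
   The index i = 0 is not a part; it is divisible by 4, so the second condition
   already forces [m 0 = 0]. *)
Definition b4 (n : nat) : nat :=
  #|[set m : {ffun 'I_n.+1 -> 'I_n.+1} |
      ((\sum_(i < n.+1) i * m i)%N == n) &&
      [forall i : 'I_n.+1, (4 %| i)%N ==> (m i == 0%N :> nat)]]%SET|.

Definition B4 (R : realType) (r : R) : R :=
  limn (series (fun n : nat => (b4 n)%:R * r ^+ n)).

(* The supremum is taken in the extended reals, so that it is +oo when the set
   of exponents is unbounded. *)
Definition irrationality_measure (R : realType) (xi : R) : \bar R :=
  ereal_sup [set nu%:E | nu in [set nu : R | 0 < nu /\
    infinite_set [set PQ : int * int | 0 < PQ.2 /\
      0 < `|xi - PQ.1%:~R / PQ.2%:~R| < PQ.2%:~R `^ (- nu)]]].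

(* Main.v *)
(* Let p = x and l = ln |p|.  Each of the three numbers xi has linear forms
   Q_N xi - P_N and common denominators D_N with
     ln |Q_N| <= a l N^2 + O(N),  ln |D_N| <= d l N^2 + o(N^2),
     ln |Q_N xi - P_N| = - b l N^2 + O(N),
   which yields the measure 1 + (a + d) / (b - d).

   For psi and Delta the forms come from a series sum_k T_k whose terms contain
   prod_(1 <= i <= N) (1 - q^k p^(2(N+i))), q = p^-2, and so vanish for
   N < k <= 2N.  Summing it exactly, by the q-binomial theorem for psi and by
   partial fractions for Delta, gives Q_N xi plus a rational number; the terms
   with k <= N are rational and those with k > 2N are tiny, whence a = b = 3.
   The denominators are counted through cyclotomic polynomials at x: the ones of
   even index contribute 2/3 to d, and for Delta the factors Phi_e(x) with e odd,
   e <= 2N+1, contribute 8/pi^2 more, by the sum of 1/n^2 over odd n.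

   For B_4, Heine's contiguous relations give a continued fraction whose
   convergents become integral after multiplication by a power of x:
   d = 0 and b = a / 2. *)
Require Import Defs.
From mathcomp Require Import all_boot all_order all_algebra all_field.
From mathcomp Require Import all_classical all_reals all_analysis.
From mathcomp Require Import zify ring lra.
Import Order.TTheory GRing.Theory Num.Theory.
Import numFieldNormedType.Exports.
Local Open Scope classical_set_scope.
Local Open Scope ring_scope.

(** * A criterion for irrationality measures *)

(** Each form is bounded from below as well as from above: a remainder series has the size of its
    first term, and the error of a convergent is an exact product of partial numerators times a tail
    close to 1. For psi and Delta, b = 3 is the balance N^2 - (2N+1)^2 = -3N^2 + O(N) of the
    normalising power p^(N^2) against the first term after the gap, k = 2N+1; a = 3 is the largest
    exponent among the coefficients of xi. For B_4, clearing denominators costs p^(N^2), while the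
    first 2N partial numerators multiply to about p^(-3N^2/2), so a = 1 and b = 1/2. The 2/3 in d
    arises as 1 - 1/3: the cyclotomic factors of odd index in the product of p^(2j) - 1, j <= N,
    carry the exponent N^2/3 and need not be cleared. The functions psi and B_4 are given by power
    series, but the argument needs them as products. One limit for Heine's continued fraction
    supplies both: base r with s = -1 gives Gauss's product for psi, base -r with s = 1 the product
    for B_4. *)

Lemma near_infty_ge (P : nat -> Prop) :
  (\forall n \near \oo, P n) -> exists N, forall n, (N <= n)%N -> P n.
Proof. by case=> N _ H; exists N. Qed.

Lemma exists_nat_ge4 (a b c d : nat) :
  exists n, [/\ a <= n, b <= n, c <= n & d <= n]%N.
Proof. by exists (a + b + c + d)%N; split; lia. Qed.

Lemma exists_natr_gt (R : realType) (y : R) : exists n : nat, y < n%:R.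
Proof. by exists (Num.truncn y).+1; exact: truncnS_gt. Qed.

(* Only a bounded number of fractions have a given denominator. *)
Lemma infinite_rat_approx (R : realType) (xi nu : R) (K : nat) : 0 < nu ->
  infinite_set [set PQ : int * int | 0 < PQ.2 /\
      0 < `|xi - PQ.1%:~R / PQ.2%:~R| < PQ.2%:~R `^ (- nu)] ->
  exists PQ : int * int, [/\ K%:Z <= PQ.2, 0 < PQ.2 &
    0 < `|xi - PQ.1%:~R / PQ.2%:~R| < PQ.2%:~R `^ (- nu)].
Proof.
move=> nu0; apply: contra_notP => no.
have [M hM] := exists_natr_gt _ (K%:R * (`|xi| + 1) : R).
(* If Q < K, then |P| is at most [M]; shifting P by [M.+1] makes it a natural number, so these pairs
   are the image of a finite box. *)
pose f (ij : nat * nat) : int * int := (ij.1%:Z - M.+1%:Z, ij.2%:Z).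
apply: (@sub_finite_set _ _ (f @` [set ij | ((ij.1 < 2 * M + 3) && (ij.2 < K))%N]%classic)); last first.
  apply: finite_image.
  apply: (@sub_finite_set _ _ (`I_(2*M+3) `*` `I_K)%classic).
    by move=> [i j] /= /andP[].
  by apply: finite_setX; apply: finite_II.
move=> [P Q] /= [Q0 PQ].
have QK : Q < K%:Z.
  rewrite ltNge; apply/negP => KQ; apply: no; exists (P, Q); by split.
have Q1 : (1 : R) <= Q%:~R by rewrite -[1]/(1%:~R) ler_int.
have Qp : (0 : R) < Q%:~R by apply: lt_le_trans Q1.
have le1 : (Q%:~R : R) `^ (- nu) <= 1.
  rewrite -[leRHS](powRr0 (Q%:~R : R)).
  by apply: ler_powR => //; rewrite oppr_le0 ltW.
case/andP: PQ => _ PQ.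
have h1 : `|P%:~R : R| <= K%:R * (`|xi| + 1).
  have -> : (P%:~R : R) = Q%:~R * (P%:~R / Q%:~R) by rewrite mulrCA divff ?mulr1 ?gt_eqF.
  rewrite normrM (gtr0_norm Qp); apply: ler_pM => //; first exact: ltW.
    by rewrite (_ : K%:R = (K%:Z)%:~R) // ler_int ltW.
  have := ler_normB xi (xi - P%:~R / Q%:~R); rewrite opprB addrC subrK => h.
  by apply: (le_trans h); rewrite lerD2l; apply: (le_trans (ltW PQ)).
have h2 : `|P| <= M%:Z.
  have : `|P|%:~R < M%:R :> R by rewrite intr_norm; exact: le_lt_trans h1 hM.
  by rewrite (_ : M%:R = (M%:Z)%:~R) // ltr_int; lia.
exists (absz (P + M.+1%:Z), absz Q) => /=; first by lia.
by rewrite /f /=; congr pair; lia.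
Qed.

(* A linear form [Q_n xi - P_n] bounded on both sides makes the usual
   determinant condition superfluous: if [P/Q] equals [P_n/Q_n], the lower
   bound itself separates [xi] from [P/Q]. *)
Lemma irrationality_criterion (R : realType) (xi A B : R) (Q P : nat -> R) :
  0 < A -> 0 < B ->
  (\forall n \near \oo, Q n \is a Num.int /\ P n \is a Num.int) ->
  (forall e, 0 < e -> \forall n \near \oo,
     `|Q n| <= expR ((A + e) * n%:R ^+ 2)) ->
  (\forall n \near \oo, Q n * xi - P n != 0) ->
  (forall e, 0 < e -> \forall n \near \oo,
     `|Q n| * expR (- ((A + B + e) * n%:R ^+ 2)) <= `|Q n * xi - P n| <=
     expR (- ((B - e) * n%:R ^+ 2))) ->
  irrational xi /\ (irrationality_measure xi <= (1 + A / B)%:E)%E.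
Proof.
move=> A0 B0 hint hQ hL0 hL; split.
  move/rationalP => [a [b xiE]].
  (* The denominator given by [rationalP] may be 0, where the quotient is 0; then 0/1 serves. *)
  have [b' b'0 [a' xiE']] : exists2 b' : nat, (0 < b')%N & exists a' : int, xi = a'%:~R / b'%:R.
    case: b xiE => [|b] xiE; last by exists b.+1 => //; exists a.
    by exists 1%N => //; exists 0; rewrite xiE invr0 mulr0 mul0r.
  have [N1 hN1] := near_infty_ge _ hint.
  have B20 : 0 < B / 2 by lra.
  have [N2 hN2] := near_infty_ge _ (hL _ B20).
  have [N3 hN3] := exists_natr_gt _ (b'%:R * 2 / B).
  have [N4 hN4] := near_infty_ge _ hL0.
  have [n [n1 nN1 nN2]] := exists_nat_ge4 1 N1 N2 (N3 + N4).
  move=> nN34; have nN3 := leq_trans (leq_addr _ _) nN34.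
  have L0 := hN4 n (leq_trans (leq_addl _ _) nN34).
  have [Qi Pi] := hN1 n nN1.
  have /andP[_ hi] := hN2 n nN2.
  have bp : (0 : R) < b'%:R by rewrite ltr0n.
  have E : b'%:R * `|Q n * xi - P n| = `|Q n * a'%:~R - P n * b'%:R|.
    by rewrite -[in LHS](gtr0_norm bp) -normrM xiE'; congr `|_|; field; lra.
  have ge1 : 1 <= b'%:R * `|Q n * xi - P n|.
    rewrite E; apply: norm_intr_ge1.
      by rewrite rpredB // rpredM // ?intr_int ?natr_int.
    by rewrite -normr_gt0 -E mulr_gt0 // normr_gt0.
  have : b'%:R * `|Q n * xi - P n| <= b'%:R * expR (- ((B - B / 2) * n%:R ^+ 2)).
    by rewrite ler_pM2l.
  rewrite expRN; set e := expR _ => h3.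
  have e0 : 0 < e by exact: expR_gt0.
  have : e <= b'%:R.
    by rewrite -[e]mul1r -ler_pdivlMr //; exact: le_trans h3.
  suff : b'%:R < e by lra.
  apply: (@lt_le_trans _ _ (1 + (B - B / 2) * n%:R ^+ 2)); last exact: expR_ge1Dx.
  have {}n1 : (1 : R) <= n%:R by rewrite ler1n.
  have n2 : b'%:R * 2 / B < n%:R by apply: (lt_le_trans hN3); rewrite ler_nat.
  move: n2; rewrite ltr_pdivrMr // => n2.
  have : n%:R * B <= n%:R ^+ 2 * B by rewrite ler_pM2r // expr2; nra.
  lra.
rewrite /irrationality_measure; apply: ge_ereal_sup => _ [nu [nu0 inf] <-].
rewrite lee_fin leNgt; apply/negP => gt.
have gap : 0 < nu * B - A - B.
  have : (1 + A / B) * B < nu * B by rewrite ltr_pM2r.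
  by rewrite mulrDl mul1r divfK ?gt_eqF //; lra.
(* For e <= 1 the product (A+B+2e)(1+e) exceeds A+B by at most e(A+B+4), so the last condition
   yields k < nu below. *)
have [e [e0 e1 eB eD]] : exists e, [/\ 0 < e, e <= 1, e <= B / 2 &
    e * (2 * (A + B + 4 + nu)) <= nu * B - A - B].
  exists (Num.min 1 (Num.min (B / 2) ((nu * B - A - B) / (2 * (A + B + 4 + nu))))).
  have D0 : 0 < 2 * (A + B + 4 + nu) by lra.
  split; rewrite ?lt_min ?ltr01 ?divr_gt0 //=; first by rewrite ge_min lexx.
    by rewrite !ge_min lexx orbT.
  by rewrite -ler_pdivlMr // !ge_min lexx !orbT.
have Be : 0 < B - e by lra.
(* [k] is the exponent that the forms achieve: from n^2 <= (1+e) ln(2y) / (B-e) it follows that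
   (A+B+2e) n^2 <= k ln(2y). *)
have [k [k0 knu kE]] : exists k,
    [/\ 0 < k, k < nu & k * (B - e) = (A + B + 2 * e) * (1 + e)].
  exists ((A + B + 2 * e) * (1 + e) / (B - e)); rewrite divfK ?gt_eqF //.
  split=> //; first by rewrite divr_gt0 // mulr_gt0; lra.
  rewrite ltr_pdivrMr //.
  have : e * e <= e by rewrite ler_piMr // ltW.
  have : e * A <= e * A by [].
  nra.
have [N1 hN1] := near_infty_ge _ hint.
have [N2 hN2] := near_infty_ge _ (hQ _ e0).
have [N3 hN3] := near_infty_ge _ (hL _ e0).
have [N4 hN4] := exists_natr_gt _ (4 / e).
have [N5 hN5] := near_infty_ge _ hL0.
have [N0 [N01 N02 N03 N045]] := exists_nat_ge4 N1 N2 N3 (N4 + N5).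
have N04 := leq_trans (leq_addr _ _) N045.
(* A denominator above [K1] forces the index [n] chosen below to exceed [N0], so that n-1 competes
   in the minimality; one above [K2] absorbs the 2 in k ln(2y) < nu ln y. *)
have [K1 hK1] := exists_natr_gt _ (expR ((B - e) * N0%:R ^+ 2)).
have [K2 hK2] := exists_natr_gt _ (expR (k * ln 2 / (nu - k))).
have [[P' Q'] [/= KQ Q0 /andP[pos lt]]] := infinite_rat_approx _ _ _ (K1 + K2)%N nu0 inf.
have yp : 0 < Q'%:~R :> R by rewrite ltr0z.
have yi : Q'%:~R \is a @Num.int R by exact: intr_int.
have yK : (K1 + K2)%:R <= Q'%:~R :> R.
  by rewrite (_ : (K1 + K2)%:R = ((K1 + K2)%N%:Z)%:~R) // ler_int.
move: (Q'%:~R : R) yp yi yK pos lt => y yp yi yK pos lt.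
have yK1 : expR ((B - e) * N0%:R ^+ 2) < y.
  apply: (lt_le_trans hK1); apply: le_trans yK; rewrite ler_nat; exact: leq_addr.
have yK2 : expR (k * ln 2 / (nu - k)) < y.
  apply: (lt_le_trans hK2); apply: le_trans yK; rewrite ler_nat; exact: leq_addl.
have ex : exists n, (N0 <= n)%N && (2 * y < expR ((B - e) * n%:R ^+ 2)).
  have [N6 hN6] := exists_natr_gt _ (2 * y / (B - e)).
  exists (N0 + N6.+1)%N; rewrite leq_addr /=.
  move: (N0 + N6.+1)%N (leq_addl N0 N6.+1) => n nN6.
  apply: (@lt_le_trans _ _ (1 + (B - e) * n%:R ^+ 2)); last exact: expR_ge1Dx.
  have n1 : (1 : R) <= n%:R by rewrite ler1n; exact: leq_trans nN6.
  have n2 : 2 * y / (B - e) < n%:R.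
    by apply: (lt_le_trans hN6); rewrite ler_nat ltnW.
  move: n2; rewrite ltr_pdivrMr // => n2.
  have : n%:R * (B - e) <= n%:R ^+ 2 * (B - e).
    by rewrite ler_pM2r // expr2 ler_peMr.
  lra.
case: (ex_minnP ex) => n /andP[nN0 hn] min.
have nN0' : (N0 < n)%N.
  rewrite ltn_neqAle nN0 andbT; apply/eqP => E.
  move: hn; rewrite -E; lra.
have n0 : (n.-1 < n)%N by rewrite prednK // (leq_ltn_trans _ nN0').
have N0n1 : (N0 <= n.-1)%N by rewrite -ltnS prednK // (leq_ltn_trans _ nN0').
have hn1 : expR ((B - e) * n.-1%:R ^+ 2) <= 2 * y.
  rewrite leNgt; apply/negP => h.
  by have := min n.-1; rewrite h andbT => /(_ N0n1); rewrite leqNgt n0.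
have [Qi Pi] := hN1 n (leq_trans N01 nN0).
have hQn := hN2 n (leq_trans N02 nN0).
have /andP[lo hi] := hN3 n (leq_trans N03 nN0).
have L0 := hN5 n (leq_trans (leq_trans (leq_addl _ _) N045) nN0).
clear hint hQ hL hL0 inf hN1 hN2 hN3 hN5 N045 min ex hK1 hK2 yK yK1 gt eB eD KQ.
have n4 : 4 / e < n.-1%:R.
  by apply: (lt_le_trans hN4); rewrite ler_nat (leq_trans N04).
have nE : n%:R = n.-1%:R + 1 :> R by rewrite natr1 prednK // (leq_ltn_trans _ nN0').
have nn : n%:R ^+ 2 <= (1 + e) * n.-1%:R ^+ 2 :> R.
  rewrite nE; move: n4; rewrite ltr_pdivrMr //.
  have : 0 <= n.-1%:R :> R by exact: ler0n.
  set m : R := n.-1%:R => m0 n4.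
  have m1 : 1 <= m.
    have : m * e <= m by rewrite ler_piMr.
    lra.
  have h1 : m * 4 <= m * (m * e) by apply: ler_wpM2l => //; lra.
  rewrite sqrrD1 expr2; lra.
have [l lE l2] : exists2 l, expR l = 2 * y & l = ln 2 + ln y.
  by exists (ln 2 + ln y); rewrite // expRD !lnK // posrE.
have hl : (B - e) * n.-1%:R ^+ 2 <= l by rewrite -ler_expR lE.
have hk : k * l < nu * ln y.
  rewrite l2; have : k * ln 2 / (nu - k) < ln y.
    by rewrite -ltr_expR lnK.
  rewrite ltr_pdivrMr ?subr_gt0 //; lra.
have l0 : 0 <= l by apply: le_trans hl; rewrite mulr_ge0 ?sqr_ge0 // ltW.
have hnl : (A + B + 2 * e) * n%:R ^+ 2 <= k * l.
  have : k * ((B - e) * n.-1%:R ^+ 2) <= k * l by rewrite ler_pM2l.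
  rewrite mulrA kE; apply: le_trans; rewrite -mulrA ler_pM2l //; lra.
have [E|NE] := eqVneq (Q n * P'%:~R) (P n * y).
  have h : `|Q n| * `|xi - P'%:~R / y| = `|Q n * xi - P n|.
    rewrite -normrM mulrBr mulrA E mulfK ?gt_eqF //.
  have Qn0 : 0 < `|Q n|.
    rewrite normr_gt0; apply: contraNneq L0 => Qn0.
    move: E; rewrite Qn0 !mul0r => /esym/eqP.
    by rewrite mulf_eq0 (gt_eqF yp) orbF => /eqP ->; rewrite subr0.
  have : expR (- (k * l)) <= `|xi - P'%:~R / y|.
    rewrite -(ler_pM2l Qn0) h; apply: le_trans lo; rewrite ler_pM2l // ler_expR.
    have : 0 <= e * n%:R ^+ 2 by rewrite mulr_ge0 ?sqr_ge0 // ltW.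
    by move: hnl; lra.
  apply/negP; rewrite -ltNge; apply: (lt_trans lt).
  rewrite /powR gt_eqF // ltr_expR; lra.
(* A nonzero integer has size at least 1, and y |Q_n xi - P_n| accounts for at most half of it; the
   other half bounds |xi - P'/y| from below. *)
have ge1 : 1 <= `|Q n * P'%:~R - P n * y|.
  apply: norm_intr_ge1; last by rewrite subr_eq0.
  by apply: rpredB; apply: rpredM => //; exact: intr_int.
have : `|Q n * P'%:~R - P n * y| <= y * (`|Q n| * `|xi - P'%:~R / y|) + y * `|Q n * xi - P n|.
  rewrite -normrM -[y in y * `|_| + _]gtr0_norm // -[y in _ + y * _]gtr0_norm // -!normrM.
  rewrite -[leRHS]addrC; apply: le_trans (ler_normB _ _).
  rewrite le_eqVlt; apply/orP; left; apply/eqP; congr `|_|.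
  by field; rewrite gt_eqF.
have : y * `|Q n * xi - P n| <= 1 / 2.
  apply: (@le_trans _ _ (y * expR (- ((B - e) * n%:R ^+ 2)))); first by rewrite ler_pM2l.
  rewrite expRN ler_pdivrMr ?expR_gt0 //; lra.
move=> h1 h2.
have h3 : 1 <= 2 * y * (`|Q n| * `|xi - P'%:~R / y|) by lra.
have : expR (- (k * l)) <= `|xi - P'%:~R / y|.
  have : 1 <= expR l * (expR ((A + e) * n%:R ^+ 2) * `|xi - P'%:~R / y|).
    apply: (le_trans h3); rewrite lE ler_pM2l ?mulr_gt0 //.
    by apply: ler_wpM2r.
  rewrite mulrA -expRD => h4.
  rewrite expRN -[leLHS]mul1r ler_pdivrMr ?expR_gt0 //.
  apply: (le_trans h4); rewrite mulrC; apply: ler_wpM2l => //.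
  rewrite ler_expR.
  have : l <= (B - e) * n%:R ^+ 2 by rewrite -ler_expR lE ltW.
  have : 0 <= e * n%:R ^+ 2 by rewrite mulr_ge0 ?sqr_ge0 // ltW.
  lra.
apply/negP; rewrite -ltNge; apply: (lt_trans lt).
rewrite /powR gt_eqF // ltr_expR; lra.
Qed.

(** * Cyclotomic factors of q-factorials *)

Section CyclotomicFactors.
Variables (R : realType) (x : int).
Hypothesis hx : 2 <= `|x|.
Let p : R := x%:~R.

Lemma base_ge2 : 2 <= `|p|.
Proof. by rewrite /p -intr_norm (_ : 2 = 2%:~R) // ler_int. Qed.

Lemma base_neq0 : p != 0.
Proof. by rewrite -normr_gt0; apply: lt_le_trans base_ge2. Qed.

Lemma norm_exp_ge2 n : (0 < n)%N -> 2 <= `|p| ^+ n.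
Proof.
case: n => // n _; rewrite exprS; apply: le_trans base_ge2 _.
by rewrite ler_peMr ?normr_ge0 // exprn_ege1 //; apply: le_trans base_ge2; lra.
Qed.

Lemma expB1_bounds n : (0 < n)%N ->
  `|p| ^+ n / 2 <= `|p ^+ n - 1| <= 2 * `|p| ^+ n.
Proof.
move=> n0; have := norm_exp_ge2 _ n0.
have := lerB_normD (p ^+ n) (- 1); have := ler_normD (p ^+ n) (- 1).
rewrite normrN1 !normrX; lra.
Qed.

Lemma expB1_neq0 n : (0 < n)%N -> p ^+ n - 1 != 0.
Proof.
move=> n0; rewrite -normr_gt0; have /andP[+ _] := expB1_bounds _ n0.
have := norm_exp_ge2 _ n0; lra.
Qed.

Definition cyc n : R := ('Phi_n).[x]%:~R.

Lemma prod_cyc n : (0 < n)%N -> \prod_(d <- divisors n) cyc d = p ^+ n - 1.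
Proof.
move=> n0; have := congr1 (fun P : {poly int} => (P.[x])%:~R : R) (prod_Cyclotomic n0).
rewrite horner_prod hornerD hornerXn hornerN hornerC rmorph_prod /= => ->.
by rewrite intrD rmorphXn rmorphN.
Qed.

Lemma cyc_int n : cyc n \is a Num.int.
Proof. exact: intr_int. Qed.

Lemma cyc_neq0 n : (0 < n)%N -> cyc n != 0.
Proof.
move=> n0; have := expB1_neq0 _ n0; rewrite -prod_cyc // prodf_seq_neq0.
by move/allP/(_ n); rewrite /= -dvdn_divisors // dvdnn => /(_ isT).
Qed.

Lemma norm_cyc_ge1 n : (0 < n)%N -> 1 <= `|cyc n|.
Proof. by move=> n0; apply: norm_intr_ge1; rewrite ?cyc_int ?cyc_neq0. Qed.

(* [cycfact M f a]: the number [a] is a product of values of the cyclotomic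
   polynomials at [x], with the exponent [f e] for the index [e < M]. *)
Definition cycfact M (f : nat -> nat) (a : R) :=
  a = \prod_(1 <= e < M) cyc e ^+ f e.

Lemma cycfactM M f g a b : cycfact M f a -> cycfact M g b ->
  cycfact M (fun e => f e + g e)%N (a * b).
Proof.
by move=> -> ->; rewrite /cycfact -big_split; apply: eq_bigr => e _; rewrite exprD.
Qed.

Lemma cycfact_ext M f g a : (forall e, (0 < e < M)%N -> f e = g e) ->
  cycfact M f a -> cycfact M g a.
Proof. by move=> fg ->; apply: eq_big_nat => e /fg ->. Qed.

Lemma cycfact_neq0 M f a : cycfact M f a -> a != 0.
Proof.
move=> ->; rewrite prodf_seq_neq0; apply/allP => e.
by rewrite mem_index_iota => /andP[e0 _]; rewrite expf_neq0 // cyc_neq0.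
Qed.

Lemma cycfact_int M f g a b : cycfact M f a -> cycfact M g b ->
  (forall e, (0 < e < M)%N -> (g e <= f e)%N) -> a / b \is a Num.int.
Proof.
move=> -> -> gf; rewrite -prodfV -big_split big_seq rpred_prod // => e.
rewrite mem_index_iota => eM; have e0 : (0 < e)%N by case/andP: eM.
rewrite /= -exprVn -{1}(subnKC (gf _ eM)) exprD mulrAC -exprMn divff ?cyc_neq0 //.
by rewrite expr1n mul1r rpredX // cyc_int.
Qed.

Lemma cycfact_one M : cycfact M (fun=> 0%N) 1.
Proof. by rewrite /cycfact big1. Qed.

Lemma cycfact_expB1 M n : (0 < n < M)%N ->
  cycfact M (fun e => (e %| n)%N) (p ^+ n - 1).
Proof.
case/andP=> n0 nM; rewrite /cycfact -prod_cyc //.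
rewrite [RHS](eq_bigr (fun e => if (e %| n)%N then cyc e else 1)); last first.
  by move=> e _; case: (e %| n)%N; rewrite ?expr1.
rewrite -big_mkcond -[in RHS]big_filter; apply: perm_big; apply: uniq_perm.
- exact: divisors_uniq.
- by rewrite filter_uniq // iota_uniq.
move=> e; rewrite mem_filter mem_index_iota -dvdn_divisors //.
have [en|//] := boolP (e %| n)%N.
rewrite (dvdn_gt0 n0 en) /=; apply/esym; exact: leq_ltn_trans (dvdn_leq n0 en) nM.
Qed.

Definition evprod n : R := \prod_(1 <= j < n.+1) (p ^+ (2 * j) - 1).
Definition odprod n : R := \prod_(0 <= j < n) (p ^+ (2 * j).+1 - 1).
Definition oddpart m := (m`_(2^'))%N.
Definition oddpartprod n : R := \prod_(1 <= m < n.+1) (p ^+ oddpart m - 1).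

Lemma evprodS n : evprod n.+1 = evprod n * (p ^+ (2 * n.+1) - 1).
Proof. by rewrite /evprod big_nat_recr. Qed.

Lemma odprodS n : odprod n.+1 = odprod n * (p ^+ (2 * n).+1 - 1).
Proof. by rewrite /odprod big_nat_recr. Qed.

Lemma oddpartprodS n : oddpartprod n.+1 = oddpartprod n * (p ^+ oddpart n.+1 - 1).
Proof. by rewrite /oddpartprod big_nat_recr. Qed.

Lemma evprod0 : evprod 0 = 1. Proof. by rewrite /evprod big_nil. Qed.
Lemma odprod0 : odprod 0 = 1. Proof. by rewrite /odprod big_nil. Qed.
Lemma oddpartprod0 : oddpartprod 0 = 1. Proof. by rewrite /oddpartprod big_nil. Qed.

(** The exponent counts the j <= n with e | 2j, that is e | j for odd e and e/2 | j for even e. *)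
Lemma cycfact_evprod M n : (2 * n < M)%N ->
  cycfact M (fun e => if odd e then n %/ e else n %/ e./2)%N (evprod n).
Proof.
elim: n => [|n IH] nM.
  by rewrite evprod0; apply: cycfact_ext (cycfact_one M) => e _; rewrite !div0n if_same.
rewrite evprodS; apply: cycfact_ext (cycfactM _ _ _ _ _ (IH _) (cycfact_expB1 _ _ _)); try lia.
move=> e /andP[e0 _]; case: ifPn => oe.
  by rewrite Gauss_dvdr ?divnS ?coprimen2 // addnC.
have E : e = (2 * e./2)%N by rewrite mul2n even_halfK.
by rewrite {2}E dvdn_pmul2l // divnS 1?addnC //; lia.
Qed.

(** The exponent counts the j < n with e | 2j+1. For odd e this means e | j + 1 + (e-1)/2, because
    twice that number is 2j+1+e. *)
Lemma cycfact_odprod M n : (2 * n < M.+1)%N ->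
  cycfact M (fun e => if odd e then (n + e./2) %/ e else 0)%N (odprod n).
Proof.
elim: n => [|n IH] nM.
  rewrite odprod0; apply: cycfact_ext (cycfact_one M) => e /andP[e0 _].
  by case: ifP => // _; rewrite add0n divn_small //; lia.
rewrite odprodS; apply: cycfact_ext (cycfactM _ _ _ _ _ (IH _) (cycfact_expB1 _ _ _)); try lia.
move=> e /andP[e0 _]; case: ifPn => oe.
  rewrite addSn divnS // addnC; congr (_ + _)%N; congr nat_of_bool.
  have E : (2 * (n + e./2).+1 = (2 * n).+1 + e)%N by have := odd_double_half e; rewrite oe; lia.
  rewrite -[RHS](@Gauss_dvdr _ 2) ?coprimen2 // E dvdn_addl //.
apply/eqP; rewrite add0n eqb0; apply: contra oe => /dvdn_odd; apply.
by rewrite /= oddM.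
Qed.

Lemma odd_oddpart m : odd (oddpart m).
Proof. by rewrite odd_2'nat part_pnat. Qed.

Lemma oddpart_gt0 m : (0 < oddpart m)%N.
Proof. exact: part_gt0. Qed.

Lemma dvdn_oddpart e m : (0 < m)%N -> (e %| oddpart m)%N = odd e && (e %| m)%N.
Proof.
move=> m0; apply/idP/andP => [em|[oe em]].
  split; last exact: dvdn_trans em (dvdn_part _ _).
  by apply: dvdn_odd em _; exact: odd_oddpart.
have e2 := oe; rewrite odd_2'nat in e2.
by rewrite /oddpart -(part_pnat_id e2) partn_dvd.
Qed.

(** An odd e divides the odd part of m exactly when it divides m, so this product carries precisely
    the odd-index factors of [evprod n]. *)
Lemma cycfact_oddpartprod M n : (n < M)%N ->
  cycfact M (fun e => if odd e then n %/ e else 0)%N (oddpartprod n).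
Proof.
elim: n => [|n IH] nM.
  by rewrite oddpartprod0; apply: cycfact_ext (cycfact_one M) => e _; rewrite div0n if_same.
rewrite oddpartprodS; apply: cycfact_ext (cycfactM _ _ _ _ _ (IH _) (cycfact_expB1 _ _ _)); try lia.
  by move=> e /andP[e0 _]; rewrite dvdn_oddpart //; case: ifPn => // oe; rewrite divnS // addnC.
rewrite oddpart_gt0 /=; apply: leq_ltn_trans nM.
by apply: dvdn_leq => //; exact: dvdn_part.
Qed.

Lemma evprod_neq0 n : evprod n != 0.
Proof. exact: cycfact_neq0 (cycfact_evprod (2 * n).+1 n _). Qed.

Lemma odprod_neq0 n : odprod n != 0.
Proof. exact: cycfact_neq0 (cycfact_odprod (2 * n).+1 n _). Qed.

Lemma oddpartprod_neq0 n : oddpartprod n != 0.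
Proof. exact: cycfact_neq0 (cycfact_oddpartprod n.+1 n _). Qed.

(* The part of [evprod n] carried by the cyclotomic polynomials of even index;
   only this part is needed to clear denominators, whence the constant 2/3. *)
Definition evcycprod n : R := evprod n / oddpartprod n.

Lemma lnbase_gt0 : 0 < ln `|p|.
Proof. by rewrite ln_gt0 //; have := base_ge2; lra. Qed.

Lemma ln2_le_lnbase : ln 2 <= ln `|p|.
Proof. by rewrite ler_ln ?posrE ?base_ge2 //; have := base_ge2; lra. Qed.

Lemma ln_expB1_bounds n : (0 < n)%N ->
  n%:R * ln `|p| - ln `|p| <= ln `|p ^+ n - 1| <= n%:R * ln `|p| + ln `|p|.
Proof.
move=> n0; have b2 := base_ge2; have b0 : 0 < `|p| by lra.
have /andP[lo hi] := expB1_bounds _ n0.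
have e0 : 0 < `|p| ^+ n by rewrite exprn_gt0.
have E : ln (`|p| ^+ n) = n%:R * ln `|p| by rewrite lnXn // mulr_natl.
have l2 := ln2_le_lnbase.
have n1 : 0 < `|p ^+ n - 1| by rewrite normr_gt0 expB1_neq0.
apply/andP; split.
  have : ln (`|p| ^+ n / 2) <= ln `|p ^+ n - 1| by rewrite ler_ln ?posrE ?divr_gt0.
  rewrite ln_div ?posrE // E; lra.
have : ln `|p ^+ n - 1| <= ln (2 * `|p| ^+ n) by rewrite ler_ln ?posrE ?mulr_gt0.
rewrite lnM ?posrE // E; lra.
Qed.

Lemma ln_evprod_bounds n :
  n%:R ^+ 2 * ln `|p| <= ln `|evprod n| <= (n%:R ^+ 2 + 2 * n%:R) * ln `|p|.
Proof.
elim: n => [|n /andP[lo hi]]; first by rewrite evprod0 normr1 ln1; lra.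
have /andP[lo' hi'] := ln_expB1_bounds (2 * n.+1) isT.
rewrite evprodS normrM lnM ?posrE ?normr_gt0 ?evprod_neq0 ?expB1_neq0 //.
move: lo' hi'; rewrite natrM -!natr1; have := lnbase_gt0; nra.
Qed.

Lemma ln_odprod_bounds n :
  (n%:R ^+ 2 - n%:R) * ln `|p| <= ln `|odprod n| <= (n%:R ^+ 2 + n%:R) * ln `|p|.
Proof.
elim: n => [|n /andP[lo hi]]; first by rewrite odprod0 normr1 ln1; lra.
have /andP[lo' hi'] := ln_expB1_bounds (2 * n).+1 isT.
rewrite odprodS normrM lnM ?posrE ?normr_gt0 ?odprod_neq0 ?expB1_neq0 //.
move: lo' hi'; rewrite -!natr1 natrM; have := lnbase_gt0; nra.
Qed.

Lemma oddpart_double m : oddpart (2 * m) = oddpart m.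
Proof.
case: m => // m; rewrite /oddpart partnM // [X in (X * _)%N]part_p'nat ?mul1n //.
Qed.

Lemma oddpart_odd m : odd m -> oddpart m = m.
Proof. by move=> om; rewrite /oddpart part_pnat_id // -odd_2'nat. Qed.

(** Splitting even and odd m gives S(2k) = k^2 + S(k), since the first k odd numbers add up to k^2.
    Iterated, this is a geometric series of ratio 1/4, whence the constant 1/3. *)
Lemma sum_oddpart_ge n : (n ^ 2 <= 3 * \sum_(1 <= m < n.+1) oddpart m)%N.
Proof.
have split2 k : (\sum_(1 <= m < (2 * k).+1) oddpart m =
    k ^ 2 + \sum_(1 <= m < k.+1) oddpart m)%N.
  elim: k => [|k IH]; first by rewrite !big_geq.
  rewrite (_ : 2 * k.+1 = (2 * k).+2)%N; last by lia.
  rewrite big_nat_recr // big_nat_recr //= IH.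
  rewrite [in RHS]big_nat_recr //= oddpart_odd; last by rewrite /= oddM.
  rewrite (_ : (2 * k).+2 = 2 * k.+1)%N; last by lia.
  rewrite oddpart_double; lia.
elim/ltn_ind: n => n IH.
have [->|n0] := posnP n; first by rewrite big_geq.
have h := IH n./2 ltac:(lia).
have [on|en] := boolP (odd n).
  have E : n = (2 * n./2).+1 by have := odd_double_half n; rewrite on; lia.
  rewrite {2}E big_nat_recr //= split2 oddpart_odd; last by rewrite -E.
  nia.
have E : n = (2 * n./2)%N by rewrite mul2n even_halfK.
rewrite {2}E split2; nia.
Qed.

Lemma ln_oddpartprod_ge n :
  (n%:R ^+ 2 / 3 - n%:R) * ln `|p| <= ln `|oddpartprod n|.
Proof.
have : ((\sum_(1 <= m < n.+1) oddpart m)%:R - n%:R) * ln `|p| <= ln `|oddpartprod n|.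
  elim: n => [|n IH]; first by rewrite big_geq // oddpartprod0 normr1 ln1; lra.
  have /andP[lo' _] := ln_expB1_bounds _ (oddpart_gt0 n.+1).
  rewrite big_nat_recr //= oddpartprodS normrM lnM ?posrE ?normr_gt0
    ?oddpartprod_neq0 ?expB1_neq0 ?oddpart_gt0 //.
  rewrite natrD -natr1; lra.
apply: le_trans; rewrite ler_pM2r ?lnbase_gt0 //.
have : ((n ^ 2)%:R <= (3 * \sum_(1 <= m < n.+1) oddpart m)%:R :> R).
  by rewrite ler_nat sum_oddpart_ge.
rewrite natrM natrX; lra.
Qed.

Lemma evcycprod_neq0 n : evcycprod n != 0.
Proof. by rewrite mulf_neq0 ?invr_eq0 ?evprod_neq0 ?oddpartprod_neq0. Qed.

Lemma ln_evcycprod_le n :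
  ln `|evcycprod n| <= (2 / 3 * n%:R ^+ 2 + 3 * n%:R) * ln `|p|.
Proof.
rewrite normrM normfV ln_div ?posrE ?normr_gt0 ?evprod_neq0 ?oddpartprod_neq0 //.
have := ln_oddpartprod_ge n; have /andP[_] := ln_evprod_bounds n; lra.
Qed.

End CyclotomicFactors.

(** * The sum of 1/n^2 over odd n *)

Section Basel.
Variable R : realType.
Implicit Types y : R.

Lemma cvg_within (f : R -> R) a b : (forall z, derivable f z 1) ->
  {within `[a, b], continuous f}.
Proof.
move=> df; apply: continuous_subspaceT => z.
exact/differentiable_continuous/derivable1_diffP.
Qed.

Lemma sin_le_id y : 0 <= y -> sin y <= y.
Proof.
move=> y0; pose f := fun z : R => z - sin z.
have df (z : R) : is_derive z 1 f (1 - cos z).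
  by apply: is_deriveB.
have [|c _] := @MVT_segment R f (fun z => 1 - cos z) 0 y y0 (fun z _ => df z).
  by apply: cvg_within => z; have := df z; case.
rewrite /f sin0 !subr0 => E.
have : 0 <= y - sin y by rewrite E mulr_ge0 // subr_ge0 cos_le1.
by rewrite subr_ge0.
Qed.

(** This is y <= tan y without the quotient; the difference has derivative z sin z. *)
Lemma mul_cos_le_sin y : 0 <= y <= pi -> y * cos y <= sin y.
Proof.
move=> /andP[y0 ypi]; pose f := fun z : R => sin z - z * cos z.
have df (z : R) : is_derive z 1 f (z * sin z).
  apply: is_derive_eq; rewrite /GRing.scale /=; ring.
have [|c /andP[c0 cy]] := @MVT_segment R f (fun z => z * sin z) 0 y y0 (fun z _ => df z).
  by apply: cvg_within => z; have := df z; case.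
rewrite /f sin0 mul0r !subr0 => E.
have : 0 <= sin y - y * cos y.
  rewrite E mulr_ge0 // mulr_ge0 // sin_ge0_pi //.
  by move: c0 cy; rewrite /= !bnd_simp => -> c1; apply: le_trans ypi.
by rewrite subr_ge0.
Qed.

Let ang n k : R := (2 * k + 1)%:R * pi / 2 ^+ n.+2.

Let ang_gt0 n k : 0 < ang n k.
Proof.
rewrite /ang addn1; apply: divr_gt0; last exact: exprn_gt0.
by apply: mulr_gt0; [exact: ltr0Sn | exact: pi_gt0].
Qed.

Let ang_lt n k : (k < 2 ^ n)%N -> ang n k < pi / 2.
Proof.
move=> kn; rewrite /ang exprS.
have h : (2 * k + 1)%:R < 2 ^+ n.+1 :> R.
  by rewrite -natrX ltr_nat expnS; lia.
have f0 : 0 < 2 ^+ n.+1 :> R by exact: exprn_gt0.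
rewrite ltr_pdivrMr ?mulr_gt0 // mulrC -!mulrA ltr_pM2l ?pi_gt0 //.
by rewrite mulrA mulVf // mul1r.
Qed.

(* Halving the angles in 1/sin^2(2t) = (1/sin^2 t + 1/cos^2 t)/4 evaluates the
   sum exactly; comparing 1/sin^2 with 1/t^2 then gives the odd Basel sum. *)
Let csc2 n : \sum_(0 <= k < 2 ^ n) (sin (ang n k)) ^- 2 = 2 * 4 ^+ n.
Proof.
have pi0 : 0 < pi :> R := pi_gt0 R.
elim: n => [|n IH].
  rewrite expn0 big_nat1 /ang expr0 mulr1 muln0 add0n mul1r.
  have s0 : (sin (pi / 2 ^+ 2)) ^+ 2 = 1 / 2 :> R.
    have := cos_mulr2n (pi / 2 ^+ 2 : R).
    rewrite (_ : (pi / 2 ^+ 2) *+ 2 = pi / 2 :> R); last by field.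
    rewrite cos_pihalf cos2sin2; lra.
  by rewrite s0; field.
rewrite (@big_cat_nat _ _ _ (2 ^ n)) //=; last by rewrite expnS; lia.
(* Read backwards, the second half of the angles consists of the complements of the first half,
   which turns sin into cos. *)
rewrite [X in _ + X]big_nat_rev /= -{2}[(2 ^ n)%N]add0n big_addn.
rewrite (_ : 2 ^ n.+1 - 2 ^ n = 2 ^ n)%N; last by rewrite expnS; lia.
rewrite -big_split /= exprS mulrCA -IH mulr_sumr.
apply: eq_big_nat => k kn.
have kn' : (k < 2 ^ n)%N by case/andP: kn.
set t := ang n.+1 k.
have -> : ang n.+1 (2 ^ n + 2 ^ n.+1 - (k + 2 ^ n).+1) = pi / 2 - t.
  rewrite /t /ang (_ : 2 * (2 ^ n + 2 ^ n.+1 - (k + 2 ^ n).+1) + 1 = 2 ^ n.+2 - (2 * k + 1))%N; last first.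
    rewrite !expnS; lia.
  rewrite natrB; last by rewrite !expnS; lia.
  rewrite natrX [2 ^+ n.+3]exprS; field.
  by rewrite expf_neq0.
have E : ang n k = t *+ 2.
  by rewrite /t /ang [2 ^+ n.+3]exprS -mulr_natl; field; rewrite expf_neq0.
have tlt : t < pi / 2 by apply: ang_lt; rewrite expnS; lia.
have t0 : 0 < t by exact: ang_gt0.
have s0 : sin t != 0 by rewrite gt_eqF // sin_gt0_pihalf // t0.
have c0 : cos t != 0 by rewrite gt_eqF // cos_gt0_pihalf // tlt andbT; lra.
rewrite (_ : sin (pi / 2 - t) = cos t); last first.
  by rewrite sinB sin_pihalf cos_pihalf mul1r mul0r subr0.
rewrite E sin_mulr2n -mulr_natl.
have := cos2Dsin2 t => h.
transitivity ((cos t ^+ 2 + sin t ^+ 2) / (cos t ^+ 2 * sin t ^+ 2)).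
  by field; rewrite s0 c0.
by rewrite h; field; rewrite s0 c0.
Qed.

Definition sum_odd_invsq n : R := \sum_(0 <= k < n) ((2 * k + 1)%:R ^+ 2)^-1.

Lemma sum_odd_invsq_mono m n : (m <= n)%N -> sum_odd_invsq m <= sum_odd_invsq n.
Proof.
move=> mn; rewrite /sum_odd_invsq [leRHS](@big_cat_nat _ _ _ m) //= lerDl.
by apply: sumr_ge0 => k _; rewrite invr_ge0 sqr_ge0.
Qed.

(** The upper estimate is 1/sin^2 = cot^2 + 1 <= 1/t^2 + 1: the 2^n extra units against a total of 2
    4^n leave an error of order 2^-n. *)
Let bounds n : sum_odd_invsq (2 ^ n) <= pi ^+ 2 / 8 <=
  sum_odd_invsq (2 ^ n) + pi ^+ 2 / 16 / 2 ^+ n.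
Proof.
have pi0 : 0 < pi :> R := pi_gt0 R.
have h4 : (4 : R) ^+ n = 2 ^+ n * 2 ^+ n by rewrite -exprMn; congr (_ ^+ n); ring.
have e0 : 0 < 2 ^+ n :> R by exact: exprn_gt0.
have S : \sum_(0 <= k < 2 ^ n) (ang n k) ^- 2 =
    16 * 4 ^+ n / pi ^+ 2 * sum_odd_invsq (2 ^ n).
  rewrite /sum_odd_invsq mulr_sumr; apply: eq_bigr => k _.
  rewrite /ang [2 ^+ n.+2]exprS [2 ^+ n.+1]exprS h4.
  have k1 : 2 * k%:R + 1 != 0 :> R by rewrite -natrM natr1 pnatr_eq0.
  by move: (@pi R) pi0 => P P0; field; rewrite k1 !gt_eqF.
have c4 : 0 < 16 * 4 ^+ n / pi ^+ 2 :> R by rewrite divr_gt0 ?mulr_gt0 ?exprn_gt0.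
apply/andP; split.
  have : \sum_(0 <= k < 2 ^ n) (ang n k) ^- 2 <= 2 * 4 ^+ n.
    rewrite -csc2; apply: ler_sum_nat => k /andP[_ kn].
    have s0 : 0 < sin (ang n k) by rewrite sin_gt0_pihalf // ang_gt0 ang_lt.
    rewrite lef_pV2 ?posrE ?exprn_gt0 //.
    by rewrite ler_sqr ?nnegrE ?(ltW s0) ?(ltW (ang_gt0 _ _)) // sin_le_id // ltW.
  rewrite S -ler_pdivlMl // => h; apply: (le_trans h).
  rewrite le_eqVlt; apply/orP; left; apply/eqP.
  have f0 : 0 < 4 ^+ n :> R by exact: exprn_gt0.
  by move: (@pi R) pi0 => P P0; field; rewrite !gt_eqF.
have : 2 * 4 ^+ n <= \sum_(0 <= k < 2 ^ n) ((ang n k) ^- 2 + 1).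
  rewrite -csc2; apply: ler_sum_nat => k /andP[_ kn].
  have s0 : 0 < sin (ang n k) by rewrite sin_gt0_pihalf // ang_gt0 ang_lt.
  have c0 : 0 < cos (ang n k).
    by rewrite cos_gt0_pihalf // ang_lt // andbT; have := ang_gt0 n k; lra.
  have a0 := ang_gt0 n k.
  have hc : ang n k * cos (ang n k) <= sin (ang n k).
    by apply: mul_cos_le_sin; rewrite ltW //=; have := ang_lt n k kn; lra.
  have hcs := cos2Dsin2 (ang n k).
  move: s0 c0 a0 hc hcs; set s := sin _; set c := cos _; set a := ang _ _ => s0 c0 a0 hc hcs.
  have -> : s ^- 2 = (c / s) ^+ 2 + 1.
    rewrite -[1 in RHS](divff (_ : s ^+ 2 != 0)) ?expf_neq0 ?gt_eqF //.
    by rewrite expr_div_n -mulrDl hcs div1r.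
  rewrite lerD2r -exprVn ler_sqr ?nnegrE ?divr_ge0 ?invr_ge0 ?(ltW s0) ?(ltW c0) ?(ltW a0) //.
  by rewrite ler_pdivrMr // mulrC ler_pdivlMr // mulrC.
rewrite big_split /= S sumr_const_nat subn0 natrX => h.
have {h} : 2 * 4 ^+ n - 2 ^+ n <= 16 * 4 ^+ n / pi ^+ 2 * sum_odd_invsq (2 ^ n) by lra.
rewrite -ler_pdivrMl // => h.
rewrite -lerBlDr; apply: le_trans h.
rewrite le_eqVlt; apply/orP; left; apply/eqP; rewrite h4.
by move: (@pi R) pi0 => P P0; field; rewrite !gt_eqF.
Qed.

Lemma sum_odd_invsq_le n : sum_odd_invsq n <= pi ^+ 2 / 8.
Proof.
have /andP[+ _] := bounds n; apply: le_trans; apply: sum_odd_invsq_mono.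
by apply: ltnW; exact: ltn_expl.
Qed.

Lemma sum_odd_invsq_near e : 0 < e ->
  exists N, forall n, (N <= n)%N -> pi ^+ 2 / 8 - e <= sum_odd_invsq n.
Proof.
move=> e0; pose m := (Num.truncn (pi ^+ 2 / 16 / e : R)).+1.
exists (2 ^ m)%N => n mn.
apply: le_trans (sum_odd_invsq_mono _ _ mn).
have /andP[_] := bounds m; suff : pi ^+ 2 / 16 / 2 ^+ m <= e by lra.
have pi0 : 0 < pi :> R := pi_gt0 R.
rewrite ler_pdivrMr ?exprn_gt0 // [e * _]mulrC -ler_pdivrMr //.
apply: ltW; apply: (lt_le_trans (truncnS_gt _)).
have -> : 2 ^+ m = (2 ^ m)%:R :> R by rewrite natrX.
rewrite ler_nat.
by apply: ltnW; exact: ltn_expl.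
Qed.

End Basel.

(** * Quadratic growth recovered from sums over odd dilations *)

Lemma linear_le_eps_sqr (R : realType) (c e y : R) : 0 < e ->
  c * y <= e * y ^+ 2 + c ^+ 2 / e.
Proof.
move=> e0; rewrite -subr_ge0.
have -> : e * y ^+ 2 + c ^+ 2 / e - c * y =
    (3 / 4) * c ^+ 2 / e + (e * y - c / 2) ^+ 2 / e by field; rewrite gt_eqF.
have h1 : 0 <= c ^+ 2 := sqr_ge0 _.
have h2 := sqr_ge0 (e * y - c / 2).
by rewrite addr_ge0 // divr_ge0 ?(ltW e0) //; lra.
Qed.

(* A Tauberian statement for sums over odd numbers: upper and lower bounds for
   the density of [s] alternately improve each other, by the factor
   [pi^2/8 - 1 < 1], down to the common value [2/pi^2]. *)
Section OddDensity.
Variables (R : realType) (s : nat -> R) (T : nat -> R).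
Hypothesis s_ge0 : forall X, 0 <= s X.
Hypothesis s0 : s 0%N = 0.
Hypothesis sum_s : forall X n, (X <= n)%N ->
  \sum_(0 <= i < n) s (X %/ (2 * i + 1))%N = T X.
Hypothesis T_bounds : forall X,
  X%:R ^+ 2 / 4 - X%:R - 1 <= T X <= X%:R ^+ 2 / 4 + X%:R + 1.

(** By the odd Basel sum, this is the sum of 1/j^2 over the odd j >= 3. *)
Let kap : R := pi ^+ 2 / 8 - 1.
(** The fixed point of the map sending l to 1/4 - l [kap], which exchanges lower and upper
    densities. *)
Let c : R := 2 / pi ^+ 2.

Let kap_ge0 : 0 <= kap.
Proof.
rewrite subr_ge0; apply: le_trans (sum_odd_invsq_le R 1).
by rewrite /sum_odd_invsq big_nat1 /= muln0 add0n expr1n invr1.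
Qed.

Let kap_lt1 : kap < 1.
Proof. by have := pihalf_lt2 R; have := pi_gt0 R; rewrite /kap; nra. Qed.

Let upper (u : R) := forall e : R, 0 < e ->
  exists2 K : R, 0 <= K & forall X, s X <= (u + e) * X%:R ^+ 2 + K.
Let lower (l : R) := forall e : R, 0 < e ->
  exists2 K : R, 0 <= K & forall X, (l - e) * X%:R ^+ 2 - K <= s X.

Let divn_bounds X i :
  (X%:R / (2 * i + 1)%:R - 1 : R) <= (X %/ (2 * i + 1))%:R <= (X%:R / (2 * i + 1)%:R : R).
Proof.
set j : R := (2 * i + 1)%:R; have j0 : 0 < j by rewrite ltr0n addn1.
apply/andP; split; last by rewrite ler_pdivlMr // -natrM ler_nat leq_trunc_div.
rewrite lerBlDr ler_pdivrMr // natr1 -natrM ler_nat.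
by rewrite ltnW // ltn_ceil // addn1.
Qed.

(** Isolating i = 0 gives s(X) = T(X) minus the values at X/(2i+1), i >= 1. Finitely many of these
    are bounded below, and the others are dropped, being nonnegative. *)
Let lower_upper l : 0 <= l -> lower l -> upper (4^-1 - l * kap).
Proof.
move=> l0 lo e e0; pose d := e / (l + kap + 1).
have lk : 0 < l + kap + 1 by have := kap_ge0; lra.
have d0 : 0 < d by rewrite divr_gt0.
have [K K0 hK] := lo _ d0.
have [D0 hD] := sum_odd_invsq_near R _ d0; pose D := D0.+1.
have {}hD := hD D (leqnSn _).
have [e' e'0 E'] : exists2 e', 0 < e' & e = (l + kap) * d + e'.
  exists d => //; rewrite /d; field; lra.
pose a : R := 1 + 2 * l * D%:R.
exists (1 + K * D%:R + a ^+ 2 / e').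
  apply: addr_ge0; first by apply: addr_ge0 => //; apply: mulr_ge0.
  by apply: divr_ge0; [exact: sqr_ge0 | exact: ltW].
move=> X.
have /andP[_ hT] := T_bounds X.
pose n := (X + D)%N.
have := sum_s X n (leq_addr _ _).
rewrite (@big_cat_nat _ _ _ D) //=; last exact: leq_addl.
rewrite big_nat_recl //= muln0 add0n divn1 => hs.
have h1 : 0 <= \sum_(D <= i < n) s (X %/ (2 * i + 1)) by exact: sumr_ge0.
have h2 : (l - d) * X%:R ^+ 2 * (sum_odd_invsq R D - 1) - 2 * l * X%:R * D%:R - K * D%:R
   <= \sum_(0 <= i < D0) s (X %/ (2 * i.+1 + 1)).
  have -> : sum_odd_invsq R D - 1 = \sum_(0 <= i < D0) ((2 * i.+1 + 1)%:R ^+ 2)^-1.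
    rewrite /sum_odd_invsq big_nat_recl //= muln0 add0n expr1n invr1; ring.
  rewrite mulr_sumr.
  have D0D : D0%:R <= D%:R :> R by rewrite ler_nat.
  have : \sum_(0 <= i < D0) ((l - d) * X%:R ^+ 2 * ((2 * i.+1 + 1)%:R ^+ 2)^-1 - 2 * l * X%:R - K)
     <= \sum_(0 <= i < D0) s (X %/ (2 * i.+1 + 1)).
    apply: ler_sum => i _; apply: le_trans (hK _).
    have /andP[] := divn_bounds X i.+1.
    set j : R := (2 * i.+1 + 1)%:R; set y : R := (X %/ _)%:R => y1 y2.
    have y0 : 0 <= y by exact: ler0n.
    have j1 : 1 <= j by rewrite ler1n addn1.
    have X0 : 0 <= X%:R :> R by exact: ler0n.
    have E : X%:R ^+ 2 * (j ^+ 2)^-1 = (X%:R / j) ^+ 2 by rewrite expr_div_n.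
    rewrite -mulrA E.
    have hX : X%:R / j <= X%:R by rewrite ler_pdivrMr ?ler_peMr //; lra.
    move: y1 y2 hX; set z := X%:R / j => y1 y2 hX.
    have z0 : 0 <= z by rewrite /z divr_ge0 //; lra.
    have q1 : z ^+ 2 - 2 * z <= y ^+ 2.
      have [z1|z1] := leP 1 z; nra.
    have q2 : y ^+ 2 <= z ^+ 2 by nra.
    have q3 : l * (z ^+ 2 - 2 * X%:R) <= l * y ^+ 2 by apply: ler_wpM2l => //; lra.
    have q4 : d * y ^+ 2 <= d * z ^+ 2 by rewrite ler_pM2l.
    lra.
  have cst (a' : R) : \sum_(0 <= i < D0) a' = a' * D0%:R.
    by rewrite sumr_const_nat subn0 mulr_natr.
  rewrite 2!big_split /= !cst => h.
  apply: le_trans h.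
  have X0 : 0 <= 2 * l * X%:R * (D%:R - D0%:R).
    by rewrite mulr_ge0 ?subr_ge0 // !mulr_ge0.
  have X1 : 0 <= K * (D%:R - D0%:R) by rewrite mulr_ge0 ?subr_ge0.
  lra.
have h3 := linear_le_eps_sqr _ a _ X%:R e'0.
have hD2 : sum_odd_invsq R D - 1 <= kap by rewrite lerD2r sum_odd_invsq_le.
have hD3 : kap - d <= sum_odd_invsq R D - 1 by rewrite /kap; lra.
move: hD2 hD3 h2; set v := sum_odd_invsq R D - 1 => hD2 hD3 h2.
have v0 : 0 <= v.
  rewrite /v subr_ge0; apply: le_trans (sum_odd_invsq_mono R 1 D isT).
  by rewrite /sum_odd_invsq big_nat1 /= muln0 add0n expr1n invr1.
have Y0 : 0 <= X%:R ^+ 2 :> R by exact: sqr_ge0.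
have q1 : l * X%:R ^+ 2 * (kap - d) <= l * X%:R ^+ 2 * v by apply: ler_wpM2l => //; exact: mulr_ge0.
have q2 : d * X%:R ^+ 2 * v <= d * X%:R ^+ 2 * kap.
  by apply: ler_wpM2l => //; apply: mulr_ge0 => //; exact: ltW.
have q3 : e * X%:R ^+ 2 = (l + kap) * d * X%:R ^+ 2 + e' * X%:R ^+ 2 by rewrite E' mulrDl.
rewrite /a in h3 *; clear -h1 h2 hs hT h3 q1 q2 q3; lra.
Qed.

(** In this direction the tail i >= [D] cannot be dropped: the crude bound s(Y) <= 3 Y^2 and the
    small tail of the odd Basel sum control it. *)
Let upper_lower u : 0 <= u -> upper u -> lower (4^-1 - u * kap).
Proof.
move=> u0 up e e0; pose d := e / (kap + 4).
have lk : 0 < kap + 4 by have := kap_ge0; lra.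
have d0 : 0 < d by rewrite divr_gt0.
have [K K0 hK] := up _ d0.
have [D0 hD] := sum_odd_invsq_near R _ d0; pose D := D0.+1.
have {}hD := hD D (leqnSn _).
have E' : e = (kap + 3) * d + d by rewrite /d; field; lra.
exists (1 + K * D%:R + 1 ^+ 2 / d).
  apply: addr_ge0; first by apply: addr_ge0 => //; apply: mulr_ge0.
  by apply: divr_ge0; [exact: sqr_ge0 | exact: ltW].
move=> X.
have /andP[hT _] := T_bounds X.
pose n := (X + D)%N.
have := sum_s X n (leq_addr _ _).
rewrite (@big_cat_nat _ _ _ D) //=; last exact: leq_addl.
rewrite big_nat_recl //= muln0 add0n divn1 => hs.
have s3 Y : s Y <= 3 * Y%:R ^+ 2.
  case: Y => [|Y]; first by rewrite s0; lra.
  have : s Y.+1 <= T Y.+1.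
    rewrite -(sum_s Y.+1 Y.+1) // big_nat_recl //= muln0 add0n divn1 lerDl.
    exact: sumr_ge0.
  have /andP[_ h] := T_bounds Y.+1.
  have : 1 <= Y.+1%:R :> R by rewrite ler1n.
  move=> Y1 h'; apply: (le_trans h'); apply: (le_trans h); nra.
have Y0 : 0 <= X%:R ^+ 2 :> R by exact: sqr_ge0.
have sq i : (X %/ (2 * i + 1))%:R ^+ 2 <= X%:R ^+ 2 * ((2 * i + 1)%:R ^+ 2)^-1 :> R.
  have /andP[_ h] := divn_bounds X i.
  by rewrite -expr_div_n ler_sqr // nnegrE ?ler0n // divr_ge0.
have h1 : \sum_(D <= i < n) s (X %/ (2 * i + 1)) <= 3 * d * X%:R ^+ 2.
  apply: (@le_trans _ _ (\sum_(D <= i < n) 3 * X%:R ^+ 2 * ((2 * i + 1)%:R ^+ 2)^-1)).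
    by apply: ler_sum => i _; apply: (le_trans (s3 _)); rewrite -mulrA ler_pM2l.
  rewrite -mulr_sumr [leRHS]mulrAC; apply: ler_wpM2l.
    by rewrite mulr_ge0.
  have := sum_odd_invsq_le R n.
  rewrite /sum_odd_invsq (@big_cat_nat _ _ _ D) //=; last exact: leq_addl.
  move: hD; rewrite /sum_odd_invsq; lra.
have h2 : \sum_(0 <= i < D0) s (X %/ (2 * i.+1 + 1)) <= (u + d) * X%:R ^+ 2 * kap + K * D%:R.
  have D0D : D0%:R <= D%:R :> R by rewrite ler_nat.
  apply: (@le_trans _ _ (\sum_(0 <= i < D0)
     ((u + d) * X%:R ^+ 2 * ((2 * i.+1 + 1)%:R ^+ 2)^-1 + K))).
    apply: ler_sum => i _; apply: (le_trans (hK _)).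
    rewrite lerD2r -mulrA ler_pM2l //; lra.
  rewrite big_split /= sumr_const_nat subn0 -[K *+ _]mulr_natr; apply: lerD; last first.
    by apply: ler_wpM2l.
  rewrite -mulr_sumr; apply: ler_wpM2l; first by rewrite mulr_ge0 //; lra.
  have := sum_odd_invsq_le R D.
  rewrite /sum_odd_invsq big_nat_recl //= muln0 add0n expr1n invr1 /kap; lra.
have h3 := linear_le_eps_sqr _ 1 _ X%:R d0.
have q3 : e * X%:R ^+ 2 = (kap + 3) * d * X%:R ^+ 2 + d * X%:R ^+ 2 by rewrite {1}E' mulrDl.
clear -h1 h2 h3 hs hT q3; lra.
Qed.

Lemma odd_density_le e : 0 < e ->
  exists2 K : R, 0 <= K & forall X, s X <= (2 / pi ^+ 2 + e) * X%:R ^+ 2 + K.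
Proof.
move=> e0.
have P0 := pi_gt0 R.
have c0 : 0 < c by rewrite divr_gt0 ?exprn_gt0.
have cE : 4^-1 - c * kap = c.
  by rewrite /c /kap; move: (@pi R) P0 => P P0; field; rewrite gt_eqF.
(* The start is the trivial lower bound 0 = c - c; one round of both improvements multiplies the
   defect by [kap] squared. *)
have lows n : lower (c - c * kap ^+ (2 * n)).
  elim: n => [|n IH].
    rewrite muln0 expr0 mulr1 subrr => d d0; exists 0 => // X.
    rewrite sub0r subr0; apply: le_trans (s_ge0 _).
    by rewrite mulNr oppr_le0 mulr_ge0 ?sqr_ge0 ?(ltW d0).
  have k2 : kap ^+ (2 * n) <= 1 by rewrite exprn_ile1 // ltW.
  have k2' : 0 <= kap ^+ (2 * n) by exact: exprn_ge0.
  have ck : c * kap ^+ (2 * n) <= c by rewrite ler_piMr // ltW.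
  have ck0 : 0 <= c * kap ^+ (2 * n) by rewrite mulr_ge0 // ltW.
  have := lower_upper _ _ IH; rewrite subr_ge0 => /(_ ck) up.
  have := upper_lower _ _ up.
  rewrite (_ : 4^-1 - (4^-1 - (c - c * kap ^+ (2 * n)) * kap) * kap =
    c - c * kap ^+ (2 * n.+1)); last first.
    rewrite (_ : 2 * n.+1 = (2 * n).+2)%N; last by lia.
    rewrite !exprS; move: cE; set k := kap ^+ _ => cE.
    have E : 4^-1 = c + c * kap by lra.
    rewrite E; ring.
  apply; rewrite mulrBl; have : 0 <= c * kap ^+ (2 * n) * kap by exact: mulr_ge0.
  by move: cE c0; lra.
have [n hn] : exists n, c * kap ^+ (2 * n).+1 <= e / 2.
  have := @cvg_expr R kap; rewrite ger0_norm // => /(_ kap_lt1).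
  move=> /cvgrPdist_le /(_ (e / 2 / c)) [|N _ hN].
    by apply: divr_gt0 => //; apply: divr_gt0.
  exists N; have /hN : (N <= (2 * N).+1)%N by lia.
  rewrite /= sub0r normrN ger0_norm ?exprn_ge0 // ler_pdivlMr //.
  by rewrite mulrC.
have k2 : kap ^+ (2 * n) <= 1 by rewrite exprn_ile1 // ltW.
have ck : c * kap ^+ (2 * n) <= c by rewrite ler_piMr // ltW.
have := lower_upper _ _ (lows n); rewrite subr_ge0 => /(_ ck).
rewrite (_ : 4^-1 - (c - c * kap ^+ (2 * n)) * kap = c + c * kap ^+ (2 * n).+1); last first.
  by rewrite exprSr (_ : 4^-1 = c + c * kap); [ring | lra].
move=> /(_ (e / 2)) [|K K0 hK]; first by rewrite divr_gt0.
exists K => // X; apply: (le_trans (hK X)); rewrite lerD2r.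
apply: ler_wpM2r; first exact: sqr_ge0.
rewrite -/c; lra.
Qed.
End OddDensity.

(** * The product of the cyclotomic values of odd index *)

Section OddCyclotomicProduct.
Variables (R : realType) (x : int).
Hypothesis hx : 2 <= `|x|.
Let p : R := x%:~R.
Let lam : R := ln `|p|.
Let w n : R := ln `|cyc R x n| / lam.

Let lam_gt0 : 0 < lam. Proof. exact: lnbase_gt0. Qed.

Let w_ge0 n : (0 < n)%N -> 0 <= w n.
Proof. by move=> n0; rewrite divr_ge0 ?(ltW lam_gt0) // ln_ge0 // norm_cyc_ge1. Qed.

(** The cofactors of an odd m are odd, so its divisors can be listed as the quotients m/(2i+1). *)
Let perm_divisors m n : odd m -> (m <= n)%N ->
  perm_eq (divisors m) [seq (m %/ (2 * i + 1))%N | i <- index_iota 0 n & (2 * i + 1 %| m)%N].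
Proof.
move=> om mn; have m0 : (0 < m)%N by case: m om mn.
apply: uniq_perm; first exact: divisors_uniq.
  rewrite map_inj_in_uniq ?filter_uniq ?iota_uniq // => i j.
  rewrite !mem_filter => /andP[im _] /andP[jm _] E.
  have : (2 * i + 1 = 2 * j + 1)%N; last by lia.
  move: (divnK im) (divnK jm); rewrite -E; move: (m %/ _)%N => q Ei Ej.
  have q0 : (0 < q)%N by case: q Ei {Ej} => //; rewrite mul0n => m0'; rewrite -m0' in m0.
  by apply/eqP; rewrite -(eqn_pmul2l q0) Ei Ej.
move=> d; rewrite -dvdn_divisors //; apply/idP/mapP => [dm|[i]].
  have oq : odd (m %/ d) by rewrite -(divnK dm) oddM in om; case/andP: om.
  have E : (2 * (m %/ d)./2 + 1 = m %/ d)%N by have := odd_double_half (m %/ d); rewrite oq; lia.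
  exists (m %/ d)./2; last by rewrite E divnA // mulKn.
  rewrite mem_filter E dvdn_div //= mem_index_iota /=.
  have := leq_div m d; lia.
by rewrite mem_filter => /andP[im _] ->; exact: dvdn_div.
Qed.

Let sumw X : R := \sum_(1 <= e < X.+1 | odd e) w e.
Let T X : R := \sum_(1 <= m < X.+1 | odd m) (ln `|p ^+ m - 1| / lam).

Let sumwS X : sumw X.+1 = sumw X + if odd X.+1 then w X.+1 else 0.
Proof. by rewrite /sumw big_mkcond big_nat_recr //= -big_mkcond. Qed.

Let ln_expB1 m : (0 < m)%N -> ln `|p ^+ m - 1| / lam = \sum_(d <- divisors m) w d.
Proof.
move=> m0; rewrite -(prod_cyc _ _ _ m0) normr_prod /w -mulr_suml; congr (_ / _).
have : all (leq 1) (divisors m).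
  by apply/allP => d; rewrite -dvdn_divisors // => /dvdn_gt0; apply.
elim: (divisors m) => [|d s IH] /=; first by rewrite !big_nil ln1.
case/andP=> d0 s0; rewrite !big_cons lnM ?IH // posrE.
  by rewrite normr_gt0 cyc_neq0.
by rewrite -normr_prod normr_gt0 prodf_seq_neq0; apply: sub_all s0 => e; exact: cyc_neq0.
Qed.

(** Each odd m <= X contributes the weights of its divisors d; grouping the pairs (m, d) by the odd
    cofactor m/d gives the left side. In the induction only the i with 2i+1 | X+1 change. *)
Let sum_sumw X n : (X <= n)%N ->
  \sum_(0 <= i < n) sumw (X %/ (2 * i + 1))%N = T X.
Proof.
elim: X => [|X IH] Xn.
  by rewrite [RHS]big_geq // big1 // => i _; rewrite div0n /sumw big_geq.
have -> : T X.+1 = T X + if odd X.+1 then ln `|p ^+ X.+1 - 1| / lam else 0.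
  by rewrite /T big_mkcond big_nat_recr //= -big_mkcond.
rewrite -IH; last by lia.
pose d i := if (2 * i + 1 %| X.+1)%N && odd (X.+1 %/ (2 * i + 1))
  then w (X.+1 %/ (2 * i + 1)) else 0.
rewrite (eq_bigr (fun i => sumw (X %/ (2 * i + 1)) + d i)); last first.
  move=> i _; rewrite /d divnS ?addn1 //.
  case: (boolP (_ %| _)%N) => [dv|_]; last by rewrite add0n addr0.
  by rewrite add1n sumwS.
rewrite big_split /=; congr (_ + _).
case: ifPn => oX; last first.
  rewrite big1 // => i _; rewrite /d; case: ifP => // /andP[dv oq].
  have := congr1 odd (divnK dv); rewrite oddM oq addn1 [odd _.+1]/= oddM => oX'.
  by move: oX oX' => /=; case: (odd X).
rewrite ln_expB1 // (perm_big _ (perm_divisors X.+1 n oX Xn)) big_map big_filter.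
rewrite [RHS]big_mkcond; apply: eq_bigr => i _; rewrite /d.
case: ifPn => [/andP[-> _] //|]; case: ifP => // dv /=.
by have := congr1 odd (divnK dv); move: oX => /=; rewrite oddM => -> /andP[->].
Qed.

(** Each summand is within 1 of m, and the odd m up to X add up to X^2/4 with a linear error. *)
Let T_bounds X : X%:R ^+ 2 / 4 - X%:R - 1 <= T X <= X%:R ^+ 2 / 4 + X%:R + 1.
Proof.
have b m : (0 < m)%N -> m%:R - 1 <= ln `|p ^+ m - 1| / lam <= m%:R + 1.
  move=> m0; have /andP[lo hi] := ln_expB1_bounds R x hx _ m0.
  by rewrite ler_pdivlMr // ler_pdivrMr // mulrBl mulrDl !mul1r lo hi.
have E k : T (2 * k) = T (2 * k).+1 - ln `|p ^+ (2 * k).+1 - 1| / lam.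
  have -> : T (2 * k).+1 = T (2 * k) + ln `|p ^+ (2 * k).+1 - 1| / lam.
    rewrite /T [LHS]big_mkcond big_nat_recr //= -big_mkcond /= oddM //=.
  by rewrite addrK.
have E2 k : T (2 * k.+1) = T (2 * k).+1.
  rewrite /T (_ : 2 * k.+1 = (2 * k).+2)%N; last by lia.
  by rewrite big_mkcond big_nat_recr //= -big_mkcond /= oddM /= addr0.
have main k : k%:R ^+ 2 - k%:R <= T (2 * k) <= k%:R ^+ 2 + k%:R.
  elim: k => [|k /andP[lo hi]]; first by rewrite /T big_geq //; lra.
  have /andP[lo' hi'] := b (2 * k).+1 isT.
  rewrite E2; move: lo hi lo' hi'; rewrite (E k) -!natr1 natrM; lra.
have [oX|eX] := boolP (odd X).
  have XE : X = (2 * X./2).+1 by have := odd_double_half X; rewrite oX; lia.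
  have /andP[] := main X./2.+1; rewrite E2 -XE -natr1.
  have -> : X%:R = 2 * X./2%:R + 1 :> R by rewrite [in LHS]XE -natr1 natrM.
  by have := ler0n R X./2; move=> h lo hi; apply/andP; split; lra.
have XE : X = (2 * X./2)%N by rewrite mul2n even_halfK.
have /andP[] := main X./2; rewrite -XE.
have -> : X%:R = 2 * X./2%:R :> R by rewrite [in LHS]XE natrM.
by have := ler0n R X./2; move=> h lo hi; apply/andP; split; lra.
Qed.

Definition oddcycprod N : R := \prod_(0 <= i < N.+1) cyc R x (2 * i).+1.

Lemma oddcycprod_int N : oddcycprod N \is a Num.int.
Proof. by apply: rpred_prod => i _; exact: cyc_int. Qed.

Lemma oddcycprod_neq0 N : oddcycprod N != 0.
Proof.
rewrite prodf_seq_neq0; apply/allP => i _; apply/implyP => _; exact: cyc_neq0.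
Qed.

Lemma cycfact_oddcycprod M N : ((2 * N).+1 < M)%N ->
  cycfact R x M (fun e => odd e && (e <= (2 * N).+1)%N) (oddcycprod N).
Proof.
rewrite /oddcycprod; elim: N => [|N IH] NM.
  rewrite big_nat1 /cycfact (@big_cat_nat _ _ _ 2) //=.
  rewrite big_nat1 [X in _ * X]big1_seq ?mulr1 ?expr1 // => e.
  rewrite mem_index_iota => /andP[_ /andP[e2 _]].
  by rewrite (_ : (e <= 1)%N = false) ?andbF ?expr0 //; lia.
rewrite big_nat_recr //=.
have c1 : cycfact R x M (fun e => e == (2 * N.+1).+1) (cyc R x (2 * N.+1).+1).
  rewrite /cycfact (@big_cat_nat _ _ _ (2 * N.+1).+1) //=; last by lia.
  rewrite big1_seq ?mul1r => [|e]; last first.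
    by rewrite mem_index_iota => /andP[_ /andP[_ e2]]; rewrite (_ : _ == _ = false) ?expr0 //; lia.
  rewrite big_ltn // eqxx expr1 big1_seq ?mulr1 // => e.
  by rewrite mem_index_iota => /andP[_ /andP[e2 _]]; rewrite (_ : _ == _ = false) ?expr0 //; lia.
apply: cycfact_ext (cycfactM _ _ _ _ _ _ _ (IH _) c1); last by lia.
move=> e _; have [->|ne] := eqVneq e (2 * N.+1).+1.
  have -> : odd (2 * N.+1).+1 = true by rewrite oddS oddM.
  by rewrite leqnn (_ : (_ <= (2 * N).+1)%N = false) //; lia.
rewrite addn0; congr nat_of_bool; case: (boolP (odd e)) => //= oe.
have : e != (2 * N.+1)%N by apply: contraTneq oe => ->; rewrite oddM.
lia.
Qed.

(** The indices run over the odd numbers up to X = 2N+1, so the density (2/pi^2) X^2 becomes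
    (8/pi^2) N^2. *)
Lemma ln_oddcycprod_le e : 0 < e -> exists2 K : R, 0 <= K & forall N,
  ln `|oddcycprod N| <= ((8 / pi ^+ 2 + e) * N%:R ^+ 2 + K) * ln `|p|.
Proof.
move=> e0.
have s0 X : 0 <= sumw X.
  rewrite /sumw big_seq_cond; apply: sumr_ge0 => i /andP[].
  by rewrite mem_index_iota => /andP[i0 _] _; exact: w_ge0.
have s00 : sumw 0 = 0 by rewrite /sumw big_geq.
have e8 : 0 < e / 8 by rewrite divr_gt0.
have [K K0 hK] := odd_density_le _ _ _ s0 s00 sum_sumw T_bounds _ e8.
pose a : R := 2 / pi ^+ 2 + e / 8.
have a0 : 0 < a by rewrite addr_gt0 // divr_gt0 // exprn_gt0 // pi_gt0.
have e2 : 0 < e / 2 by rewrite divr_gt0.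
exists (K + a + (4 * a) ^+ 2 / (e / 2)).
  apply: addr_ge0; first by rewrite addr_ge0 // ltW.
  by apply: divr_ge0; [exact: sqr_ge0 | exact: ltW].
move=> N; have E : ln `|oddcycprod N| = sumw (2 * N).+1 * lam.
  rewrite /oddcycprod; elim: N => [|N IH].
    by rewrite big_nat1 sumwS s00 add0r /= /w divfK ?gt_eqF.
  rewrite big_nat_recr //= normrM lnM ?posrE ?normr_gt0 ?oddcycprod_neq0 ?cyc_neq0 //.
  rewrite IH (_ : 2 * N.+1 = (2 * N).+2)%N; last by lia.
  rewrite [sumw (2 * N).+3]sumwS [sumw (2 * N).+2]sumwS !oddS oddM /= addr0.
  rewrite mulrDl; congr (_ + _).
  by rewrite /w divfK ?gt_eqF.
rewrite E; apply: ler_wpM2r; first exact: ltW.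
apply: (le_trans (hK _)); rewrite -/a -natr1 natrM.
have := linear_le_eps_sqr _ (4 * a) _ N%:R e2.
have : 8 / pi ^+ 2 = 4 * a - e / 2 
  by rewrite /a; move: (@pi R) (pi_gt0 R) => P P0; field; rewrite gt_eqF.
move=> ->; lra.
Qed.
End OddCyclotomicProduct.

(** * q-series *)

Section SeriesLemmas.
Variable R : realType.
Implicit Types (u v : nat -> R) (s t : R).

(** Convergence is carried along with the value, because [limn] of a divergent sequence is a junk
    value. *)
Definition is_sum u s := series u @ \oo --> s.

Lemma is_sum_lim u s : is_sum u s -> limn (series u) = s.
Proof. exact: cvg_lim. Qed.

Lemma is_sum_unique u s t : is_sum u s -> is_sum u t -> s = t.
Proof. by move=> /is_sum_lim <- /is_sum_lim. Qed.

Lemma is_sum_ext u v s : u =1 v -> is_sum u s -> is_sum v s.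
Proof. by move=> uv; rewrite (_ : u = v) //; apply/funext. Qed.

Lemma is_sumD u v s t : is_sum u s -> is_sum v t -> is_sum (fun k => u k + v k) (s + t).
Proof. by move=> us vt; rewrite /is_sum (seriesD u v); exact: cvgD. Qed.

Lemma is_sumZ c u s : is_sum u s -> is_sum (fun k => c * u k) (c * s).
Proof. by move=> us; rewrite /is_sum (seriesZ u c); exact: cvgZr. Qed.

Lemma is_sumB u v s t : is_sum u s -> is_sum v t -> is_sum (fun k => u k - v k) (s - t).
Proof.
move=> us vt; rewrite -[- t]mulN1r.
by apply: is_sum_ext (is_sumD _ _ _ _ us (is_sumZ (-1) _ _ vt)) => k; rewrite mulN1r.
Qed.

Lemma is_sum_big n (c : nat -> R) (u : nat -> nat -> R) (s : nat -> R) :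
  (forall i, (i < n)%N -> is_sum (u i) (s i)) ->
  is_sum (fun k => \sum_(0 <= i < n) c i * u i k) (\sum_(0 <= i < n) c i * s i).
Proof.
elim: n => [|n IH] h.
  rewrite big_geq // /is_sum (_ : series _ = fun=> 0); first exact: cvg_cst.
  by apply/funext => k; rewrite /series /= big1 // => i _; rewrite big_geq.
rewrite big_nat_recr //=.
apply: is_sum_ext (is_sumD _ _ _ _ (IH (fun i Hi => h i (ltnW Hi))) (is_sumZ (c n) _ _ (h n (leqnn _)))).
by move=> k; rewrite [RHS]big_nat_recr.
Qed.

Lemma is_sum_shift n u s : is_sum (fun k => u (n + k)%N) s ->
  is_sum u (\sum_(0 <= k < n) u k + s).
Proof.
move=> us; rewrite /is_sum -(cvg_shiftn n).
rewrite (_ : [sequence series u (k + n)%N]_k =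
   (fun k => \sum_(0 <= k < n) u k + series (fun k => u (n + k)%N) k)).
  by apply: cvgD us; exact: cvg_cst.
apply/funext => k; rewrite /series /= (@big_cat_nat _ _ _ n) //= ?leq_addl //.
congr (_ + _); rewrite -{1}[n]add0n big_addn addnK.
by apply: eq_bigr => i _; rewrite addnC.
Qed.

Lemma is_sum_unshift n u s : is_sum u s ->
  is_sum (fun k => u (n + k)%N) (s - \sum_(0 <= k < n) u k).
Proof.
move=> us; rewrite /is_sum.
rewrite (_ : series (fun k => u (n + k)%N) =
   (fun k => series u (k + n)%N - \sum_(0 <= k < n) u k)).
  apply: cvgB; last exact: cvg_cst.
  by have := us; rewrite /is_sum -(cvg_shiftn n).
apply/funext => k; rewrite /series /= (@big_cat_nat _ _ _ n 0 (k + n)) //= ?leq_addl //.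
rewrite [X in X - _]addrC addrK.
rewrite -[X in _ = \sum_(X <= _ < _) _]add0n big_addn addnK.
by apply: eq_bigr => i _; rewrite addnC.
Qed.

Lemma is_sum_geo_bound (C z : R) u : 0 <= z < 1 -> (forall k, `|u k| <= C * z ^+ k) ->
  exists2 s, is_sum u s & `|s| <= C / (1 - z).
Proof.
move=> /andP[z0 z1] hu.
have z1' : `|z| < 1 by rewrite ger0_norm.
have cg := @cvg_geometric_series R C z z1'.
have cn : cvgn [normed series u].
  apply: (@series_le_cvg _ _ (geometric C z)) => [k|k|k|].
  - exact: normr_ge0.
  - by apply: le_trans (hu k); exact: normr_ge0.
  - exact: hu.
  - by apply/cvg_ex; exists (C * (1 - z)^-1).
have cu := normed_cvg cn.
exists (limn (series u)) => //.
apply: le_trans (lim_series_norm cn) _.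
rewrite -(cvg_lim (@Rhausdorff R) cg); apply: lim_series_le => //.
by apply/cvg_ex; exists (C * (1 - z)^-1).
Qed.

(** With ratio at most 1/4 the later terms add up to at most a third of the first. The lower bound
    is what shows later that the linear forms do not vanish. *)
Lemma is_sum_first_term u : (forall k, `|u k.+1| <= `|u k| / 4) ->
  exists2 s, is_sum u s & `|u 0%N| / 2 <= `|s| <= 2 * `|u 0%N|.
Proof.
move=> hu.
have hk k : `|u k| <= `|u 0%N| * 4^-1 ^+ k.
  elim: k => [|k IH]; first by rewrite expr0 mulr1.
  by apply: (le_trans (hu k)); rewrite exprSr mulrA ler_pM2r.
have [||t ht ht'] := is_sum_geo_bound (`|u 0%N| / 4) 4^-1 (fun k => u (1 + k)%N).
- by lra.
- by move=> k; apply: (le_trans (hk _)); rewrite add1n exprS mulrA.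
exists (u 0%N + t); first by have := is_sum_shift 1 _ _ ht; rewrite big_nat1.
have t4 : `|t| <= `|u 0%N| / 3.
  by apply: (le_trans ht'); rewrite le_eqVlt; apply/orP; left; apply/eqP; field.
have := ler_normD (u 0%N) t; have := lerB_normD (u 0%N) t.
have := normr_ge0 (u 0%N); lra.
Qed.

End SeriesLemmas.

(** * Heine's contiguous relations and Lebesgue's identity *)

Section HeineSeries.
Variables (R : realType) (q : R).
Hypothesis q_small : `|q| <= 1 / 2.

Definition poch (a z : R) n : R := \prod_(0 <= j < n) (1 - a * z ^+ j).

Lemma pochS a z n : poch a z n.+1 = poch a z n * (1 - a * z ^+ n).
Proof. by rewrite /poch big_nat_recr. Qed.

Lemma poch0 a z : poch a z 0 = 1.
Proof. by rewrite /poch big_geq. Qed.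

Lemma poch_recl a z n : poch a z n.+1 = (1 - a) * poch (a * z) z n.
Proof.
rewrite /poch big_nat_recl //= expr0 mulr1; congr (_ * _).
by apply: eq_bigr => j _; rewrite exprS mulrA.
Qed.

Lemma norm_q_le1 : `|q| <= 1.
Proof. by apply: (le_trans q_small); lra. Qed.

Lemma norm_exp_small n : `|q ^+ n| <= 1 / 2 ^+ n.
Proof.
have h : 0 <= `|q| <= 2^-1 by rewrite normr_ge0 -div1r.
by rewrite normrX div1r -exprVn lerXn2r ?nnegrE //; case/andP: h.
Qed.

Lemma one_sub_exp_ge n : 1 / 2 <= 1 - q ^+ n.+1.
Proof.
have h := norm_exp_small n.+1.
have : q ^+ n.+1 <= `|q ^+ n.+1| := ler_norm _.
have : 1 / 2 ^+ n.+1 <= 1 / 2 :> R.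
  by rewrite ler_pM2l // lef_pV2 ?posrE ?exprn_gt0 // exprS ler_peMr // exprn_ege1 //; lra.
lra.
Qed.

Lemma poch_qq_neq0 n : poch q q n != 0.
Proof.
elim: n => [|n IH]; first by rewrite poch0 oner_neq0.
by rewrite pochS mulf_neq0 // -exprS gt_eqF //; have := one_sub_exp_ge n; lra.
Qed.

Definition tri k := (k * k.+1)./2.

Lemma triS k : tri k.+1 = (tri k + k.+1)%N.
Proof.
rewrite /tri (_ : k.+1 * k.+2 = k * k.+1 + k.+1.*2)%N; last by rewrite -mul2n; lia.
by rewrite halfD odd_double andbF add0n doubleK.
Qed.

(** The terms of the basic hypergeometric series 1phi1(-b; 0; q, -qw); at w = 1 this is the series
    in Lebesgue's identity. *)
Definition heine_term b w k : R :=
  q ^+ tri k * w ^+ k * poch (- b) q k / poch q q k.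

(** The quotient of Pochhammer products is at most 4^k, and q^(tri k) outweighs it. The constant 8 =
    2^3 comes from 3k <= 3 + tri k, with equality at k = 2 and k = 3. *)
Lemma heine_term_bound b w k : `|b| <= 1 -> `|w| <= 1 ->
  `|heine_term b w k| <= 8 * `|w| ^+ k * 2^-1 ^+ k.
Proof.
move=> b1 w1.
have hp : `|poch (- b) q k / poch q q k| <= 4 ^+ k.
  elim: k => [|k IH]; first by rewrite !poch0 divr1 normr1 expr0.
  rewrite !pochS invfM mulrACA normrM exprSr ler_pM //.
  rewrite normrM normfV ler_pdivrMr; last first.
    by rewrite normr_gt0 -exprS gt_eqF //; have := one_sub_exp_ge k; lra.
  have h1 := one_sub_exp_ge k; have h2 : `|b * q ^+ k| <= 1.
    by rewrite normrM mulr_ile1 // normrX exprn_ile1 // norm_q_le1.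
  rewrite mulNr opprK -exprS [leRHS](_ : _ = 4 * (1 - q ^+ k.+1)); last by rewrite ger0_norm; lra.
  apply: (le_trans (ler_normD _ _)); rewrite normr1; lra.
rewrite /heine_term -mulrA normrM normrM [`|w ^+ k|]normrX.
rewrite [leRHS](_ : _ = (8 * 2^-1 ^+ k) * `|w| ^+ k); last by ring.
rewrite mulrAC; apply: ler_pM => //.
apply: (@le_trans _ _ (1 / 2 ^+ tri k * 4 ^+ k)).
  by apply: ler_pM => //; exact: norm_exp_small.
have p2 n : 0 < 2 ^+ n :> R by exact: exprn_gt0.
rewrite exprVn div1r mulrC ler_pdivrMr // mulrAC ler_pdivlMr // (_ : 4 = 2 ^+ 2 :> R); last by rewrite expr2; ring.
rewrite (_ : 8 = 2 ^+ 3 :> R); last by ring.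
rewrite -exprM -!exprD; apply: ler_weXn2l; first by lra.
have : (3 * k <= 3 + tri k)%N.
  elim: k {hp} => [|k IH] //; rewrite triS; case: k IH => [|[|k]]; rewrite ?triS //; lia.
lia.
Qed.

Definition heine b w : R := limn (series (heine_term b w)).

Lemma heine_sum b w : `|b| <= 1 -> `|w| <= 1 -> is_sum R (heine_term b w) (heine b w).
Proof.
move=> b1 w1; have z01 : 0 <= (2^-1 : R) < 1 by lra.
have [k|s hs _] := is_sum_geo_bound R 8 2^-1 (heine_term b w) z01.
  apply: (le_trans (heine_term_bound _ _ _ b1 w1)).
  rewrite ler_pM2r ?exprn_gt0 ?invr_gt0 // ler_piMr //.
  by apply: exprn_ile1.
by rewrite /heine (is_sum_lim _ _ _ hs).
Qed.

Lemma heine_sub1_le b w : `|b| <= 1 -> `|w| <= 1 -> `|heine b w - 1| <= 8 * `|w|.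
Proof.
move=> b1 w1; have z01 : 0 <= (2^-1 : R) < 1 by lra.
have [k|s hs hs'] := is_sum_geo_bound R (4 * `|w|) 2^-1 (fun k => heine_term b w (1 + k)) z01.
  apply: (le_trans (heine_term_bound _ _ _ b1 w1)); rewrite add1n !exprS.
  rewrite [leRHS](_ : _ = 4 * `|w| * 1 * 2^-1 ^+ k); last by ring.
  rewrite [leLHS](_ : _ = 4 * `|w| * `|w| ^+ k * 2^-1 ^+ k); last by field.
  rewrite ler_pM2r ?exprn_gt0 ?invr_gt0 // ler_wpM2l ?mulr_ge0 //.
  exact: exprn_ile1.
have := is_sum_shift _ 1 _ _ hs; rewrite big_nat1 /heine_term expr0 !poch0 /tri /= mulr1 divr1 mulr1.
move=> /(is_sum_unique _ _ _ _ (heine_sum _ _ b1 w1)) ->.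
rewrite addrC addKr; apply: (le_trans hs').
by rewrite le_eqVlt; apply/orP; left; apply/eqP; field.
Qed.

Lemma norm_mulq_le1 b : `|b| <= 1 -> `|b * q| <= 1.
Proof. by move=> b1; rewrite normrM mulr_ile1 // norm_q_le1. Qed.

(** The constant terms on the left cancel, and term k+1 of the difference is term k of the right
    side. The relation in w below is obtained in the same way. *)
Lemma heine_shift_b b w : `|b| <= 1 -> `|w| <= 1 ->
  heine b w - heine (b * q) w = b * q * w * heine (b * q) (w * q).
Proof.
move=> b1 w1; have bq1 := norm_mulq_le1 _ b1; have wq1 := norm_mulq_le1 _ w1.
have h1 := is_sumB _ _ _ _ _ (heine_sum _ _ b1 w1) (heine_sum _ _ bq1 w1).
have h2 := is_sumZ _ (b * q * w) _ _ (heine_sum _ _ bq1 wq1).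
have h3 : is_sum R (fun k => heine_term b w (1 + k) - heine_term (b * q) w (1 + k))
    (b * q * w * heine (b * q) (w * q)).
  apply: is_sum_ext h2 => k; rewrite add1n /heine_term triS.
  rewrite -mulNr (poch_recl (- b)) (pochS (- b * q)) (pochS q) exprD !exprS exprMn.
  have := poch_qq_neq0 k.+1; rewrite pochS mulf_eq0 negb_or => /andP[p0 q0].
  by rewrite !mulNr opprK; field; rewrite p0 q0.
have := is_sum_shift _ 1 (fun k => heine_term b w k - heine_term (b * q) w k) _ h3.
rewrite big_nat1 /heine_term !poch0 subrr add0r.
exact: is_sum_unique.
Qed.

Lemma heine_shift_w b w : `|b| <= 1 -> `|w| <= 1 ->
  heine b w - heine b (w * q) = q * w * (1 + b) * heine (b * q) (w * q).
Proof.
move=> b1 w1; have bq1 := norm_mulq_le1 _ b1; have wq1 := norm_mulq_le1 _ w1.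
have h1 := is_sumB _ _ _ _ _ (heine_sum _ _ b1 w1) (heine_sum _ _ b1 wq1).
have h2 := is_sumZ _ (q * w * (1 + b)) _ _ (heine_sum _ _ bq1 wq1).
have h3 : is_sum R (fun k => heine_term b w (1 + k) - heine_term b (w * q) (1 + k))
    (q * w * (1 + b) * heine (b * q) (w * q)).
  apply: is_sum_ext h2 => k; rewrite add1n /heine_term triS.
  rewrite -mulNr (poch_recl (- b)) (pochS q) exprD !exprS !exprMn.
  have := poch_qq_neq0 k.+1; rewrite pochS mulf_eq0 negb_or => /andP[p0 q0].
  by rewrite !mulNr opprK; field; rewrite p0 q0.
have := is_sum_shift _ 1 (fun k => heine_term b w k - heine_term b (w * q) k) _ h3.
rewrite big_nat1 /heine_term !expr0 subrr add0r.
exact: is_sum_unique.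
Qed.

(** Three contiguous relations starting from w = 1 involve only two series at w = q; eliminating
    those leaves this relation, whose iteration is Lebesgue's identity. *)
Lemma heine_lebesgue b : `|b| <= 1 -> heine b 1 = (1 + b * q) * heine (b * q ^+ 2) 1.
Proof.
move=> b1; have n1 : `|1| <= 1 :> R by rewrite normr1.
have bq1 := norm_mulq_le1 _ b1.
have h1 := heine_shift_b _ _ b1 n1.
have h2 := heine_shift_w _ _ bq1 n1.
have h3 := heine_shift_b _ _ bq1 n1.
rewrite !mulr1 !mul1r -?mulrA in h1 h2 h3.
rewrite expr2 mulrA; rewrite -!mulrA in h1 h2 h3 *.
have -> : heine b 1 = heine (b * q) 1 + b * (q * heine (b * q) q) by rewrite -h1; ring.
have -> : heine (b * (q * q)) 1 = heine (b * q) 1 - b * (q * (q * heine (b * (q * q)) q)) by rewrite -h3; ring.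
have -> : heine (b * q) q = heine (b * q) 1 - q * ((1 + b * q) * heine (b * (q * q)) q) by rewrite -h2; ring.
ring.
Qed.

End HeineSeries.

(** * Heine's continued fraction and its convergents *)

Section ContinuedFraction.
Variables (R : realType) (q s : R).
Hypothesis q_small : `|q| <= 1 / 2.
Hypothesis q_neq0 : q != 0.
Hypothesis s_le1 : `|s| <= 1.
Hypothesis s_neq0 : s != 0.

Let norm_sq n : `|s * q ^+ n| <= 1.
Proof. by rewrite normrM mulr_ile1 // normrX exprn_ile1 // (norm_q_le1 _ _ q_small). Qed.

Let norm_qn n : `|q ^+ n| <= 1.
Proof. by rewrite normrX exprn_ile1 // (norm_q_le1 _ _ q_small). Qed.

Let one_sq_bounds n : 1 / 2 <= 1 + s * q ^+ n.+1 <= 3 / 2.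
Proof.
have h : `|s * q ^+ n.+1| <= 1 / 2.
  rewrite exprS mulrCA normrM -[leRHS]mulr1; apply: ler_pM => //.
have := ler_norm (s * q ^+ n.+1); have := ler_norm (- (s * q ^+ n.+1)).
rewrite normrN; lra.
Qed.

(* The contiguous relations of [heine] in its two parameters, used alternately,
   give a continued fraction with partial numerators [cf_num]. *)
Definition cf_tail n : R :=
  heine R q (s * q ^+ (uphalf n)) (q ^+ n./2).

Definition cf_num n : R :=
  if odd n then s * q ^+ n else q ^+ n./2 * (1 + s * q ^+ n./2).

Lemma cf_tail_rec n : cf_tail n = cf_tail n.+1 + cf_num n.+1 * cf_tail n.+2.
Proof.
rewrite /cf_tail /cf_num /=; case: (boolP (odd n)) => on /=.
  have E : uphalf n = n./2.+1 by rewrite uphalf_half on.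
  have := heine_shift_w _ _ q_small _ _ (norm_sq (uphalf n)) (norm_qn n./2).
  rewrite E -!exprSr => h.
  apply/eqP; rewrite -subr_eq0 opprD addrA subr_eq0; apply/eqP.
  by rewrite h -exprS -[s * _ * q]mulrA -exprSr.
have E : uphalf n = n./2 by rewrite uphalf_half (negbTE on).
have := heine_shift_b _ _ q_small _ _ (norm_sq (uphalf n)) (norm_qn n./2).
rewrite E -[s * _ * q]mulrA -!exprSr => h.
apply/eqP; rewrite -subr_eq0 opprD addrA subr_eq0; apply/eqP.
rewrite h; congr (_ * _).
have En : n.+1 = (n./2 + n./2).+1 by rewrite addnn even_halfK.
by rewrite En !exprS exprD; ring.
Qed.

Lemma cf_tail_sub1 n : `|cf_tail n - 1| <= 8 / 2 ^+ n./2.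
Proof.
have := heine_sub1_le _ _ q_small _ _ (norm_sq (uphalf n)) (norm_qn n./2).
move/le_trans; apply; rewrite ler_pM2l // -div1r; exact: norm_exp_small.
Qed.

Lemma cf_tail_bounds n : (8 <= n)%N -> 1 / 2 <= cf_tail n <= 3 / 2.
Proof.
move=> n8; have := cf_tail_sub1 n.
have : 8 / 2 ^+ n./2 <= 1 / 2 :> R.
  rewrite ler_pdivrMr ?exprn_gt0 //.
  have : 2 ^+ 4 <= 2 ^+ n./2 :> R by rewrite ler_weXn2l //; [lra | lia].
  rewrite !exprS expr0; lra.
have := ler_norm (cf_tail n - 1); have := ler_norm (- (cf_tail n - 1)).
rewrite normrN; lra.
Qed.

Lemma cf_num_neq0 n : (0 < n)%N -> cf_num n != 0.
Proof.
move=> n0; rewrite /cf_num; case: ifP => on; first by rewrite mulf_neq0 ?expf_neq0.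
rewrite mulf_neq0 ?expf_neq0 //.
have -> : n./2 = (n./2.-1).+1 by lia.
by rewrite gt_eqF //; have := one_sq_bounds n./2.-1; lra.
Qed.

(** Since no partial numerator vanishes, two consecutive zeros would propagate to all tails, but the
    tails from index 8 on are at least 1/2. *)
Lemma cf_tail_neq0 : ~ (cf_tail 0 = 0 /\ cf_tail 1 = 0).
Proof.
case=> h0 h1; have h n : cf_tail n = 0 /\ cf_tail n.+1 = 0.
  elim: n => [|n [IH1 IH2]] //; split=> //.
  have := cf_tail_rec n; rewrite IH1 IH2 add0r => /esym/eqP.
  by rewrite mulf_eq0 (negbTE (cf_num_neq0 n.+1 _)) //= => /eqP.
have := cf_tail_bounds 8 isT; rewrite (proj1 (h 8%N)); lra.
Qed.

Let A n := \prod_(0 <= j < n) (1 + s * q ^+ (2 * j + 1)).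
Let B n := \prod_(0 <= j < n) (1 + s * q ^+ (2 * j + 2)).

Let A_neq0 n : A n != 0.
Proof.
rewrite prodf_seq_neq0; apply/allP => j _; apply/implyP => _.
by rewrite addn1 gt_eqF //; have := one_sq_bounds (2 * j); lra.
Qed.

Let tail0E n : cf_tail 0 = A n * heine R q (s * q ^+ (2 * n)) 1.
Proof.
elim: n => [|n ->]; first by rewrite /A big_geq // mul1r.
rewrite /A big_nat_recr //= -mulrA; congr (_ * _).
rewrite (heine_lebesgue _ _ q_small) //.
by rewrite -mulrA -exprSr -mulrA -exprD addn1 mulnS [(2 + _)%N]addnC.
Qed.

Let tail1E n : cf_tail 1 = B n * heine R q (s * q ^+ (2 * n + 1)) 1.
Proof.
elim: n => [|n ->]; first by rewrite /B big_geq // mul1r.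
rewrite /B big_nat_recr //= -mulrA; congr (_ * _).
rewrite (heine_lebesgue _ _ q_small) //.
by rewrite -mulrA -exprSr -mulrA -exprD -addnS mulnS [(2 + _)%N]addnC addnAC.
Qed.

Let B_bound n : `|B n| <= expR 2.
Proof.
apply: (@le_trans _ _ (expR (\sum_(0 <= j < n) 2^-1 ^+ j))).
  rewrite expR_sum /B normr_prod; apply: ler_prod => j _; rewrite normr_ge0 /=.
  apply: le_trans (expR_ge1Dx _); apply: (le_trans (ler_normD _ _)); rewrite normr1 lerD2l.
  rewrite normrM -[leRHS]mul1r; apply: ler_pM => //.
  apply: (le_trans (norm_exp_small _ _ q_small _)); rewrite div1r -exprVn.
  by rewrite ler_wiXn2l //; [lra | lia].
rewrite ler_expR.
have h : \sum_(0 <= j < n) 2^-1 ^+ j = 2 - 2 * 2^-1 ^+ n :> R.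
  elim: n => [|n IH]; first by rewrite big_geq // expr0; lra.
  by rewrite big_nat_recr //= IH exprS; field.
rewrite h lerBlDr lerDl mulr_ge0 // exprn_ge0 //; lra.
Qed.

(** Iterated Lebesgue steps write both tails as finite products times Heine series at w = 1 with b =
    s q^(2n) and b = s q^(2n+1), which differ by O(q^(2n+1)). There is no division by [cf_tail 0],
    since its nonvanishing is deduced from this limit. *)
Lemma cf_limit :
  (fun n => B n / A n * cf_tail 0) @ \oo --> cf_tail 1.
Proof.
apply/cvgrPdist_le => e e0.
have [N _ hN] : \forall n \near \oo, `|(2^-1 : R) ^+ n| <= e / (9 * expR 2).
  have h2 : `|2^-1 : R| < 1 by rewrite ger0_norm; lra.
  have := @cvg_expr R 2^-1 h2 => /cvgrPdist_le /(_ (e / (9 * expR 2))).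
  rewrite divr_gt0 ?mulr_gt0 ?expR_gt0 // => /(_ isT).
  by apply: filterS => n; rewrite sub0r normrN.
exists N => // n /= Nn.
have := hN n Nn; rewrite ger0_norm ?exprn_ge0 // => hn.
rewrite (tail1E n) (tail0E n) [B n / A n * _]mulrA divfK //.
have n1 : `|1| <= 1 :> R by rewrite normr1.
have := heine_shift_b _ _ q_small _ _ (norm_sq (2 * n)) n1.
rewrite mulr1 mul1r -!mulrA -exprSr => h.
rewrite -mulrBr normrM addn1 distrC h.
have h9 : `|heine R q (s * q ^+ (2 * n).+1) q| <= 9.
  have q1 := norm_q_le1 _ _ q_small.
  have := heine_sub1_le _ _ q_small _ _ (norm_sq (2 * n).+1) q1.
  set z := heine _ _ _ _ => hz; rewrite -[z](subrK 1).
  apply: (le_trans (ler_normD _ _)); rewrite normr1; lra.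
apply: (@le_trans _ _ (expR 2 * (2^-1 ^+ n * 9))).
  apply: ler_pM => //; rewrite mulrA normrM; apply: ler_pM => //.
  rewrite normrM -[leRHS]mul1r; apply: ler_pM => //.
  apply: (le_trans (norm_exp_small _ _ q_small _)); rewrite div1r -exprVn.
  by rewrite ler_wiXn2l //; [lra | lia].
  by rewrite normrM -[leRHS]mul1r; apply: ler_pM => //; exact: norm_q_le1.
rewrite [leLHS](_ : _ = 2^-1 ^+ n * (9 * expR 2)); last by ring.
by rewrite -ler_pdivlMr //.
Qed.

(** If it vanished, the limit would make [cf_tail 1] vanish too. *)
Lemma cf_tail0_neq0 : cf_tail 0 != 0.
Proof.
apply/eqP => h0; apply: cf_tail_neq0; split=> //.
have := cf_limit; rewrite h0 (_ : (fun _ => _) = fun=> 0).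
  by move=> h; apply/esym; exact: (cvg_unique (@Rhausdorff R) (cvg_cst 0) h).
by apply/funext => n; rewrite mulr0.
Qed.

Lemma cf_product :
  (fun n => \prod_(0 <= j < n) ((1 + s * q ^+ (2 * j + 2)) / (1 + s * q ^+ (2 * j + 1))))
    @ \oo --> cf_tail 1 / cf_tail 0.
Proof.
rewrite (_ : (fun _ => _) = (fun n => B n / A n * cf_tail 0 / cf_tail 0)).
  by apply: cvgMl; exact: cf_limit.
apply/funext => n; rewrite mulfK ?cf_tail0_neq0 //.
by rewrite prodf_div.
Qed.

(** Two consecutive terms of a solution of u_(n+2) = u_(n+1) + a_(n+1) u_n, with a = [cf_num]. The
    start (1, 1) yields the denominators and (0, 1) the numerators of the convergents to
    [cf_tail 1 / cf_tail 0]. *)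
Fixpoint cf_conv (u0 u1 : R) n : R * R :=
  if n is m.+1 then let uv := cf_conv u0 u1 m in (uv.2, uv.2 + cf_num n * uv.1)
  else (u0, u1).

(** The error obeys the same recurrence as the convergents, and so do the signed products on the
    right, by [cf_tail_rec]. An exact error yields upper and lower bounds at once. *)
Lemma cf_conv_form n : let X := cf_conv 1 1 n in let Y := cf_conv 0 1 n in
  let c := (-1) ^+ n * \prod_(1 <= i < n.+1) cf_num i in
  X.1 * cf_tail 1 - Y.1 * cf_tail 0 = c * cf_tail n.+1 /\
  X.2 * cf_tail 1 - Y.2 * cf_tail 0 = - (c * cf_num n.+1 * cf_tail n.+2).
Proof.
elim: n => [|n [IH1 IH2]] /=.
  rewrite big_geq // expr0 !mul1r mul0r subr0; split=> //.
  by rewrite [cf_tail 0]cf_tail_rec; ring.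
have prodE : \prod_(1 <= i < n.+2) cf_num i = \prod_(1 <= i < n.+1) cf_num i * cf_num n.+1.
  by rewrite big_nat_recr.
rewrite prodE exprS; split; first by rewrite IH2; ring.
transitivity (((cf_conv 1 1 n).2 * cf_tail 1 - (cf_conv 0 1 n).2 * cf_tail 0) +
  cf_num n.+1 * ((cf_conv 1 1 n).1 * cf_tail 1 - (cf_conv 0 1 n).1 * cf_tail 0)); first by ring.
by rewrite IH1 IH2 [cf_tail n.+1]cf_tail_rec; ring.
Qed.

Lemma cf_num_le2 n : (0 < n)%N -> `|cf_num n| <= 2.
Proof.
move=> n0; rewrite /cf_num; case: ifP => _; first by apply: (le_trans (norm_sq _)); lra.
rewrite normrM -[leRHS]mul1r; apply: ler_pM => //.
apply: (le_trans (ler_normD _ _)); rewrite normr1; have := norm_sq n./2; lra.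
Qed.

Lemma cf_conv_bound u0 u1 n : `|u0| <= 1 -> `|u1| <= 1 ->
  `|(cf_conv u0 u1 n).1| <= 2 ^+ n /\ `|(cf_conv u0 u1 n).2| <= 2 ^+ n.+1.
Proof.
move=> h0 h1; elim: n => [|n [IH1 IH2]] /=; first by rewrite expr0 expr1; split; lra.
split=> //; apply: (le_trans (ler_normD _ _)); rewrite normrM.
have : `|cf_num n.+1| * `|(cf_conv u0 u1 n).1| <= 2 * 2 ^+ n.
  by apply: ler_pM => //; exact: cf_num_le2.
move: IH2; rewrite !exprS; lra.
Qed.

End ContinuedFraction.

(** * Partitions without parts divisible by 4 *)

Section PartitionSeries.
Variables (R : realType).
Implicit Types (a b c d : {poly R}) (r s : R).

(** The relation between two truncations of a generating function: nonnegative coefficients that can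
    only grow and are already final up to degree M. It is stable under products. *)
Definition coef_le M a b :=
  (forall n, 0 <= a`_n <= b`_n) /\ (forall n, (n <= M)%N -> a`_n = b`_n).

Lemma coef_leM M a b c d : coef_le M a b -> coef_le M c d -> coef_le M (a * c) (b * d).
Proof.
move=> [ab1 ab2] [cd1 cd2]; split=> n; rewrite !coefM.
  apply/andP; split.
    apply: sumr_ge0 => i _; apply: mulr_ge0; first by case/andP: (ab1 i).
    by case/andP: (cd1 (n - i)%N).
  apply: ler_sum => i _; have /andP[? ?] := ab1 i; have /andP[? ?] := cd1 (n - i)%N.
  exact: ler_pM.
move=> nM; apply: eq_bigr => i _; rewrite ab2 ?cd2 //; have := ltn_ord i; lia.
Qed.

Definition part_factor M i : {poly R} :=
  if (4 %| i)%N then 1 else \sum_(0 <= k < M.+1) 'X^(i * k).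

Definition part_poly M := \prod_(0 <= i < M.+1) part_factor M i.

Let coef_sumX i m n l : (0 < i)%N ->
  (\sum_(m <= k < n) 'X^(i * k) : {poly R})`_l = ((m <= l %/ i < n) && (i %| l))%N%:R.
Proof.
move=> i0; rewrite coef_sum.
transitivity (\sum_(m <= k < n | k == (l %/ i)%N) (i %| l)%:R : R).
  rewrite [RHS]big_mkcond; apply: eq_bigr => k _; rewrite coefXn.
  case: (boolP (i %| l)%N) => il.
    by rewrite (eqn_div _ i0 il) mulnC eq_sym; case: eqP.
  rewrite (_ : l == _ = false) ?if_same //; apply: contraNF il => /eqP ->.
  exact: dvdn_mulr.
case: (boolP (m <= l %/ i < n)%N) => h /=.
  by rewrite -big_filter filter_pred1_uniq ?iota_uniq ?mem_index_iota // big_seq1.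
rewrite big_seq_cond big1 // => k; rewrite mem_index_iota => /andP[+ /eqP kE].
by rewrite kE (negbTE h).
Qed.

Let coef_le_factor M N i : (M <= N)%N ->
  coef_le M (if (i <= M)%N then part_factor M i else 1) (part_factor N i).
Proof.
move=> MN; rewrite /part_factor; case: (boolP (4 %| i)%N) => h4; rewrite ?if_same.
  by split=> // n; rewrite coef1 ler0n lexx.
have i0 : (0 < i)%N by case: i h4.
case: (leqP i M) => iM.
  split=> n; rewrite !coef_sumX // !leq0n /=.
    by rewrite ler0n ler_nat; case: (i %| n)%N; rewrite ?andbF // !andbT; lia.
  move=> nM; congr _%:R; congr nat_of_bool.
  by have := leq_div n i; case: (i %| n)%N; rewrite ?andbF // !andbT; lia.
split=> n; rewrite coef1 coef_sumX // leq0n /=.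
  rewrite ler0n ler_nat /=; case: n => [|n] //; by rewrite div0n dvdn0.
move=> nM; congr _%:R; congr nat_of_bool.
have -> : (n %/ i = 0)%N by rewrite divn_small //; exact: leq_ltn_trans iM.
rewrite ltn0Sn /=; case: n nM => [|n] nM; first by rewrite dvdn0.
by rewrite gtnNdvd //; lia.
Qed.

Lemma coef_le_part_poly M N : (M <= N)%N -> coef_le M (part_poly M) (part_poly N).
Proof.
move=> MN; have -> : part_poly M =
    \prod_(0 <= i < N.+1) (if (i <= M)%N then part_factor M i else 1).
  rewrite /part_poly (@big_cat_nat _ _ _ M.+1 0 N.+1) //=.
  rewrite [X in _ * X]big1_seq ?mulr1; last first.
    by move=> i; rewrite mem_index_iota => /andP[_ /andP[Mi _]]; rewrite leqNgt Mi.
  by apply: eq_big_nat => i; rewrite ltnS => /andP[_ ->].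
rewrite /part_poly; elim: N.+1 => [|n IH].
  by rewrite !big_geq //; split=> // n; rewrite lexx coef1 ler0n.
by rewrite !big_nat_recr //=; apply: coef_leM IH _; exact: coef_le_factor.
Qed.

(** Distributing the product over the sums yields a sum over multiplicity functions, which is the
    encoding in [b4]; at M = n the ranges of parts and multiplicities coincide. *)
Lemma coef_part_poly_diag n : (part_poly n)`_n = (b4 n)%:R.
Proof.
(* A factor 1, for 4 | i, is written as a sum whose only nonzero term is k = 0, so that all factors
   have the same shape. *)
pose F (i k : 'I_n.+1) : {poly R} := if (4 %| i)%N then (k == 0%N :> nat)%:R else 'X^(i * k).
have -> : part_poly n = \prod_(i < n.+1) \sum_(k < n.+1) F i k.
  rewrite /part_poly big_mkord; apply: eq_bigr => i _; rewrite /part_factor /F.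
  case: ifP => _; last by rewrite big_mkord.
  by rewrite big_ord_recl /= big1 ?addr0.
rewrite bigA_distr_bigA /= coef_sum /b4 -sum1_card natr_sum.
rewrite [RHS]big_mkcond /=; apply: eq_bigr => f _; rewrite inE.
case: (boolP [forall i : 'I_n.+1, (4 %| i)%N ==> (f i == 0%N :> nat)]) => [/forallP h|].
  rewrite andbT (eq_bigr (fun i : 'I_n.+1 => 'X^(i * f i))); last first.
    move=> i _; rewrite /F; have := h i; case: ifP => //= _ /eqP E.
    by rewrite E eqxx muln0 expr0.
  by rewrite -expr_sum coefXn eq_sym; case: eqP.
rewrite andbF => /forallPn[i]; rewrite negb_imply => /andP[i4 fi].
by rewrite (bigD1 i) //= /F i4 (negbTE fi) mul0r coef0.
Qed.

Lemma coef_part_poly M n : (n <= M)%N -> (part_poly M)`_n = (b4 n)%:R.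
Proof.
by move=> nM; have [_ /(_ n (leqnn _)) <-] := coef_le_part_poly _ _ nM; exact: coef_part_poly_diag.
Qed.

Lemma coef_part_poly_bounds M n : 0 <= (part_poly M)`_n <= (b4 n)%:R.
Proof.
have [h _] := coef_le_part_poly _ _ (leq_addr n M).
by have := h n; rewrite (coef_part_poly (M + n)) // leq_addl.
Qed.

(** With t = ne the deviation is at most exp(t) - 1, and exp(t)(1 - t) <= 1 turns this into 2t for t
    <= 1/2. *)
Lemma prod_sub1_le n (y : nat -> R) e : n%:R * e <= 1 / 2 -> 0 <= e ->
  (forall i, (i < n)%N -> `|y i| <= e) ->
  `|\prod_(0 <= i < n) (1 - y i) - 1| <= 2 * (n%:R * e).
Proof.
move=> ne e0 hy; apply: (@le_trans _ _ (expR (n%:R * e) - 1)); last first.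
  have h : expR (n%:R * e) * (1 - n%:R * e) <= 1.
    rewrite -ler_pdivlMl ?expR_gt0 // mulr1 -expRN; exact: expR_ge1Dx.
  have t0 : 0 <= n%:R * e by rewrite mulr_ge0.
  have := expR_ge1Dx (n%:R * e); move: ne h t0.
  set t := n%:R * e; set z := expR t => ne h t0 h2; nra.
elim: n hy {ne} => [|n IH] hy; first by rewrite big_geq // subrr normr0 mul0r expR0 subrr.
have {}IH := IH (fun i h => hy i (ltnW h)).
rewrite big_nat_recr //= -natr1 mulrDl mul1r expRD.
have hn := hy n (leqnn _).
have h1 : 1 + e <= expR e := expR_ge1Dx e.
move: IH; set p := \prod_(0 <= i < n) _; set z := expR (n%:R * e) => IH.
have z1 : 1 <= z by rewrite -expR0 ler_expR mulr_ge0.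
have -> : p * (1 - y n) - 1 = (p - 1) * (1 - y n) - y n by ring.
apply: (le_trans (ler_normB _ _)); rewrite normrM.
have h2 : `|1 - y n| <= 1 + e by apply: (le_trans (ler_normB _ _)); rewrite normr1 lerD2l.
have : `|p - 1| * `|1 - y n| <= (z - 1) * (1 + e) by apply: ler_pM.
have : z * (1 + e) <= z * expR e by rewrite ler_pM2l // expR_gt0.
lra.
Qed.

Lemma sqr_le_exp2 n : (n * n <= 4 * 2 ^ n)%N.
Proof.
elim: n => [|n IH] //; case: n IH => [|[|[|n]]] // IH.
rewrite expnS; nia.
Qed.

Lemma cvg_le_harmonic (u : nat -> R) (l C : R) (N : nat) :
  (forall n, (N <= n)%N -> `|u n - l| <= C / n.+1%:R) -> u @ \oo --> l.
Proof.
move=> h; apply/cvgrPdist_le => e e0.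
have [M hM] := exists_natr_gt R (C / e).
exists (N + M)%N => // n /= nNM; rewrite distrC; apply: (le_trans (h n _)); first by lia.
rewrite ler_pdivrMr // mulrC -ler_pdivrMr //; apply: ltW; apply: (lt_le_trans hM).
by rewrite ler_nat; lia.
Qed.

Lemma cvg_sub_seq (u : nat -> R) (l : R) (f : nat -> nat) :
  (forall n, (n <= f n)%N) -> u @ \oo --> l -> (fun n => u (f n)) @ \oo --> l.
Proof.
move=> hf /cvgrPdist_le h; apply/cvgrPdist_le => e e0.
have [N _ hN] := h e e0; exists N => // n /= Nn; apply: hN.
exact: leq_trans (hf n).
Qed.

Lemma part_poly_horner M r : `|r| <= 1 / 2 ->
  (part_poly M).[r] = \prod_(1 <= i < M.+1 | ~~ (4 %| i)%N) ((1 - r ^+ (i * M.+1)) / (1 - r ^+ i)).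
Proof.
move=> r2; rewrite /part_poly horner_prod big_ltn // {1}/part_factor /= hornerC mul1r.
rewrite [RHS]big_mkcond; apply: eq_big_nat => i /andP[i0 _].
rewrite /part_factor; case: ifP => _ /=; first by rewrite hornerC.
have n0 : 1 - r ^+ i != 0.
  by case: i i0 => // i _; rewrite gt_eqF //; have := one_sub_exp_ge R r r2 i; lra.
apply: (mulIf n0); rewrite divfK // horner_sum exprM -[RHS]opprB subrX1 -mulNr opprB mulrC.
rewrite big_mkord; congr (_ * _); apply: eq_bigr => k _.
by rewrite hornerXn exprM.
Qed.
End PartitionSeries.

(** * The generating function as a continued fraction *)

Section PartitionLimit.
Variables (R : realType) (r : R).
Hypothesis r_small : `|r| <= 1 / 2.

Let norm_r_small : `| `|r| | <= 1 / 2. Proof. by rewrite normr_id. Qed.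

Let D M : R := \prod_(1 <= i < M.+1 | ~~ (4 %| i)%N) (1 - r ^+ i).
(** The truncated generating function at [r] is [W M / D M]; this numerator, which tends to 1, is
    the effect of cutting the multiplicities at M. *)
Let W M : R := \prod_(1 <= i < M.+1 | ~~ (4 %| i)%N) (1 - r ^+ (i * M.+1)).

(** The bound is uniform in M. It bounds the partial sums of b4(n) |r|^n, and so gives absolute
    convergence of the power series. *)
Let part_poly_le M : (part_poly R M).[`|r|] <= expR 2.
Proof.
rewrite part_poly_horner // big_mkcond /=.
apply: (@le_trans _ _ (expR (\sum_(1 <= i < M.+1) 2 * 2^-1 ^+ i))).
  rewrite expR_sum big_nat [leRHS]big_nat; apply: ler_prod => i /andP[i0 _].
  have h0 : 0 <= `|r| ^+ i by exact: exprn_ge0.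
  have h1 : `|r| ^+ i <= 2^-1 ^+ i.
    by have := norm_exp_small _ _ r_small i; rewrite normrX div1r exprVn.
  have h2 : 2^-1 ^+ i <= 2^-1 :> R.
    case: i i0 {h0 h1} => // i _; rewrite exprS ler_piMr ?invr_ge0 //.
    by apply: exprn_ile1; lra.
  have h3 : 0 <= `|r| ^+ (i * M.+1) <= 1.
    rewrite exprn_ge0 //= exprn_ile1 //; exact: norm_q_le1 r_small.
  have h4 := expR_ge1Dx (2 * 2^-1 ^+ i : R).
  have h5 : 0 <= 2^-1 ^+ i :> R by apply: exprn_ge0.
  case: ifP => _; last by rewrite ler01 /=; move: h4 h5; lra.
  rewrite divr_ge0 /=; [|by move: h3; lra|by move: h1 h2; lra].
  rewrite ler_pdivrMr; last by move: h1 h2; lra.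
  apply: (@le_trans _ _ ((1 + 2 * 2^-1 ^+ i) * (1 - `|r| ^+ i))).
    by move: h0 h1 h2 h3; set y := `|r| ^+ i; set z := 2^-1 ^+ i; nra.
  by apply: ler_wpM2r => //; move: h1 h2; lra.
rewrite ler_expR -mulr_sumr.
have h : \sum_(1 <= i < M.+1) 2^-1 ^+ i = 1 - 2^-1 ^+ M :> R.
  elim: M => [|M IH]; first by rewrite big_geq // expr0 subrr.
  by rewrite big_nat_recr //= IH exprS; field.
by rewrite h; have : 0 <= 2^-1 ^+ M :> R; [apply: exprn_ge0 | lra].
Qed.

Let split_horner M (y : R) : exists2 n, (M < n)%N &
  (part_poly R M).[y] = series (fun n => (b4 n)%:R * y ^+ n) M.+1 +
    \sum_(M.+1 <= k < n) (part_poly R M)`_k * y ^+ k.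
Proof.
exists (size (part_poly R M) + M.+1)%N; first by rewrite addnS ltnS leq_addl.
rewrite (horner_coef_wide _ (leq_addr M.+1 _)) -(big_mkord xpredT (fun k => (part_poly R M)`_k * y ^+ k)).
rewrite (@big_cat_nat _ _ _ M.+1) //= ?leq_addl //; congr (_ + _).
by apply: eq_big_nat => k /andP[_ kM]; rewrite coef_part_poly.
Qed.

Let t n : R := (b4 n)%:R * `|r| ^+ n.

Let t_ge0 n : 0 <= t n. Proof. by rewrite mulr_ge0 // exprn_ge0. Qed.

Let t_mono : nondecreasing_seq (series t).
Proof. exact: (@nondecreasing_series R t xpredT 0%N (fun n _ _ => t_ge0 n)). Qed.

Let t_cvg : cvgn (series t).
Proof.
apply: nondecreasing_is_cvgn => //; exists (expR 2) => _ [n _ <-].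
apply: (@le_trans _ _ (series t n.+1)); first exact: t_mono.
apply: le_trans (part_poly_le n); have [m _ ->] := split_horner n `|r|.
rewrite lerDl; apply: sumr_ge0 => k _; apply: mulr_ge0; last exact: exprn_ge0.
by case/andP: (coef_part_poly_bounds R n k).
Qed.

Lemma B4_is_sum : is_sum R (fun n => (b4 n)%:R * r ^+ n) (B4 r).
Proof.
rewrite /is_sum /B4; apply: normed_cvg.
rewrite (_ : [normed series _] = series t) //.
by apply/funext => n; rewrite /series /=; apply: eq_bigr => k _; rewrite normrM normrX normr_nat.
Qed.

Let part_poly_near M : `|(part_poly R M).[r] - series (fun n => (b4 n)%:R * r ^+ n) M.+1| <=
  limn (series t) - series t M.+1.
Proof.
have [n Mn ->] := split_horner M r; rewrite addrAC subrr add0r.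
apply: (le_trans (ler_norm_sum _ _ _)).
apply: (@le_trans _ _ (series t n - series t M.+1)); last first.
  by rewrite lerD2r; exact: nondecreasing_cvgn_le.
rewrite /series /= [X in _ <= X - _](@big_cat_nat _ _ _ M.+1) //= addrAC subrr add0r.
apply: ler_sum => k _; rewrite normrM normrX /t.
have /andP[c0 c1] := coef_part_poly_bounds R M k.
by rewrite ger0_norm // ler_wpM2r // exprn_ge0.
Qed.

Lemma part_poly_cvg : (fun M => (part_poly R M).[r]) @ \oo --> B4 r.
Proof.
apply/cvgrPdist_le => e e0; have e2 : 0 < e / 2 by rewrite divr_gt0.
have /cvgrPdist_le /(_ _ e2) [N1 _ h1] := B4_is_sum.
have /cvgrPdist_le /(_ _ e2) [N2 _ h2] := t_cvg.
exists (N1 + N2)%N => // M /= NM.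
have {}h1 := h1 M.+1 ltac:(rewrite /=; lia).
have {}h2 := h2 M.+1 ltac:(rewrite /=; lia).
have := part_poly_near M; rewrite /= in h1 h2.
set a := (part_poly R M).[r]; set b := series _ M.+1 in h1 *.
set c := limn _ in h2 *; set d := series t _ in h2 * => h3.
have -> : B4 r - a = (B4 r - b) - (a - b) by ring.
apply: (le_trans (ler_normB _ _)).
have := ler_norm (c - d); lra.
Qed.

Let W_cvg : W @ \oo --> (1 : R).
Proof.
apply: (@cvg_le_harmonic _ _ _ 8 1) => M M1.
pose y j : R := if ~~ (4 %| j.+1)%N then r ^+ (j.+1 * M.+1) else 0.
have -> : W M = \prod_(0 <= j < M) (1 - y j).
  rewrite /W big_add1 /= big_mkcond; apply: eq_bigr => j _; rewrite /y.
  by case: ifP; rewrite ?subr0.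
have p0 : 0 < 2 ^+ M :> R by exact: exprn_gt0.
have M2 : M%:R <= 2 ^+ M :> R by rewrite -natrX ler_nat ltnW // ltn_expl.
apply: (le_trans (prod_sub1_le _ _ _ (1 / 2 ^+ M.+1) _ _ _)).
- by rewrite exprS mulrA mulr1 ler_pdivrMr ?mulr_gt0 //; lra.
- by rewrite divr_ge0 // exprn_ge0.
- move=> j _; rewrite /y; case: ifP => _; last by rewrite normr0 divr_ge0 // exprn_ge0.
  apply: (le_trans (norm_exp_small _ _ r_small _)); rewrite ler_pM2l //.
  rewrite lef_pV2 ?posrE ?exprn_gt0 // ler_weXn2l //; [lra | nia].
rewrite exprS [leLHS](_ : _ = M%:R / 2 ^+ M); last by field; rewrite gt_eqF.
rewrite ler_pdivrMr // mulrAC ler_pdivlMr //.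
have : (M * M.+1 <= 8 * 2 ^ M)%N by have := sqr_le_exp2 M; nia.
by rewrite -(ler_nat R) !natrM natrX.
Qed.

Let Z n : R := \prod_(0 <= j < n) (1 - r ^+ (4 * j.+1)).
(** The quotient of [Z (n + n)] by [Z n], a correction that tends to 1. *)
Let E n : R := \prod_(0 <= j < n) (1 - r ^+ (4 * (n + j).+1)).

Let E_cvg : E @ \oo --> (1 : R).
Proof.
apply: (@cvg_le_harmonic _ _ _ 1 0) => n _.
have p0 : 0 < 2 ^+ n :> R by exact: exprn_gt0.
have n2 : n.+1%:R <= 2 ^+ n :> R by rewrite -natrX ler_nat ltn_expl.
have n0 : n%:R <= 2 ^+ n :> R by apply: le_trans n2; rewrite ler_nat.
have p1 : 1 <= 2 ^+ n :> R by apply: le_trans n2; rewrite ler1n.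
have h (e : R) : 0 <= e -> n%:R * e <= 2 ^+ n * e by move=> e0; exact: ler_wpM2r.
have e0 : 0 <= 1 / (2 * 2 ^+ n * 2 ^+ n) :> R.
  by rewrite div1r invr_ge0 ltW // mulr_gt0 // mulr_gt0.
have {h} he : n%:R * (1 / (2 * 2 ^+ n * 2 ^+ n)) <= 1 / 2 / 2 ^+ n :> R.
  apply: le_trans (h _ e0) _; rewrite le_eqVlt; apply/orP; left; apply/eqP; field.
  by rewrite gt_eqF.
apply: (le_trans (prod_sub1_le _ _ _ (1 / (2 * 2 ^+ n * 2 ^+ n)) _ _ _)) => //.
- by apply: (le_trans he); rewrite ler_pdivrMr //; lra.
- move=> j _; apply: (le_trans (norm_exp_small _ _ r_small _)); rewrite ler_pM2l //.
  rewrite -exprS -exprD lef_pV2 ?posrE ?exprn_gt0 // ler_weXn2l //; [lra | lia].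
apply: (@le_trans _ _ (1 / 2 ^+ n)); last by rewrite ler_pM2l // lef_pV2 ?posrE.
by move: he; set z := n%:R * _; lra.
Qed.

Let Zdouble n : Z (n + n) = Z n * E n.
Proof.
rewrite /Z (@big_cat_nat _ _ _ n) //=; last exact: leq_addl.
congr (_ * _); rewrite -[X in \prod_(X <= _ < _) _]add0n big_addn addnK.
by apply: eq_bigr => j _; rewrite addnC.
Qed.

Let factor_neq0 i : (0 < i)%N -> 1 - r ^+ i != 0.
Proof.
by case: i => // i _; rewrite gt_eqF //; have := one_sub_exp_ge R r r_small i; lra.
Qed.

Let Z_neq0 n : Z n != 0.
Proof.
rewrite prodf_seq_neq0; apply/allP => j _; apply/implyP => _; exact: factor_neq0.
Qed.

Let D_neq0 M : D M != 0.
Proof.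
rewrite prodf_seq_neq0; apply/allP => j; rewrite mem_index_iota => /andP[j0 _].
by apply/implyP => _; exact: factor_neq0.
Qed.

Let V n : R := \prod_(0 <= j < n)
  ((1 + 1 * (- r) ^+ (2 * j + 2)) / (1 + 1 * (- r) ^+ (2 * j + 1))).

(** The denominators of [V (2 * n)] cancel the odd-index factors of [D (4 * n)]. What remains of
    [D], the indices 2 mod 4, combines with [Z n] to all 1 - r^(2j), j <= 2n, and (1 + r^(2j))(1 -
    r^(2j)) = 1 - r^(4j). *)
Let VD n : V (2 * n) * D (4 * n) * Z n = Z (n + n).
Proof.
have VE m : V m = \prod_(0 <= j < m) ((1 + r ^+ (2 * j).+2) / (1 - r ^+ (2 * j).+1)).
  apply: eq_bigr => j _; rewrite !mul1r addn2 addn1.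
  have e0 : (- r) ^+ (2 * j) = r ^+ (2 * j) by rewrite !exprM sqrrN.
  by congr (_ / _); rewrite !exprS e0; ring.
elim: n => [|n IH]; first by rewrite VE /D /Z !big_geq // !mulr1.
have -> : Z (n.+1 + n.+1) = Z (n + n) * (1 - r ^+ (4 * (n + n).+1)) * (1 - r ^+ (4 * (n + n).+2)).
  by rewrite addnS addSn /Z !big_nat_recr.
have -> : Z n.+1 = Z n * (1 - r ^+ (4 * n.+1)) by rewrite /Z big_nat_recr.
have -> : D (4 * n.+1) = D (4 * n) * (1 - r ^+ (4 * n).+1) * (1 - r ^+ (4 * n).+2) * (1 - r ^+ (4 * n).+3).
  rewrite /D (_ : 4 * n.+1 = (4 * n).+4)%N; last by lia.
  have DS m : \prod_(1 <= i < m.+2 | ~~ (4 %| i)%N) (1 - r ^+ i) =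
      \prod_(1 <= i < m.+1 | ~~ (4 %| i)%N) (1 - r ^+ i) * if (4 %| m.+1)%N then 1 else 1 - r ^+ m.+1.
    rewrite big_mkcond big_nat_recr //= -big_mkcond; congr (_ * _).
    by case: (4 %| m.+1)%N.
  rewrite !DS (_ : (4 %| (4 * n).+4)%N = true); last by lia.
  rewrite (_ : (4 %| (4 * n).+3)%N = false); last by lia.
  rewrite (_ : (4 %| (4 * n).+2)%N = false); last by lia.
  by rewrite (_ : (4 %| (4 * n).+1)%N = false) ?mulr1 //; lia.
have -> : V (2 * n.+1) = V (2 * n) * ((1 + r ^+ (4 * n).+2) / (1 - r ^+ (4 * n).+1)) *
    ((1 + r ^+ (4 * n).+4) / (1 - r ^+ (4 * n).+3)).
  rewrite !VE (_ : 2 * n.+1 = (2 * n).+2)%N; last by lia.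
  rewrite !big_nat_recr //= (_ : 2 * (2 * n) = 4 * n)%N; last by lia.
  by rewrite (_ : 2 * (2 * n).+1 = (4 * n).+2)%N; last by lia.
rewrite -IH.
have e1 : r ^+ (4 * (n + n).+1) = r ^+ (4 * n).+2 ^+ 2 by rewrite -exprM; congr (_ ^+ _); lia.
have e2 : r ^+ (4 * (n + n).+2) = r ^+ (4 * n).+4 ^+ 2 by rewrite -exprM; congr (_ ^+ _); lia.
have e3 : r ^+ (4 * n.+1) = r ^+ (4 * n).+4 by congr (_ ^+ _); lia.
have f1 := factor_neq0 (4 * n).+1 isT.
have f3 := factor_neq0 (4 * n).+3 isT.
rewrite e1 e2 e3.
move: f1 f3; set a1 := r ^+ (4 * n).+1; set a2 := r ^+ (4 * n).+2.
set a3 := r ^+ (4 * n).+3; set a4 := r ^+ (4 * n).+4.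
by move=> f1 f3; field; rewrite f1 f3.
Qed.

Lemma B4_continued_fraction : r != 0 ->
  B4 r = cf_tail R (- r) 1 1 / cf_tail R (- r) 1 0.
Proof.
move=> r0; have q2 : `|- r| <= 1 / 2 by rewrite normrN.
have q0 : - r != 0 by rewrite oppr_eq0.
have s1 : `|1| <= 1 :> R by rewrite normr1.
have hV := cf_product _ _ _ q2 q0 s1 (oner_neq0 R).
have hVW : (fun n => V (2 * n) * W (4 * n)) @ \oo -->
    cf_tail R (- r) 1 1 / cf_tail R (- r) 1 0 * 1.
  apply: cvgM; first by apply: (cvg_sub_seq _ _ _ (fun n => 2 * n)%N) hV => n; lia.
  by apply: (cvg_sub_seq _ _ _ (fun n => 4 * n)%N) W_cvg => n; lia.
have hEU : (fun n => E n * (part_poly R (4 * n)).[r]) @ \oo --> 1 * B4 r.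
  apply: cvgM; first exact: E_cvg.
  by apply: (cvg_sub_seq _ _ _ (fun n => 4 * n)%N) part_poly_cvg => n; lia.
rewrite -[RHS]mulr1 -[LHS]mul1r.
apply: (cvg_unique (@Rhausdorff R) hEU).
(* The finite identity makes the two sequences equal term by term, so only their limits are compared
   and no infinite product is formed. *)
rewrite (_ : (fun n => E n * _) = (fun n => V (2 * n) * W (4 * n))) //.
apply/funext => n; rewrite part_poly_horner // prodf_div -/(W _) -/(D _).
apply: (mulIf (Z_neq0 n)); apply: (mulIf (D_neq0 (4 * n))).
rewrite [RHS](_ : _ = (V (2 * n) * D (4 * n) * Z n) * W (4 * n)); last by ring.
rewrite VD Zdouble; field; exact: D_neq0.
Qed.
End PartitionLimit.

(** * The criterion in logarithmic form *)

Lemma near_linear_le (R : realType) (c e : R) : 0 < e ->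
  \forall n \near \oo, c * n%:R <= e * n%:R ^+ 2.
Proof.
move=> e0; have [N hN] := exists_natr_gt R (c / e).
exists N => // n /= Nn; rewrite expr2 mulrA; apply: ler_wpM2r => //.
rewrite mulrC -ler_pdivrMr //; apply: ltW; apply: (lt_le_trans hN).
by rewrite ler_nat.
Qed.

(** It covers z = 0 as well, where [ln] takes a default value. *)
Lemma ln_le_expR (R : realType) (z t : R) : ln `|z| <= t -> `|z| <= expR t.
Proof.
move=> h; have [->|z0] := eqVneq z 0; first by rewrite normr0 expR_ge0.
by rewrite -[leLHS]lnK ?ler_expR // posrE normr_gt0.
Qed.

Lemma irrationality_criterion_ln (R : realType) (xi a b d c : R) (D Q P : nat -> R) :
  0 < a + d -> 0 < b - d ->
  (\forall n \near \oo, D n != 0) ->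
  (\forall n \near \oo, D n * Q n \is a Num.int /\ D n * P n \is a Num.int) ->
  (\forall n \near \oo, Q n * xi - P n != 0) ->
  (forall e, 0 < e -> \forall n \near \oo, ln `|D n| <= (d + e) * n%:R ^+ 2 + c * n%:R) ->
  (\forall n \near \oo, ln `|Q n| <= a * n%:R ^+ 2 + c * n%:R) ->
  (\forall n \near \oo, `|ln `|Q n * xi - P n| + b * n%:R ^+ 2| <= c * n%:R) ->
  irrational xi /\ (irrationality_measure xi <= (1 + (a + d) / (b - d))%:E)%E.
Proof.
move=> A0 B0 hD0 hint hL0 hD hQ hL.
have LE n : D n * Q n * xi - D n * P n = D n * (Q n * xi - P n) by ring.
apply: (irrationality_criterion _ _ _ _ (fun n => D n * Q n) (fun n => D n * P n) A0 B0) => //.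
- move=> e e0; have e2 : 0 < e / 2 by rewrite divr_gt0.
  have h1 := hD _ e2; have h2 := near_linear_le _ (c + c) _ e2.
  apply: filterS3 h1 h2 hQ => n h1 h2 h3; rewrite normrM.
  apply: (@le_trans _ _ (expR ((d + e / 2) * n%:R ^+ 2 + c * n%:R) *
    expR (a * n%:R ^+ 2 + c * n%:R))).
    by apply: ler_pM => //; apply: ln_le_expR.
  rewrite -expRD ler_expR; move: h2; lra.
- by apply: filterS2 hD0 hL0 => n h1 h2; rewrite LE mulf_neq0.
move=> e e0; have e2 : 0 < e / 2 by rewrite divr_gt0.
have h1 := hD _ e2; have h2 := near_linear_le _ (c + c) _ e2.
apply: filterS3 h1 h2 (filterI hQ (filterI hL hL0)) => n h1 h2 [h3 [h4 L0]].
have h5 := ler_norm (ln `|Q n * xi - P n| + b * n%:R ^+ 2).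
have h6 := ler_norm (- (ln `|Q n * xi - P n| + b * n%:R ^+ 2)).
rewrite normrN in h6; rewrite LE !normrM; apply/andP; split.
  rewrite -mulrA; apply: ler_wpM2l => //.
  apply: (@le_trans _ _ (expR (a * n%:R ^+ 2 + c * n%:R) * expR (- ((a + d + (b - d) + e) * n%:R ^+ 2)))).
    by apply: ler_wpM2r; [exact: expR_ge0 | exact: ln_le_expR].
  rewrite -expRD -[leRHS]lnK ?posrE ?normr_gt0 // ler_expR.
  have : 0 <= e / 2 * n%:R ^+ 2 by rewrite mulr_ge0 ?sqr_ge0 // ltW.
  by move: h2 h4 h6; lra.
apply: (@le_trans _ _ (expR ((d + e / 2) * n%:R ^+ 2 + c * n%:R) * expR (c * n%:R - b * n%:R ^+ 2))).
  by apply: ler_pM => //; apply: ln_le_expR => //; move: h4 h5; lra.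
rewrite -expRD ler_expR; move: h2; lra.
Qed.

Lemma mul2S m : (2 * m.+1 = (2 * m).+2)%N. Proof. lia. Qed.
Lemma sqrnS_split m : (m.+1 ^ 2 = m.+1 + (m ^ 2 + m))%N. Proof. lia. Qed.
Lemma sqrnS_odd m : (m.+1 ^ 2 = (2 * m).+1 + m ^ 2)%N. Proof. lia. Qed.
Lemma sqrnS_even m : (m.+1 ^ 2 + m.+1 = 2 * m.+1 + (m ^ 2 + m))%N. Proof. lia. Qed.
Lemma cf_exponent m : ((2 * m).+1 + m.+1 = 3 * m + 2)%N. Proof. lia. Qed.

(** * The linear forms in B_4 *)

Section PartitionMeasure.
Variables (R : realType) (x : int).
Hypothesis hx : 2 <= `|x|.
Let p : R := x%:~R.
Let r : R := p^-1.
(** The inverse of [q]: the continued fraction of [B4 r] has base -r, and the denominators of its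
    convergents are powers of this integer. *)
Let y : R := (- x)%:~R.
Let q : R := - r.

Let p2 : 2 <= `|p|. Proof. exact: base_ge2. Qed.
Let p_neq0 : p != 0. Proof. exact: base_neq0. Qed.
Let lam_gt0 : 0 < ln `|p|. Proof. exact: lnbase_gt0. Qed.

Lemma base_inv_small : `|r| <= 1 / 2.
Proof.
rewrite normfV div1r lef_pV2 ?posrE ?normr_gt0 //.
Qed.

Let r_neq0 : r != 0. Proof. by rewrite invr_eq0. Qed.
Let q_small : `|q| <= 1 / 2. Proof. by rewrite normrN base_inv_small. Qed.
Let q_neq0 : q != 0. Proof. by rewrite oppr_eq0. Qed.
Let one_le1 : `|1| <= 1 :> R. Proof. by rewrite normr1. Qed.

Let yq : y * q = 1.
Proof. by rewrite /y /q /r rmorphN mulrNN divff. Qed.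

Let yXq n : y ^+ n * q ^+ n = 1.
Proof. by rewrite -exprMn yq expr1n. Qed.

Let y_int : y \is a Num.int. Proof. exact: intr_int. Qed.

Let norm_y : `|y| = `|p|. Proof. by rewrite /y rmorphN normrN. Qed.

Let a n := cf_num R q 1 n.

Let a_odd m : y ^+ (2 * m).+1 * a (2 * m).+1 = 1.
Proof. by rewrite /a /cf_num /= oddM /= mul1r yXq. Qed.

Let a_evenE m : a (2 * m.+1) = q ^+ m.+1 * (1 + q ^+ m.+1).
Proof. by rewrite /a /cf_num mul2n odd_double doubleK mul1r. Qed.

Let a_even m : y ^+ (2 * m.+1) * a (2 * m.+1) = y ^+ m.+1 + 1.
Proof.
rewrite a_evenE mul2n -addnn exprD.
rewrite [LHS](_ : _ = (y ^+ m.+1 * q ^+ m.+1) * (y ^+ m.+1 + y ^+ m.+1 * q ^+ m.+1)); last by ring.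
by rewrite yXq mul1r.
Qed.

(** A factor y^(2m+1) turns the odd partial numerator into 1 and y^(2m) turns the even one into y^m
    + 1. The exponents m^2 and m^2 + m grow by enough in each step to supply these factors. *)
Let conv_int u0 u1 m : u0 \is a Num.int -> u1 \is a Num.int ->
  y ^+ (m ^ 2) * (cf_conv R q 1 u0 u1 (2 * m)).1 \is a Num.int /\
  y ^+ (m ^ 2 + m) * (cf_conv R q 1 u0 u1 (2 * m)).2 \is a Num.int.
Proof.
move=> i0 i1; elim: m => [|m [IH1 IH2]]; first by rewrite /= !expr0 !mul1r.
rewrite mul2S; move: IH1 IH2.
have -> : (cf_conv R q 1 u0 u1 (2 * m).+2).2 = (cf_conv R q 1 u0 u1 (2 * m).+2).1 +
  a (2 * m).+2 * (cf_conv R q 1 u0 u1 (2 * m)).2 by [].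
have -> : (cf_conv R q 1 u0 u1 (2 * m).+2).1 = (cf_conv R q 1 u0 u1 (2 * m)).2 +
  a (2 * m).+1 * (cf_conv R q 1 u0 u1 (2 * m)).1 by [].
case: (cf_conv R q 1 u0 u1 (2 * m)) => u v /= IH1 IH2.
have h1 : y ^+ (m.+1 ^ 2) * (v + a (2 * m).+1 * u) \is a Num.int.
  have -> : y ^+ (m.+1 ^ 2) * (v + a (2 * m).+1 * u) = y ^+ m.+1 * (y ^+ (m ^ 2 + m) * v) +
      (y ^+ (2 * m).+1 * a (2 * m).+1) * (y ^+ (m ^ 2) * u).
    by rewrite mulrDr {1}sqrnS_split sqrnS_odd !exprD; ring.
  by rewrite a_odd mul1r rpredD // rpredM // rpredX.
split=> //; rewrite mulrDr rpredD //.
  by rewrite addnC exprD -mulrA rpredM // rpredX.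
have -> : y ^+ (m.+1 ^ 2 + m.+1) * (a (2 * m).+2 * v) =
    (y ^+ (2 * m.+1) * a (2 * m.+1)) * (y ^+ (m ^ 2 + m) * v).
  by rewrite sqrnS_even mul2S [y ^+ (_ + (m ^ 2 + m))]exprD; ring.
by rewrite a_even rpredM ?rpredD ?rpredX ?rpred1.
Qed.

(** Two consecutive partial numerators, of indices 2m+1 and 2m+2, contribute the exponent (2m+1) +
    (m+1) = 3m+2, apart from a factor between 1/2 and 3/2; the sum is 3m^2/2 + O(m). *)
Let ln_num_bound m :
  `|ln `|\prod_(1 <= i < (2 * m).+1) a i| + (3 / 2 * m%:R ^+ 2) * ln `|p| |
    <= 2 * m%:R * ln `|p|.
Proof.
have q0 : 0 < `|q| by rewrite normr_gt0.
have lnq : ln `|q| = - ln `|p| by rewrite normrN normfV lnV ?posrE ?normr_gt0.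
elim: m => [|m IH].
  by rewrite big_geq // normr1 ln1 expr0n mulr0 mul0r addr0 normr0 mulr0 mul0r.
have P0 : \prod_(1 <= i < (2 * m).+1) a i != 0.
  rewrite prodf_seq_neq0; apply/allP => i; rewrite mem_index_iota => /andP[i0 _].
  by rewrite (cf_num_neq0 _ _ _ q_small q_neq0 one_le1 (oner_neq0 _)).
have E : \prod_(1 <= i < (2 * m.+1).+1) a i =
    \prod_(1 <= i < (2 * m).+1) a i * (q ^+ (3 * m + 2) * (1 + q ^+ m.+1)).
  have recr k : \prod_(1 <= i < k.+2) a i = \prod_(1 <= i < k.+1) a i * a k.+1.
    by rewrite big_nat_recr.
  rewrite mul2S recr recr -mulrA; congr (_ * _).
  rewrite -mul2S a_evenE -cf_exponent exprD /a /cf_num /= oddM /= mul1r.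
  by rewrite mulrA.
have h := one_sub_exp_ge R (- r) q_small m.
have h1 : 1 / 2 <= 1 + q ^+ m.+1 <= 3 / 2.
  have := norm_exp_small _ _ q_small m.+1.
  have := ler_norm (q ^+ m.+1); have := ler_norm (- q ^+ m.+1); rewrite normrN.
  have : 1 / 2 ^+ m.+1 <= 1 / 2 :> R.
    by rewrite ler_pM2l // lef_pV2 ?posrE ?exprn_gt0 // exprS ler_peMr // exprn_ege1 //; lra.
  lra.
have {h1}[h2 h3] := andP h1.
have z0 : 0 < 1 + q ^+ m.+1 by lra.
have l2 := ln2_le_lnbase R x hx.
have lz1 : ln (1 + q ^+ m.+1) <= ln `|p|.
  by apply: le_trans l2; rewrite ler_ln ?posrE //; lra.
have lz2 : - ln `|p| <= ln (1 + q ^+ m.+1).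
  have : ln (1 / 2) <= ln (1 + q ^+ m.+1) by rewrite ler_ln ?posrE.
  rewrite ln_div ?posrE // ln1 -/p; move: l2; rewrite -/p; lra.
rewrite E !normrM (gtr0_norm z0) normrX !lnM ?posrE ?mulr_gt0 ?exprn_gt0 ?normr_gt0 //.
have -> : ln (`|q| ^+ (3 * m + 2)) = (3 * m%:R + 2) * - ln `|p|.
  by rewrite lnXn // lnq -[LHS]mulr_natl natrD natrM.
rewrite -natr1.
move: IH; set u := ln `|\prod_(1 <= i < _) _|; set l := ln `|p| in lz1 lz2 *.
set v := ln (1 + _) in lz1 lz2 * => IH.
rewrite [X in `|X|](_ : _ = (u + 3 / 2 * m%:R ^+ 2 * l) + (v - l / 2)); last by field.
apply: (le_trans (ler_normD _ _)).
have : `|v - l / 2| <= 3 / 2 * l by rewrite ler_norml; apply/andP; split; lra.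
have l0 : 0 < l := lam_gt0; lra.
Qed.

Lemma B4_measure : irrational (B4 r) /\ (irrationality_measure (B4 r) <= 3%:E)%E.
Proof.
have F0 := cf_tail0_neq0 _ _ _ q_small q_neq0 one_le1 (oner_neq0 R).
pose F n := cf_tail R q 1 n.
have xiE : B4 r = F 1%N / F 0%N by exact: B4_continued_fraction base_inv_small r_neq0.
have -> : 3 = 1 + (ln `|p| + 0) / (ln `|p| / 2 - 0) :> R.
  by rewrite addr0 subr0; field; rewrite gt_eqF.
pose Q m := y ^+ (m ^ 2) * (cf_conv R q 1 1 1 (2 * m)).1.
pose P m := y ^+ (m ^ 2) * (cf_conv R q 1 0 1 (2 * m)).1.
have LE m : Q m * B4 r - P m =
    y ^+ (m ^ 2) * \prod_(1 <= i < (2 * m).+1) a i * F (2 * m).+1 / F 0%N.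
  have [h _] := cf_conv_form R q 1 q_small one_le1 (2 * m).
  rewrite exprM sqrrN !expr1n mul1r in h.
  apply: (mulIf F0); rewrite [RHS]divfK // -[RHS]mulrA -h /Q /P xiE /F; field; exact: F0.
have a0 m : \prod_(1 <= i < (2 * m).+1) a i != 0.
  rewrite prodf_seq_neq0; apply/allP => i; rewrite mem_index_iota => /andP[i0 _].
  by rewrite (cf_num_neq0 _ _ _ q_small q_neq0 one_le1 (oner_neq0 _)).
have y0 m : y ^+ m != 0 by rewrite expf_neq0 // -normr_gt0 norm_y normr_gt0.
have Fb m : (4 <= m)%N -> 1 / 2 <= F (2 * m).+1 <= 3 / 2.
  move=> m4; apply: (cf_tail_bounds R q 1 q_small q_neq0 one_le1 (oner_neq0 R)).
  by rewrite ltnW // ltnS -[8%N]/(2 * 4)%N leq_mul2l.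
have l2 := ln2_le_lnbase R x hx; rewrite -/p in l2.
have c0 : 0 <= 3 * ln `|p| + `|ln `|F 0%N| | by rewrite addr_ge0 // mulr_ge0 // ltW.
apply: (@irrationality_criterion_ln _ _ _ _ _ (3 * ln `|p| + `|ln `|F 0%N| |) (fun=> 1) Q P) => //.
- by rewrite addr0.
- by rewrite subr0 divr_gt0.
- by exists 0%N => // n _; exact: oner_neq0.
- exists 0%N => // m _; rewrite !mul1r; split.
    by have [] := conv_int 1 1 m (rpred1 _) (rpred1 _).
  by have [] := conv_int 0 1 m (rpred0 _) (rpred1 _).
- exists 4%N => // m /= m4; rewrite LE !mulf_neq0 ?invr_eq0 //.
  by have /andP[h _] := Fb m m4; rewrite gt_eqF //; lra.
- move=> e e0; exists 0%N => // m _; rewrite normr1 ln1 add0r.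
  by rewrite addr_ge0 // mulr_ge0 ?sqr_ge0 // ltW.
- exists 1%N => // m /= m1.
  have [h _] := cf_conv_bound R q 1 q_small one_le1 1 1 (2 * m) one_le1 one_le1.
  have [->|Q0] := eqVneq (Q m) 0.
    by rewrite normr0 ln0 // addr_ge0 // mulr_ge0 ?sqr_ge0 // ltW.
  have : ln `|Q m| <= ln (`|p| ^+ (m ^ 2) * `|p| ^+ (2 * m)).
    rewrite ler_ln ?posrE ?normr_gt0 ?mulr_gt0 ?exprn_gt0 ?normr_gt0 //.
    rewrite normrM normrX norm_y ler_wpM2l ?exprn_ge0 //; apply: (le_trans h).
    by rewrite lerXn2r ?nnegrE.
  rewrite -exprD lnXn ?normr_gt0 // -[ln `|p| *+ _]mulr_natl natrD natrX natrM => h2.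
  apply: (le_trans h2).
  have e2 : 0 <= `|ln `|F 0%N| | * m%:R by rewrite mulr_ge0.
  have e3 : 0 <= m%:R * ln `|p| by rewrite mulr_ge0 // ltW.
  lra.
exists 4%N => // m /= m4.
have /andP[f1 f2] := Fb m m4; have f0 : 0 < F (2 * m).+1 by lra.
have lf : `|ln (F (2 * m).+1)| <= ln `|p|.
  rewrite ler_norml; apply/andP; split; last first.
    by apply: le_trans l2; rewrite ler_ln ?posrE //; lra.
  have : ln (1 / 2) <= ln (F (2 * m).+1) by rewrite ler_ln ?posrE.
  rewrite ln_div ?posrE // ln1; lra.
rewrite LE !normrM normfV (gtr0_norm f0) normrX norm_y.
rewrite ln_div ?posrE ?mulr_gt0 ?exprn_gt0 ?normr_gt0 //.
rewrite !lnM ?posrE ?mulr_gt0 ?exprn_gt0 ?normr_gt0 // lnXn ?normr_gt0 //.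
have := ln_num_bound m; set u := ln `|\prod_(1 <= i < _) _|.
move: lf; set f := ln (F _); set g := ln `|F 0%N|; set l := ln `|p| => lf hu.
rewrite -[l *+ _]mulr_natl natrX.
rewrite [X in `|X|](_ : _ = (u + 3 / 2 * m%:R ^+ 2 * l) + f - g); last by field.
apply: (le_trans (ler_normB _ _)).
have := ler_normD (u + 3 / 2 * m%:R ^+ 2 * l) f => h1.
have m1 : 1 <= m%:R :> R by rewrite ler1n (leq_trans _ m4).
have e2 : `|g| <= `|g| * m%:R by rewrite ler_peMr.
have e3 : l <= l * m%:R by rewrite ler_peMr // ltW.
move: hu lf h1 e2 e3; lra.
Qed.
End PartitionMeasure.

(** * Common denominators *)

Lemma leq_divnD m n d : (m %/ d + n %/ d <= (m + n) %/ d)%N.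
Proof.
have [->|d0] := posnP d; first by rewrite !divn0.
by rewrite leq_divRL // mulnDl leq_add // leq_trunc_div.
Qed.

(* Hermite's identity floor(j/e) + floor(j/e + 1/2) = floor(2j/e), for odd e. *)
Lemma divn_double_odd j e : odd e -> (j %/ e + (j + e./2) %/ e <= (j + j) %/ e)%N.
Proof.
move=> oe; have e0 : (0 < e)%N by case: e oe.
have E : e = (2 * e./2).+1 by have := odd_double_half e; rewrite oe; lia.
rewrite leq_divRL //.
have := leq_trunc_div (j + e./2) e; have := divn_eq j e; have := ltn_pmod j e0.
move: (j %/ e)%N (j %% e)%N ((j + e./2) %/ e)%N E => B j' t; move: e./2 => h Ee.
rewrite Ee => h1 h2 h3.
have [tB|tB] := leqP t B; first by nia.
have t1 : (t <= B.+1)%N.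
  rewrite leqNgt; apply/negP => tB2; have : (B.+2 * (2 * h).+1 <= t * (2 * h).+1)%N by rewrite leq_mul2r tB2 orbT.
  nia.
have -> : t = B.+1 by lia.
have tE : t = B.+1 by lia.
rewrite tE in h3; nia.
Qed.

Section Integrality.
Variables (R : realType) (x : int).
Hypothesis hx : 2 <= `|x|.
Let ev := evprod R x.
Let od := odprod R x.
Let op := oddpartprod R x.
Let cf := cycfact R x.
Let D := evcycprod R x.

Let evE n e := (if odd e then n %/ e else n %/ e./2)%N.
Let odE n e := (if odd e then (n + e./2) %/ e else 0)%N.

(** At odd e the quotient of the two values of [od] pays for the second factor [ev i]. At even e it
    contributes nothing, and [D N] pays instead. *)
Lemma evcycprod_qbin_int N i : (i <= N)%N ->
  D N * (ev N * od (N + i) / (ev i * ev i * ev (N - i) * od N)) \is a Num.int.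
Proof.
move=> iN; pose M := (4 * N).+3.
have h1 n : (n <= N)%N -> cf M (evE n) (ev n) by move=> nN; apply: cycfact_evprod; rewrite /M; lia.
have h2 n : (n <= N + N)%N -> cf M (odE n) (od n).
  by move=> nN; apply: cycfact_odprod; rewrite // /M; lia.
have h3 : cf M (fun e => if odd e then N %/ e else 0)%N (op N).
  by apply: cycfact_oddpartprod; rewrite // /M; lia.
have hN := h1 N (leqnn _); have hi := h1 i iN; have hNi := h1 (N - i)%N (leq_subr _ _).
have oN := h2 N (leq_addr _ _); have oNi : cf M (odE (N + i)) (od (N + i)) by apply: h2; rewrite leq_add2l.
have num := cycfactM _ _ _ _ _ _ _ (cycfactM _ _ _ _ _ _ _ hN hN) oNi.
have den := cycfactM _ _ _ _ _ _ _ h3 (cycfactM _ _ _ _ _ _ _ (cycfactM _ _ _ _ _ _ _ (cycfactM _ _ _ _ _ _ _ hi hi) hNi) oN).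
have -> : D N * (ev N * od (N + i) / (ev i * ev i * ev (N - i) * od N)) =
   (ev N * ev N * od (N + i)) / (op N * (ev i * ev i * ev (N - i) * od N)).
  by rewrite /D /evcycprod mulf_div [in LHS]mulrA.
apply: (cycfact_int _ _ hx _ _ _ _ _ num den) => e /andP[e0 _]; rewrite /evE /odE.
case: ifP => _.
  have a1 := leq_divnD i (N - i) e; rewrite subnKC // in a1.
  have a2 := leq_divnD (N + e./2) i e; rewrite addnAC in a2.
  move: a1 a2; move: (i %/ e)%N ((N - i) %/ e)%N (N %/ e)%N ((N + e./2) %/ e)%N.
  move: ((N + i + e./2) %/ e)%N => a b c d f; clear; lia.
have := leq_divnD i (N - i) e./2; rewrite subnKC //.
move: (i %/ e./2)%N ((N - i) %/ e./2)%N (N %/ e./2)%N => a b c; clear; lia.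
Qed.

(** With 2N-k = 2(N-k) + k, Hermite's identity pays for [od (N - k)] at odd e, so no common
    denominator is spent here. *)
Lemma qbin_mixed_int N k : (k <= N)%N ->
  ev (2 * N - k) / (ev (N - k) * ev k * od (N - k)) \is a Num.int.
Proof.
move=> kN; pose M := (4 * N).+3.
have h1 n : (n <= 2 * N)%N -> cf M (evE n) (ev n) by move=> nN; apply: cycfact_evprod; rewrite /M; lia.
have h2 n : (n <= N)%N -> cf M (odE n) (od n).
  by move=> nN; apply: cycfact_odprod; rewrite // /M; lia.
have num := h1 (2 * N - k)%N (leq_subr _ _).
have hk := h1 k ltac:(lia); have hNk := h1 (N - k)%N ltac:(lia).
have oNk := h2 (N - k)%N (leq_subr _ _).
have den := cycfactM _ _ _ _ _ _ _ (cycfactM _ _ _ _ _ _ _ hNk hk) oNk.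
apply: (cycfact_int _ _ hx _ _ _ _ _ num den) => e /andP[e0 _]; rewrite /evE /odE.
have E : (2 * N - k = (N - k) + (N - k) + k)%N by clear -kN; lia.
rewrite E; case: (boolP (odd e)) => oe.
  have a1 := divn_double_odd (N - k) e oe.
  have a2 := leq_divnD (N - k + (N - k)) k e; move: a1 a2.
  move: ((N - k + (N - k) + k) %/ e)%N ((N - k + (N - k)) %/ e)%N ((N - k) %/ e)%N (k %/ e)%N.
  move: ((N - k + e./2) %/ e)%N => a b c d f; clear; lia.
have a1 := leq_divnD (N - k + (N - k)) k e./2.
have a2 := leq_divnD (N - k) (N - k) e./2; move: a1 a2.
move: ((N - k + (N - k) + k) %/ _)%N ((N - k + (N - k)) %/ _)%N ((N - k) %/ _)%N (k %/ _)%N.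
by move=> a b c d; clear; lia.
Qed.

(** As 2N-l+1 = (N-l+1) + N, at odd e the quotient of the two values of [od] pays for both values of
    [ev]; at even e [D N] does. *)
Lemma evcycprod_residue_int N l : (l <= N)%N ->
  D N * (od (2 * N - l).+1 / (od (N - l).+1 * ev l * ev (N - l))) \is a Num.int.
Proof.
move=> lN; pose M := (4 * N).+4.
have h1 n : (n <= N)%N -> cf M (evE n) (ev n) by move=> nN; apply: cycfact_evprod; rewrite /M; lia.
have h2 n : (n <= (2 * N).+1)%N -> cf M (odE n) (od n).
  by move=> nN; apply: cycfact_odprod; rewrite // /M; lia.
have h3 : cf M (fun e => if odd e then N %/ e else 0)%N (op N).
  by apply: cycfact_oddpartprod; rewrite // /M; lia.
have hN := h1 N (leqnn _); have hl := h1 l lN; have hNl := h1 (N - l)%N (leq_subr _ _).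
have o1 := h2 (2 * N - l).+1 ltac:(lia); have o2 := h2 (N - l).+1 ltac:(lia).
have num := cycfactM _ _ _ _ _ _ _ hN o1.
have den := cycfactM _ _ _ _ _ _ _ h3 (cycfactM _ _ _ _ _ _ _ (cycfactM _ _ _ _ _ _ _ o2 hl) hNl).
have -> : D N * (od (2 * N - l).+1 / (od (N - l).+1 * ev l * ev (N - l))) =
   (ev N * od (2 * N - l).+1) / (op N * (od (N - l).+1 * ev l * ev (N - l))).
  by rewrite /D /evcycprod mulf_div.
apply: (cycfact_int _ _ hx _ _ _ _ _ num den) => e /andP[e0 _]; rewrite /evE /odE.
case: ifP => _.
  have a1 := leq_divnD l (N - l) e; rewrite subnKC // in a1.
  have a2 := leq_divnD ((N - l).+1 + e./2) N e.
  have -> : ((2 * N - l).+1 + e./2 = (N - l).+1 + e./2 + N)%N by clear -lN; lia.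
  move: a1 a2; move: (l %/ e)%N ((N - l) %/ e)%N (N %/ e)%N (((N - l).+1 + e./2) %/ e)%N.
  move: (((N - l).+1 + e./2 + N) %/ e)%N => a b c d f; clear; lia.
have := leq_divnD l (N - l) e./2; rewrite subnKC //.
move: (l %/ e./2)%N ((N - l) %/ e./2)%N (N %/ e./2)%N => a b c; clear; lia.
Qed.

(** Compared with [ev k], the product [od k.+1] has at most one more factor of each odd index e <=
    2N+1 and none of larger odd index. This excess is what [oddcycprod] has to clear. *)
Lemma oddcycprod_head_int N k : (k <= N)%N ->
  oddcycprod R x N * (ev (2 * N - k) / (ev (N - k) * od k.+1 * od (N - k))) \is a Num.int.
Proof.
move=> kN; pose M := (4 * N).+4.
have hE n : (n <= 2 * N)%N -> cf M (evE n) (ev n) by move=> nN; apply: cycfact_evprod; rewrite /M; lia.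
have hO n : (n <= N.+1)%N -> cf M (odE n) (od n).
  by move=> nN; apply: cycfact_odprod; rewrite // /M; lia.
have hD : cf M (fun e => odd e && (e <= (2 * N).+1)%N) (oddcycprod R x N).
  by apply: cycfact_oddcycprod; rewrite // /M; lia.
have h1 := hE (2 * N - k)%N (leq_subr _ _); have h2 := hE (N - k)%N ltac:(lia).
have h3 := hO k.+1 kN; have h4 := hO (N - k)%N ltac:(lia).
have num := cycfactM _ _ _ _ _ _ _ hD h1.
have den := cycfactM _ _ _ _ _ _ _ (cycfactM _ _ _ _ _ _ _ h2 h3) h4.
rewrite mulrA; apply: (cycfact_int _ _ hx _ _ _ _ _ num den) => e /andP[e0 _]; rewrite /evE /odE.
have -> : (2 * N - k = (N - k) + (N - k) + k)%N by clear -kN; lia.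
case: (boolP (odd e)) => oe.
  have a1 := divn_double_odd (N - k) e oe.
  have a2 := leq_divnD (N - k + (N - k)) k e.
  have E : e = (2 * e./2).+1 by have := odd_double_half e; rewrite oe; clear; lia.
  have a3 : ((k.+1 + e./2) %/ e <= k %/ e + (e <= (2 * N).+1))%N.
    case: (leqP e (2 * N).+1) => eN.
      have -> : (k %/ e + true = (k + e) %/ e)%N by rewrite divnDr ?dvdnn // divnn e0.
      by apply: leq_div2r; rewrite {2}E; clear; lia.
    rewrite divn_small //; move: E eN kN; clear; lia.
  move: a1 a2 a3; rewrite andTb; move: (nat_of_bool (e <= _)%N).
  move: ((N - k + (N - k) + k) %/ e)%N ((N - k + (N - k)) %/ e)%N ((N - k) %/ e)%N (k %/ e)%N.
  move: ((N - k + e./2) %/ e)%N ((k.+1 + e./2) %/ e)%N => a b c d f g i; clear; lia.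
have a1 := leq_divnD (N - k + (N - k)) k e./2.
have a2 := leq_divnD (N - k) (N - k) e./2; move: a1 a2.
move: ((N - k + (N - k) + k) %/ _)%N ((N - k + (N - k)) %/ _)%N ((N - k) %/ _)%N (k %/ _)%N.
by move=> a b c d; clear; lia.
Qed.

(** The cyclotomic factors of x^(2n+1) - 1 are simple and of odd index at most 2N+1. *)
Lemma oddcycprod_factor_int N n : (n <= N)%N ->
  oddcycprod R x N / ((x%:~R : R) ^+ (2 * n).+1 - 1) \is a Num.int.
Proof.
move=> nN; pose M := (4 * N).+4.
have hD : cf M (fun e => odd e && (e <= (2 * N).+1)%N) (oddcycprod R x N).
  by apply: cycfact_oddcycprod; rewrite // /M; lia.
have hn : cf M (fun e => (e %| (2 * n).+1)%N) (x%:~R ^+ (2 * n).+1 - 1).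
  by apply: cycfact_expB1; rewrite // /M; lia.
apply: (cycfact_int _ _ hx _ _ _ _ _ hD hn) => e /andP[e0 _].
case: (boolP (e %| _)%N) => // en.
have -> : odd e by apply: dvdn_odd en _; rewrite oddS oddM.
have h := dvdn_leq (ltn0Sn (2 * n)) en; by have -> : (e <= (2 * N).+1)%N by rewrite (leq_trans h) // ltnS leq_mul2l nN orbT.
Qed.
End Integrality.

(** * Approximants of psi *)

Section QBinomialTheorem.
Variables (R : realType) (q : R).
Hypothesis q_small : `|q| <= 1 / 2.

Lemma pochD a m n : poch R a q (m + n) = poch R a q m * poch R (a * q ^+ m) q n.
Proof.
elim: n => [|n IH]; first by rewrite addn0 poch0 mulr1.
by rewrite addnS !pochS IH exprD !mulrA.
Qed.

Let norm_poch_le A k : `|poch R A q k| <= expR (2 * `|A|).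
Proof.
apply: (@le_trans _ _ (expR (\sum_(0 <= j < k) `|A| * 2^-1 ^+ j))).
  rewrite expR_sum /poch normr_prod; apply: ler_prod => j _; rewrite normr_ge0 /=.
  apply: le_trans (expR_ge1Dx _); apply: (le_trans (ler_normB _ _)); rewrite normr1 lerD2l.
  rewrite normrM; apply: ler_wpM2l => //.
  by apply: (le_trans (norm_exp_small _ _ q_small _)); rewrite div1r exprVn.
rewrite ler_expR -mulr_sumr mulrC; apply: ler_wpM2r => //.
have h : \sum_(0 <= j < k) 2^-1 ^+ j = 2 - 2 * 2^-1 ^+ k :> R.
  elim: k => [|k IH]; first by rewrite big_geq // expr0; lra.
  by rewrite big_nat_recr //= IH exprS; field.
rewrite h lerBlDr lerDl mulr_ge0 // exprn_ge0 //; lra.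
Qed.

Let norm_poch_qq_ge k : 2^-1 ^+ k <= `|poch R q q k|.
Proof.
elim: k => [|k IH]; first by rewrite poch0 normr1.
rewrite pochS normrM exprSr; apply: ler_pM => //.
by rewrite -exprS ger0_norm; have := one_sub_exp_ge _ _ q_small k; lra.
Qed.

(** The terms of 1phi0(A; q, z), whose sum is (Az; q)_oo / (z; q)_oo by the q-binomial theorem. *)
Definition qbin_term A z k : R := poch R A q k / poch R q q k * z ^+ k.
Definition qbin_sum A z : R := limn (series (qbin_term A z)).

Let term_bound A z k : `|z| <= 1 / 8 ->
  `|qbin_term A z k.+1| <= expR (2 * `|A|) * 2 * `|z| * 2^-1 ^+ k.
Proof.
move=> z8; have pz : 0 < `|poch R q q k.+1| by rewrite normr_gt0 (poch_qq_neq0 _ _ q_small).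
rewrite /qbin_term normrM normrM normfV normrX.
have h1 : `|poch R A q k.+1| / `|poch R q q k.+1| <= expR (2 * `|A|) * 2 ^+ k.+1.
  rewrite ler_pdivrMr // -mulrA; apply: (le_trans (norm_poch_le _ _)).
  rewrite ler_peMr ?expR_ge0 //.
  have h := norm_poch_qq_ge k.+1.
  rewrite -[leLHS](_ : 2 ^+ k.+1 * 2^-1 ^+ k.+1 = 1); first by rewrite ler_pM2l ?exprn_gt0.
  by rewrite -exprMn divff // expr1n.
apply: (le_trans (ler_wpM2r (exprn_ge0 k.+1 (normr_ge0 z)) h1)).
have -> : expR (2 * `|A|) * 2 ^+ k.+1 * `|z| ^+ k.+1 =
    expR (2 * `|A|) * 2 * `|z| * (2 * `|z|) ^+ k by rewrite !exprS exprMn; ring.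
apply: ler_wpM2l; first by rewrite !mulr_ge0 ?expR_ge0.
by apply: lerXn2r; rewrite ?nnegrE ?mulr_ge0 //; lra.
Qed.

Let half01 : 0 <= (2^-1 : R) < 1. Proof. lra. Qed.

Lemma qbin_sumP A z : `|z| <= 1 / 8 -> is_sum R (qbin_term A z) (qbin_sum A z) /\
  `|qbin_sum A z - 1| <= 4 * expR (2 * `|A|) * `|z|.
Proof.
move=> z8.
have [|s hs hs'] := is_sum_geo_bound R (expR (2 * `|A|) * 2 * `|z|) 2^-1
  (fun k => qbin_term A z (1 + k)) half01 _; first by move=> k; exact: term_bound.
have h0 := is_sum_shift _ 1 _ _ hs.
rewrite big_nat1 {2}/qbin_term !poch0 divr1 expr0 mulr1 in h0.
rewrite /qbin_sum (is_sum_lim _ _ _ h0); split=> //.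
rewrite addrC addKr; apply: (le_trans hs').
by rewrite le_eqVlt; apply/orP; left; apply/eqP; field.
Qed.

Let norm_mulq z n : `|z| <= 1 / 8 -> `|z * q ^+ n| <= 1 / 8.
Proof.
move=> z8; rewrite normrM -[leRHS]mulr1; apply: ler_pM => //.
by rewrite normrX exprn_ile1 // (norm_q_le1 _ _ q_small).
Qed.

Lemma qbin_sum_rec A z : `|z| <= 1 / 8 ->
  (1 - z) * qbin_sum A z = (1 - A * z) * qbin_sum A (z * q).
Proof.
move=> z8; have zq8 : `|z * q| <= 1 / 8 by have := norm_mulq z 1 z8; rewrite expr1.
have [h1 _] := qbin_sumP A _ z8; have [h2 _] := qbin_sumP A _ zq8.
have h3 := is_sumB _ _ _ _ _ h1 h2.
have h4 := is_sumZ _ z _ _ (is_sumB _ _ _ _ _ h1 (is_sumZ _ A _ _ h2)).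
have h5 : is_sum R (fun k => qbin_term A z (1 + k) - qbin_term A (z * q) (1 + k))
    (z * (qbin_sum A z - A * qbin_sum A (z * q))).
  apply: is_sum_ext h4 => k; rewrite /qbin_term add1n !pochS !exprS !exprMn.
  have := poch_qq_neq0 _ _ q_small k.+1; rewrite pochS mulf_eq0 negb_or => /andP[p0 q0].
  by field; rewrite p0 q0.
have := is_sum_shift _ 1 (fun k => qbin_term A z k - qbin_term A (z * q) k) _ h5.
have E0 : qbin_term A z 0 - qbin_term A (z * q) 0 = 0 by rewrite /qbin_term !expr0 subrr.
rewrite big_nat1 E0 add0r => /(is_sum_unique _ _ _ _ h3) E.
rewrite mulrBl mul1r mulrBl mul1r.
apply/eqP; rewrite -subr_eq0; apply/eqP.
have -> : qbin_sum A z - z * qbin_sum A z - (qbin_sum A (z * q) - A * z * qbin_sum A (z * q)) =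
  (qbin_sum A z - qbin_sum A (z * q)) - z * (qbin_sum A z - A * qbin_sum A (z * q)) by ring.
by rewrite E subrr.
Qed.

(** The finite form of the q-binomial theorem, obtained from n steps of the functional equation; the
    last factor tends to 1. *)
Lemma qbin_sum_iter A z n : `|z| <= 1 / 8 ->
  poch R z q n * qbin_sum A z = poch R (A * z) q n * qbin_sum A (z * q ^+ n).
Proof.
move=> z8; elim: n => [|n IH]; first by rewrite !poch0 expr0 mulr1.
rewrite !pochS mulrAC IH -!mulrA [_ * (1 - _)]mulrC.
by rewrite qbin_sum_rec ?norm_mulq // exprSr !mulrA.
Qed.

Lemma cvg_qbin_sum A z : `|z| <= 1 / 8 -> (fun n => qbin_sum A (z * q ^+ n)) @ \oo --> (1 : R).
Proof.
move=> z8; apply: (@cvg_le_harmonic _ _ _ (4 * expR (2 * `|A|)) 0) => n _.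
have [_ h] := qbin_sumP A _ (norm_mulq z n z8); apply: (le_trans h).
apply: ler_wpM2l; first by rewrite mulr_ge0 ?expR_ge0.
rewrite normrM -[leRHS]mul1r; apply: ler_pM => //; first lra.
apply: (le_trans (norm_exp_small _ _ q_small _)); rewrite div1r lef_pV2 ?posrE ?exprn_gt0 //.
by rewrite -natrX ler_nat ltn_expl.
Qed.

Lemma cvg_poch_shift a m N : `|a| <= 1 -> (fun n => poch R (a * q ^+ (m + n)) q N) @ \oo --> (1 : R).
Proof.
move=> a1; apply: (@cvg_le_harmonic _ _ _ (2 * N%:R) (2 * N)) => n nN.
have n2 : n.+1%:R <= 2 ^+ n :> R by rewrite -natrX ler_nat ltn_expl.
have p0 : 0 < 2 ^+ n :> R by exact: exprn_gt0.
apply: (le_trans (prod_sub1_le _ _ _ (1 / 2 ^+ n) _ _ _)).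
- rewrite mulrA mulr1 ler_pdivrMr // -ler_pdivrMl // (_ : (1 / 2)^-1 = 2); last by field.
  apply: le_trans n2; rewrite -natrM ler_nat; exact: leq_trans (leqnSn _).
- by rewrite divr_ge0 // ltW.
- move=> j _; rewrite -mulrA -exprD normrM -[leRHS]mul1r; apply: ler_pM => //.
  apply: (le_trans (norm_exp_small _ _ q_small _)); rewrite ler_pM2l //.
  rewrite lef_pV2 ?posrE ?exprn_gt0 // ler_weXn2l //; [lra | lia].
rewrite mulrA; apply: ler_wpM2l; first by rewrite mulr_ge0.
by rewrite div1r lef_pV2 ?posrE.
Qed.

Lemma norm_poch_bounds a n : `|a| <= 1 / 2 ->
  2^-1 ^+ n <= `|poch R a q n| <= 2 ^+ n.
Proof.
move=> a2; elim: n => [|n /andP[lo hi]]; first by rewrite poch0 normr1 !expr0 lexx.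
have h : `|a * q ^+ n| <= 1 / 2.
  rewrite normrM -[leRHS]mulr1; apply: ler_pM => //.
  by rewrite normrX exprn_ile1 // (norm_q_le1 _ _ q_small).
have h1 := ler_normB 1 (a * q ^+ n); have h2 := lerB_dist 1 (a * q ^+ n).
rewrite normr1 in h1 h2; rewrite pochS normrM !exprSr; apply/andP; split.
  by apply: ler_pM => //; move: h h2; lra.
by apply: ler_pM => //; move: h h1; lra.
Qed.

End QBinomialTheorem.

(** * Gauss's product for psi *)

Section PsiProduct.
Variables (R : realType) (r : R).
Hypothesis r_small : `|r| <= 1 / 2.
Hypothesis r_neq0 : r != 0.
Let q := r ^+ 2.

Lemma sqr_small : `|q| <= 1 / 2.
Proof.
rewrite /q normrX expr2; apply: (@le_trans _ _ (1 / 2 * 1)); last lra.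
by apply: ler_pM => //; apply: (le_trans r_small); lra.
Qed.

(** Gauss's identity read off from the continued fraction at s = -1. Then (1; r)_k kills every term
    of [cf_tail 0] but the first, and in [cf_tail 1] the Pochhammer products cancel, leaving the
    series of psi. *)
Lemma psi_product : (fun n => poch R q q n / poch R r q n) @ \oo --> psi r.
Proof.
have s1 : `|-1| <= 1 :> R by rewrite normrN normr1.
have s0 : -1 != 0 :> R by rewrite oppr_eq0 oner_neq0.
have := cf_product R r (-1) r_small r_neq0 s1 s0.
have -> : cf_tail R r (-1) 0 = 1.
  rewrite /cf_tail /= expr0 mulr1 /heine.
  have E0 k : heine_term R r (-1) 1 (1 + k) = 0.
    by rewrite /heine_term opprK add1n poch_recl subrr !mul0r mulr0 mul0r.
  have h0 : is_sum R (fun k => heine_term R r (-1) 1 (1 + k)) 0.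
    rewrite /is_sum (_ : series _ = fun=> 0); first exact: cvg_cst.
    by apply/funext => n; rewrite /series /= big1.
  have := is_sum_shift _ 1 _ _ h0.
  rewrite big_nat1 addr0 {2}/heine_term !poch0 /tri !expr0 !mulr1 divr1.
  exact: is_sum_lim.
have -> : cf_tail R r (-1) 1 = psi r.
  rewrite /cf_tail /= expr1 expr0 /heine /psi; congr (limn (series _)).
  apply/funext => k; rewrite /heine_term mulN1r opprK expr1n mulr1 mulfK //.
  exact: poch_qq_neq0.
rewrite divr1; rewrite (_ : (fun n => \prod_(0 <= j < n) _) = (fun n => poch R q q n / poch R r q n)) //.
apply/funext => n; rewrite /poch -prodf_div; apply: eq_bigr => j _.
rewrite !mulN1r /q -exprM addn1 -exprS -exprD; congr (_ / _).
by rewrite addnC.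
Qed.

Let q_small : `|q| <= 1 / 2 := sqr_small.

(** The parameters satisfy Az = q^(i+1) and z = r q^(N+i), so (Az; q)_oo / (z; q)_oo is Gauss's
    product for psi up to the finite products displayed. *)
Lemma psi_qbin N i : (0 < N)%N ->
  is_sum R (qbin_term R q (r / q ^+ N) (r * q ^+ (N + i)))
    (psi r * (poch R r q (N + i) / poch R q q i)).
Proof.
move=> N0; set A := r / q ^+ N; set z := r * q ^+ (N + i).
have q0 : q != 0 by rewrite expf_neq0.
(* Here z = r^(2(N+i)+1), an exponent of at least 3 because N > 0. *)
have z8 : `|z| <= 1 / 8.
  rewrite /z /q -exprM -exprS.
  apply: (le_trans (norm_exp_small _ _ r_small _)).
  rewrite ler_pM2l // lef_pV2 ?posrE ?exprn_gt0 //.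
  rewrite (_ : 8 = 2 ^+ 3 :> R); last by ring.
  by rewrite ler_weXn2l //; [lra | move: N0; clear; lia].
have [hs _] := qbin_sumP R q q_small A z z8.
have p0 := poch_qq_neq0 R q q_small i.
suff -> : psi r * (poch R r q (N + i) / poch R q q i) = qbin_sum R q A z by [].
rewrite mulrA; apply: (mulIf p0); rewrite divfK //.
have Az : A * z = q * q ^+ i.
  by rewrite /A /z exprD /q; field; rewrite expf_neq0.
have hl : (fun n => poch R q q (i + n) / poch R r q (i + n) * poch R r q (N + i) *
     qbin_sum R q A (z * q ^+ n)) @ \oo --> psi r * poch R r q (N + i) * 1.
  apply: cvgM (cvg_qbin_sum R q q_small A z z8).
  apply: cvgM; last exact: cvg_cst.
  exact: (cvg_sub_seq _ _ _ (addn i) (leq_addl i) psi_product).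
have r1 : `|r| <= 1 by apply: (le_trans r_small); lra.
have hr : (fun n => qbin_sum R q A z * poch R (r * q ^+ (i + n)) q N * poch R q q i) @ \oo -->
     qbin_sum R q A z * 1 * poch R q q i.
  apply: cvgM; last exact: cvg_cst.
  by apply: cvgM; [exact: cvg_cst | exact: cvg_poch_shift].
rewrite !mulr1 in hl hr; apply: (cvg_unique (@Rhausdorff R) hl).
rewrite (_ : (fun n => _ * qbin_sum R q A (z * q ^+ n)) =
   (fun n => qbin_sum R q A z * poch R (r * q ^+ (i + n)) q N * poch R q q i)) //.
apply/funext => n.
have d0 : poch R r q (i + n) != 0.
  have /andP[h _] := norm_poch_bounds R q q_small r (i + n) r_small.
  by rewrite -normr_gt0; apply: lt_le_trans h; apply: exprn_gt0; lra.
have := qbin_sum_iter R q q_small A z n z8; rewrite Az => h.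
have E1 : poch R r q (N + i) * poch R z q n = poch R r q (i + n) * poch R (r * q ^+ (i + n)) q N.
  by rewrite /z -!pochD [in RHS]addnC addnA.
have E2 : poch R q q i * poch R (q * q ^+ i) q n = poch R q q (i + n) by rewrite -pochD.
apply: (mulIf d0).
transitivity (poch R r q (N + i) * (poch R q q (i + n) * qbin_sum R q A (z * q ^+ n))).
  by field.
rewrite -E2 -mulrA -h.
transitivity (qbin_sum R q A z * (poch R r q (N + i) * poch R z q n) * poch R q q i); first by ring.
by rewrite E1; ring.
Qed.

End PsiProduct.

Lemma ln_sum_le (R : realType) (t : nat -> R) (u l : R) n : 0 <= u -> ln 2 <= l ->
  (forall i, (i < n.+1)%N -> `|t i| <= expR u) ->
  ln `|\sum_(0 <= i < n.+1) t i| <= u + n%:R * l.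
Proof.
move=> u0 l2 ht.
have l0 : 0 < l by apply: lt_le_trans l2; rewrite ln_gt0 //; lra.
have [->|s0] := eqVneq (\sum_(0 <= i < n.+1) t i) 0.
  by rewrite normr0 ln0 // addr_ge0 // mulr_ge0 // ltW.
have h : `|\sum_(0 <= i < n.+1) t i| <= expR (u + n%:R * l).
  apply: (le_trans (ler_norm_sum _ _ _)).
  apply: (@le_trans _ _ (n.+1%:R * expR u)).
    rewrite -[n.+1 in leRHS]subn0 mulr_natl -sumr_const_nat.
    by apply: ler_sum_nat => i /andP[_ i_n]; exact: ht.
  rewrite expRD mulrC ler_pM2l ?expR_gt0 //.
  apply: (@le_trans _ _ (2 ^+ n)); first by rewrite -natrX ler_nat ltn_expl.
  rewrite -[2 in leLHS](@lnK R) ?posrE // -expRM_natl ler_expR.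
  by apply: ler_wpM2l.
by rewrite -(expRK (u + _)) ler_ln ?posrE ?normr_gt0 ?expR_gt0.
Qed.

(* With [q = p^-2] this vanishes at [y = q^k] for [N < k <= 2N]: the gap separates
   the terms that go into the numerator from the remainder. *)
Definition gap_prod (R : realType) (p : R) N y : R :=
  \prod_(1 <= i < N.+1) (1 - y * p ^+ (2 * (N + i))).

(** * The linear forms in psi *)

Section PsiApproximants.
Variables (R : realType) (x : int).
Hypothesis hx : 2 <= `|x|.
Let p : R := x%:~R.
Let r : R := p^-1.
Let q : R := r ^+ 2.
Let l : R := ln `|p|.
Let ev := evprod R x.
Let od := odprod R x.

Let p_neq0 : p != 0. Proof. exact: base_neq0. Qed.
Let pX0 n : p ^+ n != 0. Proof. exact: expf_neq0. Qed.
Let r_neq0 : r != 0. Proof. by rewrite invr_eq0. Qed.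
Let r_small : `|r| <= 1 / 2. Proof. exact: base_inv_small. Qed.
Let q_small : `|q| <= 1 / 2. Proof. exact: sqr_small. Qed.
Let l_gt0 : 0 < l. Proof. exact: lnbase_gt0. Qed.
Let ev0 n : ev n != 0. Proof. exact: evprod_neq0. Qed.
Let od0 n : od n != 0. Proof. exact: odprod_neq0. Qed.
Let evS n : ev n.+1 = ev n * (p ^+ (2 * n.+1) - 1). Proof. exact: evprodS. Qed.
Let odS n : od n.+1 = od n * (p ^+ (2 * n).+1 - 1). Proof. exact: odprodS. Qed.
Let pB1 n : (0 < n)%N -> p ^+ n - 1 != 0. Proof. exact: expB1_neq0. Qed.

Definition gauss_coef N i : R := (-1) ^+ i * p ^+ (i * i.+1) * (ev N / (ev i * ev (N - i))).

(** The Pascal rule for Gaussian binomials in base p^2; writing the upper index through m + i keeps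
    the truncated subtractions exact. *)
Let gauss_coefS m i : gauss_coef (m + i).+2 i.+1 =
  gauss_coef (m + i).+1 i.+1 - p ^+ (2 * (m + i).+2) * gauss_coef (m + i).+1 i.
Proof.
rewrite /gauss_coef (_ : (m + i).+2 - i.+1 = m.+1)%N; last by lia.
rewrite (_ : (m + i).+1 - i.+1 = m)%N; last by lia.
rewrite (_ : (m + i).+1 - i = m.+1)%N; last by lia.
rewrite (evS (m + i).+1) (evS i) (evS m) (_ : i.+1 * i.+2 = i * i.+1 + 2 * i.+1)%N; last by lia.
rewrite (_ : 2 * (m + i).+2 = 2 * m.+1 + 2 * i.+1)%N; last by lia.
rewrite !(exprD p) (exprS (-1)).
have a0 := ev0 i; have b0 := ev0 m; have c0 := pB1 (2 * i.+1) isT; have d0 := pB1 (2 * m.+1) isT.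
move: c0 d0 a0 b0; set c := p ^+ (2 * i.+1); set d := p ^+ (2 * m.+1).
move=> c0 d0 a0 b0; field.
by rewrite a0 b0 c0 d0.
Qed.

Lemma gauss_binomial N y :
  \prod_(1 <= i < N.+1) (1 - y * p ^+ (2 * i)) = \sum_(0 <= i < N.+1) gauss_coef N i * y ^+ i.
Proof.
have g0 n : gauss_coef n 0 = 1.
  by rewrite /gauss_coef /ev evprod0 subn0 mul0n !expr0 !mul1r divff //; exact: ev0.
have gn n : gauss_coef n.+1 n.+1 = - (p ^+ (2 * n.+1) * gauss_coef n n).
  rewrite /gauss_coef !subnn /ev evprod0 !mulr1 (divff (ev0 n)) (divff (ev0 n.+1)) !mulr1.
  by rewrite exprS (_ : n.+1 * n.+2 = n * n.+1 + 2 * n.+1)%N ?exprD; [ring | lia].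
elim: N => [|N IH]; first by rewrite big_geq // big_nat1 g0 mul1r expr0.
rewrite big_nat_recr //= IH [RHS]big_nat_recl // g0 expr0 mulr1.
rewrite [in RHS]big_nat_recr //=.
set A := \sum_(0 <= i < N.+1) _.
have A1 : A = 1 + \sum_(0 <= i < N) gauss_coef N i.+1 * y ^+ i.+1.
  by rewrite /A big_nat_recl // g0 expr0 mulr1.
have A2 : A = \sum_(0 <= i < N) gauss_coef N i * y ^+ i + gauss_coef N N * y ^+ N.
  by rewrite /A big_nat_recr.
rewrite mulrBr mulr1 {1}A1 A2.
have -> : \sum_(0 <= i < N) gauss_coef N.+1 i.+1 * y ^+ i.+1 =
    \sum_(0 <= i < N) gauss_coef N i.+1 * y ^+ i.+1 -
    \sum_(0 <= i < N) gauss_coef N i * y ^+ i * (y * p ^+ (2 * N.+1)).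
  rewrite -sumrB; apply: eq_big_nat => i /andP[_ iN].
  have := gauss_coefS (N - i.+1) i; rewrite (_ : (N - i.+1 + i).+1 = N)%N; last by lia.
  by move=> ->; rewrite exprS; ring.
by rewrite -mulr_suml gn exprS; ring.
Qed.

Lemma poch_rq n : poch R r q n = od n / p ^+ (n ^ 2).
Proof.
elim: n => [|n IH]; first by rewrite poch0 /od odprod0 expr0 divr1.
rewrite pochS IH odS (_ : n.+1 ^ 2 = n ^ 2 + (2 * n).+1)%N; last by lia.
rewrite exprD /q -exprM -exprS /r exprVn; field.
by rewrite !pX0.
Qed.

Lemma poch_qq n : poch R q q n = ev n / p ^+ (n * n.+1).
Proof.
elim: n => [|n IH]; first by rewrite poch0 /ev evprod0 expr0 divr1.
rewrite pochS IH evS (_ : n.+1 * n.+2 = n * n.+1 + 2 * n.+1)%N; last by lia.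
rewrite exprD -exprS /q -exprM /r exprVn; field.
by rewrite !pX0.
Qed.

Local Notation G := (gap_prod R p).

Let T N k := qbin_term R q (r / q ^+ N) (r * q ^+ N) k * G N (q ^+ k).

(** The coefficient of psi in the sum of [T N], multiplied by p^(N^2) / [od N]. With the same
    normalisation, [psi_num] is the sum of the terms k <= N. *)
Definition psi_den N : R := \sum_(0 <= i < N.+1)
  (-1) ^+ i * p ^+ (i ^ 2 + 2 * i) * (ev N * od (N + i) / (ev i * ev i * ev (N - i) * od N)).

Definition psi_num N : R := \sum_(0 <= k < N.+1)
  (-1) ^+ (N + k) * p ^+ ((N - k) ^ 2) * (ev (2 * N - k) / (ev (N - k) * ev k * od (N - k))).

Let GE N y : G N y = \sum_(0 <= i < N.+1) gauss_coef N i * p ^+ (2 * N * i) * y ^+ i.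
Proof.
have -> : G N y = \prod_(1 <= i < N.+1) (1 - (y * p ^+ (2 * N)) * p ^+ (2 * i)).
  by apply: eq_bigr => i _; rewrite -mulrA -exprD mulnDr.
rewrite gauss_binomial; apply: eq_bigr => i _.
by rewrite exprMn -exprM; ring.
Qed.

(** Expanding the gap product in powers of q^k multiplies the argument of the q-binomial series by
    q^i, so each piece is an instance of [psi_qbin]. *)
Let T_sum N : (0 < N)%N -> is_sum R (T N) (psi r * (psi_den N * od N / p ^+ (N ^ 2))).
Proof.
move=> N0.
have h := is_sum_big R N.+1 (fun i => gauss_coef N i * p ^+ (2 * N * i)) _ _
  (fun i _ => psi_qbin R r r_small r_neq0 N i N0).
have -> : psi r * (psi_den N * od N / p ^+ (N ^ 2)) = \sum_(0 <= i < N.+1)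
   gauss_coef N i * p ^+ (2 * N * i) * (psi r * (poch R r q (N + i) / poch R q q i)).
  rewrite /psi_den -!mulrA mulr_suml mulr_sumr; apply: eq_bigr => i _.
  rewrite poch_rq poch_qq /gauss_coef (_ : (N + i) ^ 2 = N ^ 2 + 2 * N * i + i ^ 2)%N; last by lia.
  rewrite (_ : i ^ 2 + 2 * i = i + i * i.+1)%N; last by lia.
  rewrite (_ : i * i.+1 = i + i ^ 2)%N; last by lia.
  rewrite !exprD; field.
  by rewrite !pX0 !ev0 !od0.
apply: is_sum_ext h => k; rewrite /T GE mulr_sumr; apply: eq_bigr => i _.
rewrite /qbin_term; have -> : (r * q ^+ (N + i)) ^+ k = (r * q ^+ N) ^+ k * (q ^+ k) ^+ i.
  by rewrite exprD mulrA exprMn [(q ^+ i) ^+ k]exprAC.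
ring.
Qed.

Lemma poch_head N k : (k <= N)%N ->
  poch R (r / q ^+ N) q k = (-1) ^+ k * (od N / od (N - k)).
Proof.
elim: k => [|k IH] kN; first by rewrite poch0 subn0 divff // mulr1.
rewrite pochS IH; last by exact: ltnW.
have E : (N - k = (N - k.+1).+1)%N by lia.
have -> : r / q ^+ N * q ^+ k = p ^+ (2 * (N - k.+1)).+1.
  rewrite /q /r -!exprM !exprVn invrK.
  have -> : p ^+ (2 * N) = p ^+ (2 * (N - k.+1)).+1 * p * p ^+ (2 * k).
    by rewrite -exprSr -exprD; congr (p ^+ _); lia.
  by field; rewrite p_neq0 pX0.
rewrite E odS (exprS (-1)); have := pB1 (2 * (N - k.+1)).+1 isT.
have := od0 (N - k.+1); set a := od (N - k.+1); set b := p ^+ (2 * (N - k.+1)).+1 => a0 b0.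
by field; rewrite a0 b0.
Qed.

Lemma prod_one_sub_evens m n : \prod_(1 <= i < n.+1) (1 - p ^+ (2 * (m + i))) = (-1) ^+ n * (ev (m + n) / ev m).
Proof.
elim: n => [|n IH]; first by rewrite big_geq // addn0 divff // mulr1.
by rewrite big_nat_recr //= IH addnS evS exprS; field.
Qed.

Let q_p k m : (k <= m)%N -> q ^+ k * p ^+ (2 * m) = p ^+ (2 * (m - k)).
Proof.
move=> km; rewrite /q /r -exprM exprVn -[in LHS](subnKC km) mulnDr exprD.
by rewrite mulrA mulVf // mul1r.
Qed.

Lemma gap_prod_head N k : (k <= N)%N -> G N (q ^+ k) = (-1) ^+ N * (ev (2 * N - k) / ev (N - k)).
Proof.
move=> kN; rewrite (_ : 2 * N - k = (N - k) + N)%N; last by lia.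
rewrite -prod_one_sub_evens; apply: eq_bigr => i _; rewrite q_p; last by lia.
by congr (1 - p ^+ (2 * _)); lia.
Qed.

Lemma gap_prod_zero N k : (N < k <= 2 * N)%N -> G N (q ^+ k) = 0.
Proof.
(* The factor of index i = k - N is 1 - q^k p^(2k) = 0. *)
move=> h; rewrite /gap_prod (big_cat_nat (n := (k - N)%N)) //=; [|lia|lia].
rewrite [X in _ * X]big_ltn; last by lia.
rewrite q_p; last by lia.
by rewrite (_ : N + (k - N) - k = 0)%N ?muln0 ?expr0 ?subrr ?mul0r ?mulr0 //; lia.
Qed.

Let T_head N : \sum_(0 <= k < (2 * N).+1) T N k = psi_num N * od N / p ^+ (N ^ 2).
Proof.
rewrite (@big_cat_nat _ _ _ N.+1) //=; last by lia.
rewrite [X in _ + X]big1_seq ?addr0; last first.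
  move=> k; rewrite mem_index_iota => /andP[_ h]; rewrite /T gap_prod_zero ?mulr0 //.
rewrite /psi_num -mulrA mulr_suml; apply: eq_big_nat => k; rewrite ltnS => /andP[_ kN].
rewrite /T /qbin_term poch_head // poch_qq gap_prod_head // exprD.
have -> : (r * q ^+ N) ^+ k = (p ^+ (k + 2 * N * k))^-1.
  by rewrite exprMn /q /r -!exprM !exprVn exprD invfM.
have -> : p ^+ (k + 2 * N * k) = p ^+ (k * k.+1) * p ^+ (N ^ 2) / p ^+ ((N - k) ^ 2).
  apply: (mulIf (pX0 ((N - k) ^ 2))); rewrite divfK // -!exprD; congr (p ^+ _).
  by have := subnKC kN; move: (N - k)%N => j <-; clear; nia.
by field; rewrite !pX0 !ev0 !od0.
Qed.

Lemma gap_prod_tail N j : G N (q ^+ ((2 * N).+1 + j)) = poch R q q (N + j) / poch R q q j.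
Proof.
have h0 n : poch R q q n != 0 := poch_qq_neq0 R q q_small n.
rewrite /gap_prod big_nat_rev /=.
have -> : \prod_(1 <= i < N.+1) (1 - q ^+ ((2 * N).+1 + j) * p ^+ (2 * (N + (1 + N.+1 - i.+1)))) =
   \prod_(1 <= i < N.+1) (1 - q * q ^+ (j + i.-1)).
  apply: eq_big_nat => i /andP[i1 iN]; congr (1 - _).
  rewrite (_ : (2 * N).+1 + j = (j + i.-1).+1 + (N + (1 + N.+1 - i.+1)))%N; last by lia.
  rewrite exprD -mulrA q_p // subnn muln0 expr0 mulr1 exprS //.
rewrite big_add1 /=; elim: N => [|n IH]; first by rewrite big_geq // add0n divff.
by rewrite big_nat_recr //= IH addSn pochS [(j + n)%N]addnC; field.
Qed.

Definition psi_tail N j : R := p ^+ (N ^ 2) / od N * T N ((2 * N).+1 + j).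

Lemma psi_tail_sum N : (0 < N)%N ->
  is_sum R (psi_tail N) (psi_den N * psi r - psi_num N).
Proof.
move=> N0; have h := is_sum_unshift _ (2 * N).+1 _ _ (T_sum N N0).
have := is_sumZ _ (p ^+ (N ^ 2) / od N) _ _ h.
rewrite T_head; set u := p ^+ (N ^ 2) / od N * _.
rewrite (_ : u = psi_den N * psi r - psi_num N) // /u.
by field; rewrite pX0 od0.
Qed.

Let tailE N j : psi_tail N j = (-1) ^+ N * p ^+ (N ^ 2) * (r * q ^+ N) ^+ ((2 * N).+1 + j) *
  (poch R r q (N.+1 + j) * poch R q q (N + j)) / (poch R q q ((2 * N).+1 + j) * poch R q q j).
Proof.
have h0 n : poch R q q n != 0 := poch_qq_neq0 R q q_small n.
rewrite /psi_tail /T /qbin_term gap_prod_tail.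
rewrite (_ : (2 * N).+1 + j = N + (N.+1 + j))%N; last by lia.
rewrite pochD poch_head // subnn /od odprod0 divr1 divfK; last by rewrite expf_neq0 // expf_neq0.
have o0 : odprod R x N != 0 := od0 N.
by field; rewrite !h0 o0.
Qed.

Lemma factor_bounds n : 1 / 2 <= `|1 - r * q ^+ n| <= 3 / 2 /\ 3 / 4 <= `|1 - q ^+ n.+1| <= 5 / 4.
Proof.
have b m : (0 < m)%N -> `|r ^+ m| <= 1 / 2 /\ ((1 < m)%N -> `|r ^+ m| <= 1 / 4).
  move=> m0; have := norm_exp_small _ _ r_small m.
  have e1 : 1 / 2 ^+ m <= 1 / 2 :> R.
    by rewrite ler_pM2l // lef_pV2 ?posrE ?exprn_gt0 // -[leLHS]expr1 ler_weXn2l //; lra.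
  move=> h; split; first by lra.
  move=> m1; apply: (le_trans h); rewrite ler_pM2l // lef_pV2 ?posrE ?exprn_gt0 //.
  rewrite (_ : 4 = 2 ^+ 2 :> R); last by ring.
  by rewrite ler_weXn2l //; lra.
have n1 : `|1| = 1 :> R := normr1 R.
split.
  have [h _] := b (2 * n).+1 isT; rewrite /q -exprM -exprS.
  have := ler_normB 1 (r ^+ (2 * n).+1); have := lerB_dist 1 (r ^+ (2 * n).+1); lra.
have n2 : (1 < 2 * n.+1)%N by rewrite mul2S.
have [_ /(_ n2) h] := b (2 * n.+1)%N isT; rewrite /q -exprM.
have := ler_normB 1 (r ^+ (2 * n.+1)); have := lerB_dist 1 (r ^+ (2 * n.+1)); lra.
Qed.

Let zsmall N : (2 <= N)%N -> `|r * q ^+ N| <= 1 / 32.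
Proof.
move=> N2; rewrite /q -exprM -exprS; apply: (le_trans (norm_exp_small _ _ r_small _)).
rewrite ler_pM2l // lef_pV2 ?posrE ?exprn_gt0 // (_ : 32 = 2 ^+ 5 :> R); last by ring.
by rewrite ler_weXn2l //; [lra | move: N2; clear; lia].
Qed.

Lemma ln_poch_bounds a n : `|a| <= 1 / 2 -> poch R a q n != 0 /\ `|ln `|poch R a q n| | <= n%:R * l.
Proof.
move=> a2; have /andP[lo hi] := norm_poch_bounds R q q_small a n a2.
  have i0 : 0 < 2^-1 ^+ n :> R by apply: exprn_gt0; lra.
  have pp : 0 < `|poch R a q n| by apply: lt_le_trans lo.
  rewrite -normr_gt0; split=> //.
  have l2 : ln 2 <= l := ln2_le_lnbase R x hx.
  have n0 : 0 <= n%:R :> R by [].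
  have n2 : n%:R * ln 2 <= n%:R * l by apply: ler_wpM2l.
  rewrite ler_norml; apply/andP; split.
    have : ln (2^-1 ^+ n) <= ln `|poch R a q n| by rewrite ler_ln ?posrE.
    rewrite lnXn ?invr_gt0 // lnV ?posrE // -[X in X <= _ -> _]mulr_natl; lra.
  have : ln `|poch R a q n| <= ln (2 ^+ n) by rewrite ler_ln ?posrE ?exprn_gt0.
  rewrite lnXn // -[X in _ <= X -> _]mulr_natl; lra.
Qed.

(** The denominator [w] is left open so that psi, with (q; q)_n, and Delta, with (r; q)_(n+1), are
    treated at once. The first term decides; its exponent is N^2 - (2N+1)^2 = -(3N^2 + 4N + 1), up
    to O(N) from the Pochhammer products. *)
Lemma tail_sum_bounds N (e : R) (w y u : nat -> R) s : (2 <= N)%N -> `|e| = 1 ->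
  (forall n, w n != 0) -> (forall n, w n.+1 = w n * (1 - y n)) ->
  (forall n, 1 / 2 <= `|1 - y n|) ->
  `|ln `|w (2 * N).+1| | <= (2 * N%:R + 2) * l ->
  (forall j, u j = e * p ^+ (N ^ 2) * (r * q ^+ N) ^+ ((2 * N).+1 + j) *
    (poch R r q (N.+1 + j) * poch R q q (N + j)) / (w ((2 * N).+1 + j)%N * poch R q q j)) ->
  is_sum R u s ->
  s != 0 /\ `|ln `|s| + 3 * l * N%:R ^+ 2| <= 12 * l * N%:R.
Proof.
move=> N2 e1 w0 wS y2 lw uE us.
have decr j : `|u j.+1| <= `|u j| / 4.
  have h0 n : poch R q q n != 0 := poch_qq_neq0 R q q_small n.
  have [_ /andP[a1 a2]] := factor_bounds (N + j).
  have [/andP[b1 b2] _] := factor_bounds (N.+1 + j).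
  have c1 := y2 ((2 * N).+1 + j)%N.
  have [_ /andP[d1 d2]] := factor_bounds j.
  (* The ratio of consecutive terms is r q^N, at most 1/32 since N >= 2, times factors bounded on
     both sides; this suffices for the ratio 1/4. *)
  have hz := zsmall N N2.
  have nz n : 1 - q ^+ n.+1 != 0.
    by have [_ /andP[h _]] := factor_bounds n; rewrite -normr_gt0; lra.
  have ny n : 1 - y n != 0 by have := y2 n; rewrite -normr_gt0; lra.
  have E : u j.+1 = u j * ((r * q ^+ N) * (1 - r * q ^+ (N.+1 + j)) *
     (1 - q ^+ (N + j).+1) / ((1 - y ((2 * N).+1 + j)%N) * (1 - q ^+ j.+1))).
    rewrite !uE !addnS wS !pochS [_ ^+ (_ + j).+1]exprSr -!exprS.
    field; by rewrite !h0 !nz ny w0.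
  rewrite E normrM; apply: ler_wpM2l => //.
  rewrite normrM normfV ler_pdivrMr; last first.
    by rewrite normrM mulr_gt0 //; [move: c1 | move: d1]; lra.
  rewrite 2![`|_ * (1 - _)|]normrM [`|(1 - _) * _|]normrM.
  apply: (@le_trans _ _ (1 / 32 * (3 / 2) * (5 / 4))).
    by apply: ler_pM => //; apply: ler_pM.
  apply: (@le_trans _ _ (4^-1 * (1 / 2 * (3 / 4)))); first lra.
  by apply: ler_wpM2l => //; apply: ler_pM => //; lra.
have [s' hs hs'] := is_sum_first_term R u decr.
rewrite (is_sum_unique _ _ _ _ us hs).
have [a0 la] := ln_poch_bounds r N.+1 r_small; have [b0 lb] := ln_poch_bounds q N q_small.
have t0E : `|u 0%N| = `|p| ^+ (N ^ 2) * (`|p| ^+ ((2 * N).+1 ^ 2))^-1 *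
    (`|poch R r q N.+1| * `|poch R q q N|) / `|w (2 * N).+1|.
  have gen (s1 v z a b c : R) : `|s1 * v * z * (a * b) / c| = `|s1| * `|v| * `|z| * (`|a| * `|b|) / `|c|.
    by rewrite !normrM normfV.
  rewrite uE !addn0 poch0 mulr1 gen; congr (_ * _ * _ / _).
    by rewrite e1 normrX mul1r.
  by rewrite /q /r -exprM -exprS -exprM exprVn normfV normrX mulnn.
have bp : 0 < `|p| by rewrite normr_gt0.
have t0 : 0 < `|u 0%N|.
  by rewrite t0E divr_gt0 ?mulr_gt0 ?invr_gt0 ?exprn_gt0 ?normr_gt0.
have s0 : 0 < `|s'| by move: hs' => /andP[h _]; apply: lt_le_trans h; rewrite divr_gt0.
split; first by rewrite -normr_gt0.
have l2 : ln 2 <= l := ln2_le_lnbase R x hx.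
have ls : `|ln `|s'| - ln `|u 0%N| | <= l.
  case/andP: hs' => lo hi; rewrite ler_norml; apply/andP; split.
    have : ln (`|u 0%N| / 2) <= ln `|s'| by rewrite ler_ln ?posrE ?divr_gt0.
    rewrite ln_div ?posrE //; lra.
  have : ln `|s'| <= ln (2 * `|u 0%N|) by rewrite ler_ln ?posrE ?mulr_gt0.
  rewrite lnM ?posrE //; lra.
have lt : ln `|u 0%N| = - (3 * N%:R ^+ 2 + 4 * N%:R + 1) * l +
    (ln `|poch R r q N.+1| + ln `|poch R q q N| - ln `|w (2 * N).+1|).
  rewrite t0E ln_div ?posrE ?mulr_gt0 ?invr_gt0 ?exprn_gt0 ?normr_gt0 //.
  rewrite lnM ?posrE ?mulr_gt0 ?invr_gt0 ?exprn_gt0 ?normr_gt0 //.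
  rewrite lnM ?posrE ?mulr_gt0 ?invr_gt0 ?exprn_gt0 ?normr_gt0 //.
  rewrite lnM ?posrE ?mulr_gt0 ?invr_gt0 ?exprn_gt0 ?normr_gt0 //.
  rewrite lnV ?posrE ?exprn_gt0 // !lnXn // -/l.
  rewrite -[l *+ (N ^ 2)]mulr_natl -[l *+ _]mulr_natl !natrX -natr1 natrM; ring.
move: ls la lb lw; rewrite lt -!natr1 ?natrM.
set v := ln `|s'|; set a := ln `|poch R r q N.+1|; set b := ln `|poch R q q N|.
set c := ln `|w _|; set n := N%:R => ls la lb lc.
have n2 : 2 <= n by rewrite /n ler_nat.
have nl : 2 * l <= n * l by rewrite ler_pM2r.
rewrite !ler_norml in ls la lb lc *.
have /andP[? ?] := ls; have /andP[? ?] := la; have /andP[? ?] := lb; have /andP[? ?] := lc.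
by apply/andP; split; lra.
Qed.

Lemma psi_form_bounds N : (2 <= N)%N ->
  psi_den N * psi r - psi_num N != 0 /\
  `|ln `|psi_den N * psi r - psi_num N| + 3 * l * N%:R ^+ 2| <= 12 * l * N%:R.
Proof.
move=> N2; have N0 : (0 < N)%N by exact: ltn_trans N2.
have [c0 lc] := ln_poch_bounds q (2 * N).+1 q_small.
apply: (tail_sum_bounds N ((-1) ^+ N) (poch R q q) (fun n => q ^+ n.+1) (psi_tail N)) => //.
- by rewrite normrX normrN normr1 expr1n.
- by move=> n; exact: poch_qq_neq0.
- by move=> n; rewrite pochS exprS.
- by move=> n; have [_] := factor_bounds n; lra.
- apply: (le_trans lc); apply: ler_wpM2r; first exact: ltW.
  by rewrite -natr1 natrM; lra.
by apply: psi_tail_sum.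
Qed.

Lemma ln_psi_den_le N : ln `|psi_den N| <= 3 * l * N%:R ^+ 2 + 12 * l * N%:R.
Proof.
have l2 : ln 2 <= l := ln2_le_lnbase R x hx.
have n0 : 0 <= N%:R :> R by [].
apply: (le_trans (ln_sum_le _ _ (3 * l * N%:R ^+ 2 + 11 * l * N%:R) l N _ l2 _)).
- by rewrite addr_ge0 // mulr_ge0 ?sqr_ge0 // mulr_ge0 // ltW.
- move=> i; rewrite ltnS => iN; apply: ln_le_expR.
  have bp : 0 < `|p| by rewrite normr_gt0.
  have evp n : 0 < `|ev n| by rewrite normr_gt0.
  have odp n : 0 < `|od n| by rewrite normr_gt0.
  rewrite !normrM normfV !normrM !normrX normrN normr1 expr1n mul1r.
  rewrite lnM ?posrE ?divr_gt0 ?mulr_gt0 ?exprn_gt0 //.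
  rewrite ln_div ?posrE ?mulr_gt0 // !lnM ?posrE ?mulr_gt0 // lnXn // -/l.
  rewrite -[l *+ _]mulr_natl natrD natrX natrM.
  have /andP[_ h1] := ln_evprod_bounds R x hx N.
  have /andP[_ h2] := ln_odprod_bounds R x hx (N + i).
  have /andP[h3 _] := ln_evprod_bounds R x hx i.
  have /andP[h4 _] := ln_evprod_bounds R x hx (N - i).
  have /andP[h5 _] := ln_odprod_bounds R x hx N.
  have iN' : i%:R <= N%:R :> R by rewrite ler_nat.
  have i0 : 0 <= i%:R :> R by [].
  rewrite natrD in h2; rewrite natrB // in h4.
  move: h1 h2 h3 h4 h5; rewrite -/p -/l -/ev -/od.
  set a := ln `|ev N|; set b := ln `|od _|; set c := ln `|ev i|; set d := ln `|ev (N - i)|.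
  set f := ln `|od N|; set n := N%:R; set m := i%:R => h1 h2 h3 h4 h5.
  (* The i-th summand has leading exponent 4Ni - i^2, and 3N^2 - (4Ni - i^2) = (N-i)(3N-i): the
     maximum is at i = N. *)
  have k1 : 0 <= l * ((n - m) * (3 * n - m)).
    by rewrite mulr_ge0 ?(ltW l_gt0) // mulr_ge0 ?subr_ge0 //; move: iN' i0 n0; rewrite -/n -/m; lra.
  have k2 : l * m <= l * n by rewrite ler_pM2l.
  have k3 : 0 <= l * n by rewrite mulr_ge0 // ltW.
  by move: h1 h2 h3 h4 h5 k1 k2 k3; lra.
lra.
Qed.

Lemma psi_measure : irrational (psi r) /\ (irrationality_measure (psi r) <= (18 / 7)%:E)%E.
Proof.
have -> : 18 / 7 = 1 + (3 * l + 2 / 3 * l) / (3 * l - 2 / 3 * l) :> R.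
  by field; rewrite !gt_eqF //; move: l_gt0; lra.
have c0 n : 0 <= 12 * l * n%:R :> R by rewrite !mulr_ge0 // ltW.
apply: (@irrationality_criterion_ln _ _ _ _ _ (12 * l) (evcycprod R x) psi_den psi_num).
- by move: l_gt0; lra.
- by move: l_gt0; lra.
- by exists 0%N => // n _; exact: evcycprod_neq0.
- exists 0%N => // N _; split.
    rewrite /psi_den mulr_sumr big_nat rpred_sum // => i; rewrite ltnS => /andP[_ iN].
    rewrite mulrCA rpredM //; first by rewrite rpredM ?rpredX ?rpredN ?rpred1 ?intr_int.
    exact: evcycprod_qbin_int.
  rewrite rpredM //.
    (* At i = 0 the quotient is 1, so this says that [evcycprod] itself is an integer. *)
    have := evcycprod_qbin_int R x hx N 0 (leq0n N).
    by rewrite /= addn0 subn0 evprod0 !mul1r divff ?mulr1 ?mulf_neq0.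
  rewrite /psi_num big_nat rpred_sum // => k; rewrite ltnS => /andP[_ kN].
  rewrite rpredM //; first by rewrite rpredM ?rpredX ?rpredN ?rpred1 ?intr_int.
  exact: qbin_mixed_int.
- by exists 2%N => // N N2; have [] := psi_form_bounds N N2.
- move=> e e0; exists 0%N => // N _.
  apply: (le_trans (ln_evcycprod_le R x hx N)); rewrite -/p -/l.
  have h1 : 0 <= e * N%:R ^+ 2 by rewrite mulr_ge0 ?sqr_ge0 // ltW.
  have h2 : 0 <= l * N%:R by rewrite mulr_ge0 // ltW.
  by move: h1 h2; lra.
- by exists 0%N => // N _; rewrite ln_psi_den_le.
by exists 2%N => // N N2; have [] := psi_form_bounds N N2.
Qed.
End PsiApproximants.

(** * Approximants of Delta *)

(* In the induction step the coefficient at the new pole is the identity for [n]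
   evaluated at that pole. *)
Lemma partial_fractions (F : fieldType) (a t : nat -> F) n y :
  (forall i, (i <= n)%N -> t i != 0) ->
  (forall i j, (i < j <= n)%N -> t i != t j) ->
  (forall i, (i <= n)%N -> 1 - t i * y != 0) ->
  \prod_(0 <= i < n) (1 - a i * y) / \prod_(0 <= i < n.+1) (1 - t i * y) =
  \sum_(0 <= l < n.+1) (\prod_(0 <= i < n) (1 - a i / t l) /
     \prod_(0 <= i < n.+1 | i != l) (1 - t i / t l)) / (1 - t l * y).
Proof.
elim: n y => [|n IH] y t0 tt ty.
  rewrite !big_nat1 [X in _ / X / _]big_mkcond big_nat1 /= !(big_geq (leqnn 0)); by rewrite ?divr1.
have t0' i : (i <= n)%N -> t i != 0 by move=> h; apply: t0; exact: leqW.
have tt' i j : (i < j <= n)%N -> t i != t j.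
  by move=> /andP[ij jn]; apply: tt; rewrite ij leqW.
have tn i : (i <= n)%N -> t i != t n.+1 by move=> h; apply: tt; rewrite ltnS h leqnn.
have ty' i : (i <= n)%N -> 1 - t i * y != 0 by move=> h; apply: ty; exact: leqW.
have tz i : (i <= n)%N -> 1 - t i / t n.+1 != 0.
  move=> h; rewrite subr_eq0; apply/negP => /eqP e; have := tn i h.
  by rewrite -[t i](divfK (t0 n.+1 (leqnn _))) -e mul1r eqxx.
have tz' i : (i <= n)%N -> 1 - t n.+1 / t i != 0.
  move=> h; rewrite subr_eq0; apply/negP => /eqP e; have := tn i h.
  by rewrite -[t n.+1](divfK (t0' i h)) -e mul1r eqxx.
have IHy := IH y t0' tt' ty'; have IHt := IH (t n.+1)^-1 t0' tt' tz.
set C := fun l => \prod_(0 <= i < n) (1 - a i / t l) / \prod_(0 <= i < n.+1 | i != l) (1 - t i / t l) in IHy IHt.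
rewrite [RHS]big_nat_recr //= (big_nat_recr n.+1 _ (fun i => 1 - t i * y)) //=.
rewrite [X in X / _ = _]big_nat_recr //=.
have last : \prod_(0 <= i < n.+2 | i != n.+1) (1 - t i / t n.+1) = \prod_(0 <= i < n.+1) (1 - t i / t n.+1).
  rewrite big_mkcond big_nat_recr //= eqxx mulr1; apply: eq_big_nat => i /andP[_ h].
  by rewrite neq_ltn h.
have E (u v w z : F) : u * v / (w * z) = u / w * (v / z) by rewrite invfM mulrACA.
rewrite last (big_nat_recr n _ (fun i => 1 - a i / t n.+1)) //= E IHy.
rewrite [X in _ = _ + X / _]mulrAC IHt !mulr_suml -big_split.
apply: eq_big_nat => l /andP[_ ln].
rewrite (big_nat_recr n _ (fun i => 1 - a i / t l)) //=.
have -> : \prod_(0 <= i < n.+2 | i != l) (1 - t i / t l) =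
    \prod_(0 <= i < n.+1 | i != l) (1 - t i / t l) * (1 - t n.+1 / t l).
  by rewrite big_mkcond big_nat_recr //= [n.+1 != l]neq_ltn ln orbT -big_mkcond.
rewrite E -/(C l); move: (C l) => c.
have h1 := ty' l ln; have h2 := ty n.+1 (leqnn _); have h3 := tz l ln; have h4 := tz' l ln.
have h5 := t0' l ln; have h6 := t0 n.+1 (leqnn _).
have h7 : t l - t n.+1 != 0 by rewrite subr_eq0 tn.
have h8 : t n.+1 - t l != 0 by rewrite subr_eq0 eq_sym tn.
move: h1 h2 h5 h6 h7 h8; move: (t l) (t n.+1) (a n) => b d e h1 h2 h5 h6 h7 h8.
field.
by rewrite ?h1 ?h2 ?h5 ?h6 ?h7 ?h8.
Qed.

(* [2k+1] divides [2m+1] exactly when [m] is congruent to [k] modulo [2k+1]. *)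
Lemma num_divisors_odd m M : (m < M)%N ->
  num_divisors m.*2.+1 = (\sum_(0 <= k < M) (m %% (2 * k).+1 == k))%N.
Proof.
move=> mM; set P := fun k => (m %% (2 * k).+1 == k)%N.
have -> : (\sum_(0 <= k < M) P k = size [seq (2 * k).+1 | k <- iota 0 M & P k])%N.
  rewrite size_map size_filter -sum1_count [RHS]big_mkcond /= /index_iota subn0.
  by apply: eq_bigr => k _; case: (P k).
apply: perm_size; apply: uniq_perm.
- exact: divisors_uniq.
- by rewrite map_inj_uniq ?filter_uniq ?iota_uniq // => i j [] /eqP; rewrite eqn_pmul2l // => /eqP.
have dP k : ((2 * k).+1 %| m.*2.+1)%N = P k.
  have E : (m.*2.+1 + 2 * k = (2 * k).+1 + 2 * m)%N by rewrite -mul2n; lia.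
  have kk : (k < (2 * k).+1)%N by lia.
  have -> : P k = (m == k %[mod (2 * k).+1])%N by rewrite /P [(k %% _)%N]modn_small.
  rewrite -(eqn_modDr k.+1).
  have -> : (k + k.+1 = (2 * k).+1)%N by lia.
  rewrite modnn -/(dvdn _ _) (_ : m.*2.+1 = (m + k.+1) + (m + k.+1) - (2 * k).+1)%N; last first.
    by rewrite -mul2n; lia.
  rewrite dvdn_subl ?dvdnn //; last by lia.
  rewrite addnn -mul2n Gauss_dvdr //.
  by rewrite coprimen2 /= oddM.
move=> d; rewrite -dvdn_divisors //; apply/idP/mapP => [dm|[k]].
  have od : odd d by apply: dvdn_odd dm _; rewrite /= odd_double.
  have dE : d = (2 * d./2).+1 by have := odd_double_half d; rewrite od; lia.
  have dm2 : (d <= m.*2.+1)%N by exact: dvdn_leq.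
  exists d./2 => //; rewrite mem_filter mem_iota -dP -dE dm /=; lia.
by rewrite mem_filter => /andP[Pk _] ->; rewrite dP.
Qed.

(** What remains of a geometric series over a residue class is again geometric, starting at the
    first exponent e >= M of the class. *)
Lemma residue_class_sum (R : realType) (r : R) k M : `|r| < 1 -> exists2 e, (M <= e)%N &
  r ^+ k / (1 - r ^+ (2 * k).+1) - \sum_(0 <= m < M) (m %% (2 * k).+1 == k)%N%:R * r ^+ m =
  r ^+ e / (1 - r ^+ (2 * k).+1).
Proof.
move=> r1; set d := (2 * k).+1.
have d0 : 1 - r ^+ d != 0.
  have : `|r ^+ d| < 1 by rewrite normrX exprn_ilt1.
  by rewrite subr_eq0; apply: contraTneq => <-; rewrite normr1 ltxx.
(* The bound e < M + d, added for the induction, makes e the unique exponent of the class in that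
   window. *)
suff [e /andP[/andP[Me _] _] h] : exists2 e, (M <= e < M + d)%N && (e %% d == k)%N &
    r ^+ k / (1 - r ^+ d) - \sum_(0 <= m < M) (m %% d == k)%N%:R * r ^+ m = r ^+ e / (1 - r ^+ d).
  by exists e.
elim: M => [|M [e /andP[/andP[Me eM] /eqP ek] h]].
  by exists k; rewrite ?big_geq ?subr0 // modn_small ?eqxx /d /=; lia.
have [Mk|Mk] := eqVneq (M %% d)%N k; last first.
  exists e.
    rewrite ek eqxx andbT; apply/andP; split; last by lia.
    by rewrite ltn_neqAle Me andbT; apply: contra_neq Mk => ->.
  by rewrite big_nat_recr //= (negPf Mk) mul0r addr0.
have eE : e = M.
  have : (e == M %[mod d])%N by rewrite ek Mk.
  rewrite -[in X in X -> _](subnK Me) -[X in _ == X %[mod _]]add0n eqn_modDr mod0n => /eqP.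
  by rewrite modn_small; lia.
exists (M + d)%N.
  by rewrite modnDr Mk eqxx andbT; apply/andP; split; rewrite /d; lia.
rewrite big_nat_recr //= opprD addrA h eE Mk eqxx mul1r exprD; by field.
Qed.

Lemma Delta_lambert (R : realType) (r : R) : `|r| <= 1 / 2 ->
  is_sum R (fun k => r ^+ k / (1 - r * (r ^+ 2) ^+ k)) (Delta r).
Proof.
move=> r2; have r1 : `|r| < 1 by lra.
have den k : 1 / 2 <= `|1 - r ^+ (2 * k).+1|.
  have := norm_exp_small R r r2 (2 * k).+1.
  have : 1 / 2 ^+ (2 * k).+1 <= 1 / 2 :> R.
    by rewrite ler_pM2l // lef_pV2 ?posrE ?exprn_gt0 // -[leLHS]expr1 ler_weXn2l //; lra.
  have := lerB_dist 1 (r ^+ (2 * k).+1); rewrite normr1; lra.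
have inv k : `|(1 - r ^+ (2 * k).+1)^-1| <= 2.
  have h := den k; rewrite normfV -[leRHS]invrK lef_pV2 ?posrE ?invr_gt0 //; lra.
have uE k : r ^+ k / (1 - r * (r ^+ 2) ^+ k) = r ^+ k / (1 - r ^+ (2 * k).+1).
  by rewrite -exprM -exprS.
have z01 : 0 <= (2^-1 : R) < 1 by lra.
have [k|s hs _] := is_sum_geo_bound R 2 2^-1 (fun k => r ^+ k / (1 - r * (r ^+ 2) ^+ k)) z01.
  rewrite uE normrM mulrC; apply: ler_pM => //.
  by apply: (le_trans (norm_exp_small R r r2 k)); rewrite div1r exprVn.
suff hd : series (fun m => (num_divisors m.*2.+1)%:R * r ^+ m) @ \oo --> s.
  by rewrite /Delta (cvg_lim _ hd).
have dE M : series (fun m => (num_divisors m.*2.+1)%:R * r ^+ m) M =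
    \sum_(0 <= k < M) \sum_(0 <= m < M) (m %% (2 * k).+1 == k)%N%:R * r ^+ m.
  rewrite exchange_big /=; apply: eq_big_nat => m /andP[_ mM].
  by rewrite (num_divisors_odd _ _ mM) natr_sum mulr_suml.
(* Instead of rearranging a double series, partial sums of equal length M are compared: they differ
   by M geometric tails, each at most 2 2^-M. *)
have close : (fun M => series (fun k => r ^+ k / (1 - r * (r ^+ 2) ^+ k)) M -
    series (fun m => (num_divisors m.*2.+1)%:R * r ^+ m) M) @ \oo --> 0.
  apply: (@cvg_le_harmonic _ _ _ 16 0) => M _; rewrite subr0 dE /series -sumrB.
  apply: (@le_trans _ _ (\sum_(0 <= k < M) 2 * 2^-1 ^+ M)).
    apply: (le_trans (ler_norm_sum _ _ _)); apply: ler_sum => k _; rewrite uE.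
    have [e Me ->] := residue_class_sum _ _ k M r1.
    rewrite normrM mulrC; apply: ler_pM => //.
    apply: (le_trans (norm_exp_small R r r2 e)); rewrite div1r exprVn.
    by rewrite lef_pV2 ?posrE ?exprn_gt0 // ler_weXn2l //; lra.
  rewrite sumr_const_nat subn0 -[leLHS]mulr_natl exprVn mulrA.
  have h : (M * M.+1 <= 8 * 2 ^ M)%N.
    have := sqr_le_exp2 M; have : (M < 2 ^ M)%N by rewrite ltn_expl.
    by move: (2 ^ M)%N => X; nia.
  rewrite ler_pdivrMr ?exprn_gt0 // mulrAC ler_pdivlMr //.
  by rewrite -natrX -!natrM ler_nat; nia.
set g := series _; set h := series _ in hs close.
rewrite (_ : g = fun M => h M - (h M - g M)); last by apply/funext => M; rewrite opprB addrC subrK.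
by rewrite -[s]subr0; apply: cvgB hs close.
Qed.

(** * The linear forms in Delta *)

Section DeltaApproximants.
Variables (R : realType) (x : int).
Hypothesis hx : 2 <= `|x|.
Let p : R := x%:~R.
Let r : R := p^-1.
Let q : R := r ^+ 2.
Let l : R := ln `|p|.
Let ev := evprod R x.
Let od := odprod R x.

Let p_neq0 : p != 0. Proof. exact: base_neq0. Qed.
Let pX0 n : p ^+ n != 0. Proof. exact: expf_neq0. Qed.
Let r_neq0 : r != 0. Proof. by rewrite invr_eq0. Qed.
Let q_neq0 : q != 0. Proof. exact: expf_neq0. Qed.
Let r_small : `|r| <= 1 / 2. Proof. exact: base_inv_small. Qed.
Let q_small : `|q| <= 1 / 2. Proof. exact: sqr_small. Qed.
Let l_gt0 : 0 < l. Proof. exact: lnbase_gt0. Qed.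
Let ev0 n : ev n != 0. Proof. exact: evprod_neq0. Qed.
Let od0 n : od n != 0. Proof. exact: odprod_neq0. Qed.
Let odS n : od n.+1 = od n * (p ^+ (2 * n).+1 - 1). Proof. exact: odprodS. Qed.
Let pB1 n : (0 < n)%N -> p ^+ n - 1 != 0. Proof. exact: expB1_neq0. Qed.

(** Up to a sign and a power of p, the coefficient at the j-th pole in the partial fractions of
    [T N]. *)
Definition delta_weight N j : R := od (2 * N - j).+1 / (od (N - j).+1 * ev j * ev (N - j)).

Definition delta_den N : R := \sum_(0 <= j < N.+1)
  (-1) ^+ j * p ^+ ((N - j) ^ 2 + N) * delta_weight N j.

(** The first sum consists of the terms k <= N before the gap. The inner sums are the rational
    corrections made when the series at pole j is reduced to Delta: N of them change its argument, j
    of them shift the pole. *)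
Definition delta_num N : R :=
  \sum_(0 <= k < N.+1) (-1) ^+ k * p ^+ ((N - k) ^ 2 + k.+1) *
    (ev (2 * N - k) / (ev (N - k) * od k.+1 * od (N - k))) +
  \sum_(0 <= j < N.+1) (-1) ^+ j * p ^+ ((N - j) ^ 2) * delta_weight N j *
    (\sum_(0 <= i < N) p ^+ (N + i.+1) / (p ^+ (2 * i).+1 - 1) +
     \sum_(0 <= i < j) p ^+ ((2 * N).+1 * i.+1) / (p ^+ (2 * i).+1 - 1)).

Let pole_den N k := \prod_(0 <= i < N.+1) (1 - r * p ^+ (2 * i) * q ^+ k).

Let T N k := (r * q ^+ N) ^+ k * gap_prod R p N (q ^+ k) / pole_den N k.

Let pX_inj m n : p ^+ m = p ^+ n -> m = n.
Proof.
have p2 : 2 <= `|p| := base_ge2 R x hx.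
move=> /(congr1 Num.norm); rewrite !normrX; apply: ieexprIn; first by lra.
by rewrite gt_eqF //; lra.
Qed.

Let pole_q j k : r * p ^+ (2 * j) * q ^+ k = p ^+ (2 * j) / p ^+ (2 * k).+1.
Proof. by rewrite /q -exprM /r exprVn exprS invfM mulrAC [LHS]mulrC. Qed.

(** A zero would equate an even and an odd power of p. *)
Let pole_neq j k : 1 - r * p ^+ (2 * j) * q ^+ k != 0.
Proof.
rewrite pole_q subr_eq0; apply/negP => /eqP e.
have : p ^+ (2 * k).+1 = p ^+ (2 * j) by rewrite -[RHS](divfK (pX0 (2 * k).+1)) -e mul1r.
by move/pX_inj; lia.
Qed.

Let pole_denE N k : pole_den N k = poch R (r / q ^+ N * q ^+ k) q N.+1.
Proof.
rewrite /pole_den /poch big_nat_rev /=; apply: eq_big_nat => i /andP[_ iN].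
congr (1 - _); rewrite add0n subSS.
have -> : p ^+ (2 * (N - i)) = q ^+ i / q ^+ N.
  rewrite /q -!exprM /r !exprVn invrK; apply: (mulfI (pX0 (2 * i))).
  by rewrite mulrA divff // mul1r -exprD; congr (p ^+ _); lia.
by field; rewrite expf_neq0.
Qed.

Let pole_den_tail N m : pole_den N (N + m) = poch R r q (N + m).+1 / poch R r q m.
Proof.
have [h _] := ln_poch_bounds R x hx r m r_small.
apply: (mulIf h); rewrite divfK // pole_denE exprD mulrA divfK ?expf_neq0 //.
by rewrite mulrC -pochD; congr (poch _ _ _ _); lia.
Qed.

(** The Pochhammer product of r/q^N of length N+k+1 is split at k and at N; both initial parts are
    given by [poch_head]. *)
Let pole_den_head N k : (k <= N)%N ->
  pole_den N k = (-1) ^+ (N + k) * (od k.+1 * od (N - k)) / p ^+ (k.+1 ^ 2).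
Proof.
move=> kN; have h : poch R (r / q ^+ N) q k != 0.
  by rewrite poch_head // mulf_neq0 ?expf_neq0 ?oppr_eq0 ?oner_neq0 // mulf_neq0 ?invr_neq0.
apply: (mulfI h); rewrite pole_denE -pochD (_ : k + N.+1 = N + k.+1)%N; last by lia.
rewrite pochD divfK ?expf_neq0 // !poch_head // subnn poch_rq // -/p -/od.
rewrite [od 0]odprod0 exprD.
have s1 : (-1) ^+ k * (-1) ^+ k = 1 :> R by rewrite -exprD addnn -signr_odd odd_double.
have -> : (-1) ^+ k * (od N / od (N - k)) * ((-1) ^+ N * (-1) ^+ k * (od k.+1 * od (N - k)) / p ^+ (k.+1 ^ 2))
   = ((-1) ^+ k * (-1) ^+ k) * ((-1) ^+ N * od N * (od k.+1 / p ^+ (k.+1 ^ 2))).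
  by field; rewrite pX0 od0.
by rewrite s1 mul1r divr1 mulrA.
Qed.

Let T_head N : p ^+ (N ^ 2) * \sum_(0 <= k < (2 * N).+1) T N k =
  \sum_(0 <= k < N.+1) (-1) ^+ k * p ^+ ((N - k) ^ 2 + k.+1) *
    (ev (2 * N - k) / (ev (N - k) * od k.+1 * od (N - k))).
Proof.
rewrite (@big_cat_nat _ _ _ N.+1) //=; last by lia.
rewrite [X in _ + X]big1_seq ?addr0; last first.
  by move=> k; rewrite mem_index_iota => /andP[_ h]; rewrite /T gap_prod_zero // mulr0 mul0r.
rewrite mulr_sumr; apply: eq_big_nat => k; rewrite ltnS => /andP[_ kN].
rewrite /T pole_den_head // gap_prod_head //.
have -> : (r * q ^+ N) ^+ k = (p ^+ (k + 2 * N * k))^-1.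
  by rewrite exprMn /q /r -!exprM !exprVn exprD invfM.
have -> : p ^+ ((N - k) ^ 2 + k.+1) = p ^+ (N ^ 2) * p ^+ (k.+1 ^ 2) / p ^+ (k + 2 * N * k).
  apply: (mulIf (pX0 (k + 2 * N * k))); rewrite divfK // -!exprD; congr (p ^+ _).
  by have := subnKC kN; move: (N - k)%N => j <-; clear; nia.
have s0 : (-1) ^+ N != 0 :> R by rewrite expf_neq0 // oppr_eq0 oner_neq0.
have s1 : (-1) ^+ k != 0 :> R by rewrite expf_neq0 // oppr_eq0 oner_neq0.
have -> : (-1) ^+ (N + k) = (-1) ^+ N / (-1) ^+ k :> R by rewrite -exprVn invrN invr1 exprD.
move: s0 s1; set a := (-1) ^+ N; set b := (-1) ^+ k => a0 b0; rewrite -/p -/ev.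
by field; rewrite a0 b0 !pX0 !ev0 !od0.
Qed.

Let prod_one_sub_odds m n :
  \prod_(0 <= i < n) (1 - p ^+ (2 * (m + i)).+1) = (-1) ^+ n * (od (m + n) / od m).
Proof.
elim: n => [|n IH]; first by rewrite big_geq // addn0 divff // mulr1.
by rewrite big_nat_recr //= IH addnS odS (exprS (-1)); move: (p ^+ _) => z; field.
Qed.

Let residueE N j : (j <= N)%N ->
  \prod_(0 <= i < N) (1 - p ^+ (2 * (N + i.+1)) / (r * p ^+ (2 * j))) /
  \prod_(0 <= i < N.+1 | i != j) (1 - r * p ^+ (2 * i) / (r * p ^+ (2 * j))) =
  (-1) ^+ j * p ^+ (j * j.+1) * delta_weight N j.
Proof.
move=> jN.
have -> : \prod_(0 <= i < N) (1 - p ^+ (2 * (N + i.+1)) / (r * p ^+ (2 * j))) =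
    (-1) ^+ N * (od (2 * N - j).+1 / od (N - j).+1).
  rewrite (_ : (2 * N - j).+1 = (N - j).+1 + N)%N; last by lia.
  rewrite -prod_one_sub_odds; apply: eq_big_nat => i _; congr (1 - _).
  apply: (mulIf (pX0 (2 * j))); rewrite invfM /r invrK mulrA divfK // -exprSr -exprD.
  by congr (p ^+ _); lia.
have -> : \prod_(0 <= i < N.+1 | i != j) (1 - r * p ^+ (2 * i) / (r * p ^+ (2 * j))) =
    poch R q q j * ((-1) ^+ (N - j) * ev (N - j)).
  rewrite (@big_cat_nat _ _ _ j) //=; last by lia.
  congr (_ * _).
    rewrite big_nat_rev /= big_mkcond /poch; apply: eq_big_nat => i /andP[_ ij].
    rewrite add0n ifT; last by lia.
    congr (1 - _); rewrite -mulf_div divff // mul1r -exprS /q -exprM /r exprVn.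
    apply: (mulIf (pX0 (2 * j))); rewrite divfK //; apply: (mulIf (pX0 (2 * i.+1))).
    by rewrite [RHS]mulrAC mulVf // mul1r -exprD; congr (p ^+ _); lia.
  rewrite big_ltn_cond ?eqxx /=; last by lia.
  have -> : (-1) ^+ (N - j) * ev (N - j) = (-1) ^+ (N - j) * (ev (0 + (N - j)) / ev 0).
    by rewrite add0n [ev 0]evprod0 divr1.
  rewrite -prod_one_sub_evens // -/p -[j.+1]add1n big_addn (_ : N.+1 - j = (N - j).+1)%N; last by lia.
  rewrite big_mkcond; apply: eq_big_nat => i /andP[i1 _]; rewrite ifT; last by lia.
  congr (1 - _); rewrite -mulf_div divff // mul1r; apply: (mulIf (pX0 (2 * j))); rewrite divfK //.
  by rewrite -exprD; congr (p ^+ _); lia.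
rewrite poch_qq // -/p -/ev /delta_weight.
have -> : (-1) ^+ N = (-1) ^+ j * (-1) ^+ (N - j) :> R by rewrite -exprD; congr (_ ^+ _); lia.
have s0 n : (-1) ^+ n != 0 :> R by rewrite expf_neq0 // oppr_eq0 oner_neq0.
by field; rewrite s0 !pX0 !ev0 !od0.
Qed.

(** As functions of q^k the numerator has degree N and the denominator N+1 simple poles, so there is
    no polynomial part. *)
Let T_expand N k : T N k = \sum_(0 <= j < N.+1) (-1) ^+ j * p ^+ (j * j.+1) * delta_weight N j *
  ((r * q ^+ N) ^+ k / (1 - r * p ^+ (2 * j) * q ^+ k)).
Proof.
rewrite /T -mulrA.
have -> : gap_prod R p N (q ^+ k) = \prod_(0 <= i < N) (1 - p ^+ (2 * (N + i.+1)) * q ^+ k).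
  by rewrite /gap_prod big_add1 /=; apply: eq_bigr => i _; rewrite mulrC.
rewrite (partial_fractions _ (fun i => p ^+ (2 * (N + i.+1))) (fun i => r * p ^+ (2 * i))); first last.
- by move=> i _; exact: pole_neq.
- move=> i j /andP[ij _]; apply/negP => /eqP /(mulfI r_neq0) /pX_inj; lia.
- by move=> i _; rewrite mulf_neq0.
rewrite mulr_sumr; apply: eq_big_nat => j; rewrite ltnS => /andP[_ jN].
by rewrite residueE // mulrCA.
Qed.

Let rq_small n : `|r * q ^+ n| <= 1 / 2.
Proof.
rewrite /q -exprM -exprS; apply: (le_trans (norm_exp_small _ _ r_small _)).
by rewrite ler_pM2l // lef_pV2 ?posrE ?exprn_gt0 // -[leLHS]expr1 ler_weXn2l //; lra.
Qed.

(** Since r q^k / (1 - r q^k) = 1/(1 - r q^k) - 1, every step subtracts a geometric series with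
    rational sum and multiplies by p. *)
Let lambert_shift n : is_sum R (fun k => (r * q ^+ n) ^+ k / (1 - r * q ^+ k))
  (p ^+ n * (Delta r - \sum_(0 <= i < n) p ^+ i.+1 / (p ^+ (2 * i).+1 - 1))).
Proof.
elim: n => [|n IH].
  rewrite big_geq // subr0 mul1r mulr1; exact: Delta_lambert.
have z1 : `|r * q ^+ n| < 1 by have := rq_small n; lra.
have geo : is_sum R (fun k => (r * q ^+ n) ^+ k) (1 - r * q ^+ n)^-1.
  have := @cvg_geometric_series R 1 _ z1; rewrite mul1r; apply: is_sum_ext => k.
  by rewrite /geometric /= mul1r.
have nz k : 1 - r * q ^+ k != 0.
  by have [/andP[h _] _] := factor_bounds R x hx k; rewrite -normr_gt0; lra.
have := is_sumZ R p _ _ (is_sumB R _ _ _ _ IH geo).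
have -> : p * (p ^+ n * (Delta r - \sum_(0 <= i < n) p ^+ i.+1 / (p ^+ (2 * i).+1 - 1)) - (1 - r * q ^+ n)^-1) =
   p ^+ n.+1 * (Delta r - \sum_(0 <= i < n.+1) p ^+ i.+1 / (p ^+ (2 * i).+1 - 1)).
  rewrite big_nat_recr //= (_ : 1 - r * q ^+ n = (p ^+ (2 * n).+1 - 1) / p ^+ (2 * n).+1); last first.
    rewrite mulrBl divff // mul1r /q -exprM -exprS /r exprVn //.
  rewrite invf_div (_ : (2 * n).+1 = n + n.+1)%N; last by lia.
  have : p ^+ (n + n.+1) - 1 != 0 by apply: pB1; lia.
  rewrite !exprD !exprS.
  by move: (\sum_(0 <= i < n) _) (p ^+ n) (Delta r) => A B C h; field.
apply: is_sum_ext => k; rewrite exprSr mulrA [in RHS]exprMn -[(q ^+ 1) ^+ k]exprM mul1n.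
have -> : p = r^-1 by rewrite /r invrK.
by field; rewrite r_neq0 nz.
Qed.

(** As p^2 q = 1, moving from pole j to pole j+1 shifts the summation index by one; the new initial
    terms form the finite sum. *)
Let pole_sum N j F : is_sum R (fun k => (r * q ^+ N) ^+ k / (1 - r * q ^+ k)) F ->
  is_sum R (fun k => (r * q ^+ N) ^+ k / (1 - r * p ^+ (2 * j) * q ^+ k))
    ((r * q ^+ N) ^+ j * F - \sum_(0 <= i < j) (r * q ^+ N) ^+ (j - i.+1) / (p ^+ (2 * i).+1 - 1)).
Proof.
move=> hF; elim: j => [|j IH].
  by rewrite big_geq // subr0 mul1r; apply: is_sum_ext hF => k; rewrite mulr1.
have h := is_sumZ R (r * q ^+ N) _ _ IH.
have -> : (r * q ^+ N) ^+ j.+1 * F -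
     \sum_(0 <= i < j.+1) (r * q ^+ N) ^+ (j.+1 - i.+1) / (p ^+ (2 * i).+1 - 1) =
   \sum_(0 <= k < 1) (r * q ^+ N) ^+ k / (1 - r * p ^+ (2 * j.+1) * q ^+ k) +
   (r * q ^+ N * ((r * q ^+ N) ^+ j * F - \sum_(0 <= i < j) (r * q ^+ N) ^+ (j - i.+1) / (p ^+ (2 * i).+1 - 1))).
  rewrite big_nat1 expr0 mulr1 big_nat_recr //= subnn expr0 mulrBr mulrA -exprS mulr_sumr.
  have -> : r * p ^+ (2 * j.+1) = p ^+ (2 * j).+1.
    by rewrite (_ : 2 * j.+1 = (2 * j).+2)%N; [rewrite exprS mulrA mulVf // mul1r | lia].
  have -> : \sum_(0 <= i < j) (r * q ^+ N) ^+ (j.+1 - i.+1) / (p ^+ (2 * i).+1 - 1) =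
     \sum_(0 <= i < j) r * q ^+ N * ((r * q ^+ N) ^+ (j - i.+1) / (p ^+ (2 * i).+1 - 1)).
    apply: eq_big_nat => i /andP[_ ij]; rewrite mulrA -exprS; congr (_ ^+ _ / _); lia.
  have := pB1 (2 * j).+1 isT; have -> : 1 - p ^+ (2 * j).+1 = - (p ^+ (2 * j).+1 - 1) by rewrite opprB.
  by rewrite invrN !mul1r => _; ring.
apply: is_sum_shift; apply: is_sum_ext h => k.
rewrite add1n mulrA -exprS; congr (_ / (1 - _)).
rewrite (_ : 2 * j.+1 = 2 * j + 2)%N; last by lia.
rewrite exprD [q ^+ k.+1]exprS (_ : p ^+ 2 = q^-1); last by rewrite /q /r exprVn invrK.
by field.
Qed.

Definition delta_tail N j : R := p ^+ (N ^ 2) * T N ((2 * N).+1 + j).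

Let u_weight N j i : (j <= N)%N -> (i <= j)%N ->
  p ^+ (N ^ 2) * p ^+ (j * j.+1) * (r * q ^+ N) ^+ (j - i) =
  p ^+ ((N - j) ^ 2) * p ^+ ((2 * N).+1 * i).
Proof.
move=> jN ij; rewrite /q -exprM -exprS -exprM /r exprVn.
apply: (mulIf (pX0 ((2 * N).+1 * (j - i)))); rewrite divfK // -!exprD; congr (p ^+ _).
have := subnKC jN; have := subnKC ij; move: (N - j)%N (j - i)%N => a b <- <-; nia.
Qed.

Lemma delta_tail_sum N : is_sum R (delta_tail N) (delta_den N * Delta r - delta_num N).
Proof.
have hT := is_sum_big R N.+1 (fun j => (-1) ^+ j * p ^+ (j * j.+1) * delta_weight N j) _ _
  (fun j _ => pole_sum N j _ (lambert_shift N)).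
have := is_sumZ R (p ^+ (N ^ 2)) _ _ (is_sum_unshift R (2 * N).+1 _ _
  (is_sum_ext R _ _ _ (fun k => esym (T_expand N k)) hT)).
rewrite mulrBr T_head; set t := (X in is_sum R _ X -> _) => h.
suff -> : delta_den N * Delta r - delta_num N = t by exact: h.
rewrite /t /delta_num opprD addrA [LHS]addrAC; congr (_ - _).
rewrite /delta_den mulr_suml mulr_sumr -sumrB; apply: eq_big_nat => j; rewrite ltnS => /andP[_ jN].
set A := \sum_(0 <= i < N) p ^+ i.+1 / (p ^+ (2 * i).+1 - 1).
have -> : \sum_(0 <= i < N) p ^+ (N + i.+1) / (p ^+ (2 * i).+1 - 1) = p ^+ N * A.
  by rewrite mulr_sumr; apply: eq_bigr => i _; rewrite exprD mulrA.
set B := \sum_(0 <= i < j) p ^+ ((2 * N).+1 * i.+1) / _.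
have hB : p ^+ (N ^ 2) * p ^+ (j * j.+1) *
    \sum_(0 <= i < j) (r * q ^+ N) ^+ (j - i.+1) / (p ^+ (2 * i).+1 - 1) = p ^+ ((N - j) ^ 2) * B.
  rewrite !mulr_sumr; apply: eq_big_nat => i /andP[_ ij].
  by rewrite mulrA u_weight // -mulrA.
have hu := u_weight N j 0 jN (leq0n j); rewrite subn0 muln0 expr0 mulr1 in hu.
rewrite exprD; move: hu hB; set C := \sum_(0 <= i < j) _.
move: (delta_weight N j) (Delta r) => W D hu hB.
have -> : p ^+ (N ^ 2) * ((-1) ^+ j * p ^+ (j * j.+1) * W * ((r * q ^+ N) ^+ j * (p ^+ N * (D - A)) - C)) =
  (-1) ^+ j * W * (p ^+ (N ^ 2) * p ^+ (j * j.+1) * (r * q ^+ N) ^+ j * (p ^+ N * (D - A)) -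
     p ^+ (N ^ 2) * p ^+ (j * j.+1) * C).
  by move: (r * q ^+ N) => u; ring.
by rewrite hu hB; ring.
Qed.

Let delta_tailE N j : delta_tail N j = p ^+ (N ^ 2) * (r * q ^+ N) ^+ ((2 * N).+1 + j) *
  (poch R r q (N.+1 + j) * poch R q q (N + j)) / (poch R r q ((2 * N).+1 + j).+1 * poch R q q j).
Proof.
rewrite /delta_tail /T gap_prod_tail //.
rewrite [X in pole_den N X](_ : _ = N + (N.+1 + j))%N; last by lia.
rewrite pole_den_tail (_ : N + (N.+1 + j) = (2 * N).+1 + j)%N; last by lia.
have h a n : `|a| <= 1 / 2 -> poch R a q n != 0 by move=> ha; have [] := ln_poch_bounds R x hx a n ha.
have h1 := h r (N.+1 + j)%N r_small; have h2 := h r ((2 * N).+1 + j).+1 r_small.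
have h3 := h q j q_small; rewrite -/p -/r -/q.
by field; rewrite h1 h2 h3.
Qed.

Lemma delta_form_bounds N : (2 <= N)%N ->
  delta_den N * Delta r - delta_num N != 0 /\
  `|ln `|delta_den N * Delta r - delta_num N| + 3 * l * N%:R ^+ 2| <= 12 * l * N%:R.
Proof.
move=> N2; have [_ lw] := ln_poch_bounds R x hx r (2 * N).+2 r_small.
apply: (tail_sum_bounds R x hx N 1 (fun n => poch R r q n.+1) (fun n => r * q ^+ n.+1) (delta_tail N)) => //.
- exact: normr1.
- by move=> n; have [] := ln_poch_bounds R x hx r n.+1 r_small.
- by move=> n; rewrite pochS.
- by move=> n; have [/andP[]] := factor_bounds R x hx n.+1.
- by apply: (le_trans lw); rewrite -!natr1 natrM /l -/p; lra.
- by move=> j; rewrite mul1r delta_tailE.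
exact: delta_tail_sum.
Qed.

Lemma ln_delta_den_le N : (0 < N)%N -> ln `|delta_den N| <= 3 * l * N%:R ^+ 2 + 12 * l * N%:R.
Proof.
move=> N0; have l2 : ln 2 <= l := ln2_le_lnbase R x hx.
have n1 : 1 <= N%:R :> R by rewrite (ler_nat _ 1).
apply: (le_trans (ln_sum_le _ _ (3 * l * N%:R ^+ 2 + 11 * l * N%:R) l N _ l2 _)).
- by rewrite addr_ge0 // mulr_ge0 ?sqr_ge0 // mulr_ge0 // ltW.
- move=> j; rewrite ltnS => jN; apply: ln_le_expR.
  have bp : 0 < `|p| by rewrite normr_gt0.
  have evp n : 0 < `|ev n| by rewrite normr_gt0.
  have odp n : 0 < `|od n| by rewrite normr_gt0.
  rewrite /delta_weight !normrM normfV !normrM !normrX normrN normr1 expr1n mul1r.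
  rewrite lnM ?posrE ?divr_gt0 ?mulr_gt0 ?exprn_gt0 //.
  rewrite ln_div ?posrE ?mulr_gt0 // !lnM ?posrE ?mulr_gt0 // lnXn // -/l.
  rewrite -[l *+ _]mulr_natl natrD natrX.
  have /andP[_ h1] := ln_odprod_bounds R x hx (2 * N - j).+1.
  have /andP[h2 _] := ln_odprod_bounds R x hx (N - j).+1.
  have /andP[h3 _] := ln_evprod_bounds R x hx j.
  have /andP[h4 _] := ln_evprod_bounds R x hx (N - j).
  have jN' : j%:R <= N%:R :> R by rewrite ler_nat.
  have j0 : 0 <= j%:R :> R by [].
  have E1 : (2 * N - j).+1%:R = 2 * N%:R - j%:R + 1 :> R.
    by rewrite -natr1 natrB ?natrM // (leq_trans jN) // leq_pmull.
  have E2 : (N - j).+1%:R = N%:R - j%:R + 1 :> R by rewrite -natr1 natrB.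
  rewrite E1 in h1; rewrite E2 in h2; rewrite natrB // in h4 *.
  move: h1 h2 h3 h4; rewrite -/p -/l -/ev -/od.
  set a := ln `|od (2 * N - j).+1|; set b := ln `|od _|; set c := ln `|ev j|; set d := ln `|ev (N - j)|.
  set n := N%:R; set m := j%:R => h1 h2 h3 h4.
  (* The j-th summand has leading exponent 3N^2 - 2Nj - j^2, largest at j = 0. *)
  have k1 : 0 <= l * m by rewrite mulr_ge0 // ltW.
  have k2 : 0 <= l * (n * m) by rewrite !mulr_ge0 ?(ltW l_gt0).
  have k3 : l * 1 <= l * n by rewrite ler_pM2l.
  have k4 : 0 <= l * m ^+ 2 by rewrite !mulr_ge0 ?sqr_ge0 ?(ltW l_gt0).
  have k5 : 0 <= l := ltW l_gt0.
  by move: h1 h2 h3 h4 k1 k2 k3 k4 k5; lra.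
lra.
Qed.

Lemma evcycprod_int N : evcycprod R x N \is a Num.int.
Proof.
have := evcycprod_qbin_int R x hx N 0 (leq0n N).
by rewrite /= addn0 subn0 evprod0 !mul1r divff ?mulr1 ?mulf_neq0.
Qed.

Lemma Delta_measure : irrational (Delta r) /\
  (irrationality_measure (Delta r) <= (18 * pi ^+ 2 / (7 * pi ^+ 2 - 24))%:E)%E.
Proof.
(* This crude bound is enough for b > d: it gives 2/3 + 8/pi^2 <= 2/3 + 2 < 3. *)
have pi4 : 4 <= pi ^+ 2 :> R.
  by have := @pi_ge2 R; have -> : 4 = 2 ^+ 2 :> R by [ring]; move=> h; rewrite lerXn2r ?nnegrE //; lra.
have pi0 : (pi : R) ^+ 2 != 0 by rewrite gt_eqF //; lra.
have i8 : 8 / pi ^+ 2 <= 2 :> R by rewrite ler_pdivrMr; lra.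
have i0 : 0 < 8 / pi ^+ 2 :> R by rewrite divr_gt0 //; lra.
pose d := (2 / 3 + 8 / pi ^+ 2) * l.
have d0 : 0 < d by rewrite mulr_gt0 //; lra.
have bd : 0 < 3 * l - d.
  by rewrite -mulrBl mulr_gt0 //; lra.
have -> : 18 * pi ^+ 2 / (7 * pi ^+ 2 - 24) = 1 + (3 * l + d) / (3 * l - d) :> R.
  have l0 : l != 0 by rewrite gt_eqF.
  move: bd; rewrite /d; move: (pi ^+ 2 : R) pi4 pi0 => P P4 P0 bd.
  have P1 : 7 * P - 24 != 0 by rewrite gt_eqF //; lra.
  by rewrite -mulrDl -mulrBl -mulf_div divff // mulr1; field; rewrite P0 gt_eqF //; lra.
apply: (@irrationality_criterion_ln _ _ _ _ _ (12 * l)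
  (fun n => evcycprod R x n * oddcycprod R x n) delta_den delta_num).
- by move: d0 l_gt0; lra.
- exact: bd.
- by exists 0%N => // n _; rewrite mulf_neq0 ?evcycprod_neq0 ?oddcycprod_neq0.
- exists 0%N => // N _; split.
    rewrite mulrAC rpredM ?oddcycprod_int //.
    rewrite /delta_den mulr_sumr big_nat rpred_sum // => j; rewrite ltnS => /andP[_ jN].
    rewrite mulrCA rpredM //; first by rewrite rpredM ?rpredX ?rpredN ?rpred1 ?intr_int.
    exact: evcycprod_residue_int.
  rewrite /delta_num mulrDr rpredD //.
    rewrite -mulrA rpredM ?evcycprod_int // mulr_sumr big_nat rpred_sum // => k.
    rewrite ltnS => /andP[_ kN].
    rewrite mulrCA rpredM //; first by rewrite rpredM ?rpredX ?rpredN ?rpred1 ?intr_int.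
    exact: oddcycprod_head_int.
  rewrite mulr_sumr big_nat rpred_sum // => j; rewrite ltnS => /andP[_ jN].
  set s := _ + _; have -> : evcycprod R x N * oddcycprod R x N *
     ((-1) ^+ j * p ^+ ((N - j) ^ 2) * delta_weight N j * s) =
     ((-1) ^+ j * p ^+ ((N - j) ^ 2)) * (evcycprod R x N * delta_weight N j) * (oddcycprod R x N * s) by ring.
  rewrite rpredM //.
    rewrite rpredM //; first by rewrite rpredM ?rpredX ?rpredN ?rpred1 ?intr_int.
    exact: evcycprod_residue_int.
  have frac n k : (n <= N)%N -> oddcycprod R x N * (p ^+ k / (p ^+ (2 * n).+1 - 1)) \is a Num.int.
    by move=> nN; rewrite mulrCA rpredM ?rpredX ?intr_int // oddcycprod_factor_int.
  rewrite /s mulrDr !mulr_sumr rpredD // big_nat rpred_sum // => i /andP[_ iN]; apply: frac.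
    exact: ltnW.
  exact: leq_trans (ltnW iN) jN.
- by exists 2%N => // N N2; have [] := delta_form_bounds N N2.
- move=> e e0; have e2 : 0 < e / (2 * l) by rewrite divr_gt0 // mulr_gt0.
  have [K K0 hK] := ln_oddcycprod_le R x hx _ e2.
  have e2' : 0 < e / 2 by rewrite divr_gt0.
  have [M _ hM] := near_linear_le R (K * l) _ e2'.
  exists M.+1 => // N /= MN; have hN := hM N (ltnW MN).
  have N1 : 1 <= N%:R :> R by rewrite (ler_nat _ 1); exact: leq_ltn_trans MN.
  have Kl : K * l * 1 <= K * l * N%:R by apply: ler_wpM2l => //; rewrite mulr_ge0 // ltW.
  rewrite normrM lnM ?posrE ?normr_gt0 ?evcycprod_neq0 ?oddcycprod_neq0 //.
  have h1 := ln_evcycprod_le R x hx N; have h2 := hK N.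
  have h3 : 0 <= l * N%:R by rewrite mulr_ge0 // ltW.
  apply: (le_trans (lerD h1 h2)); rewrite -/p -/l /d; move: (8 / pi ^+ 2) => w.
  have -> : (w + e / (2 * l)) * N%:R ^+ 2 = w * N%:R ^+ 2 + e / 2 * N%:R ^+ 2 / l.
    by rewrite mulrDl invfM; ring.
  have E : (w * N%:R ^+ 2 + e / 2 * N%:R ^+ 2 / l + K) * l =
      w * l * N%:R ^+ 2 + e / 2 * N%:R ^+ 2 + K * l.
    by rewrite !mulrDl divfK ?gt_eqF //; ring.
  rewrite E; move: hN Kl h3; rewrite /=; lra.
- by exists 1%N => // N N1; rewrite ln_delta_den_le.
by exists 2%N => // N N2; have [] := delta_form_bounds N N2.
Qed.
End DeltaApproximants.

Theorem theorem1p4 (R : realType) (x : int) (hx : 2 <= `|x|) :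
  let r : R := x%:~R^-1 in
  [/\ irrational (psi r), irrational (Delta r) & irrational (B4 r)] /\
  [/\ (irrationality_measure (psi r) <= (18 / 7)%:E)%E,
      (irrationality_measure (Delta r)
         <= (18 * pi ^+ 2 / (7 * pi ^+ 2 - 24))%:E)%E &
      (irrationality_measure (B4 r) <= 3%:E)%E].
Proof.
have [psi_irr psi_le] := psi_measure R x hx.
have [Delta_irr Delta_le] := Delta_measure R x hx.
by have [B4_irr B4_le] := B4_measure R x hx.
Qed.
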